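(* Let $k = k(n)$ and $m = m(n)$ be positive integers, both tending to infinity as $n \to \infty$, with $\lim_{n\to\infty} m/n^k = c$ for some constant $c \in (0,\infty)$ and $\lim_{n \to\infty} k/n = 0$. Let $(\tau_j)_{j \ge 1}$ be a sequence of positive real numbers such that for every $q \in \mathbb{N}$ the limit $m_q^{(\tau)} = \lim_{M \to \infty} \frac{1}{M} \sum_{j=1}^M \tau_j^q$ exists and is finite, and such that, for some positive constant $A$, $|m_q^{(\tau)}| \le A^q q^q$ for all $q \in \mathbb{N}$. For each $n$, let $\mathbf{y}$ be a random vector uniformly distributed on the unit sphere $S^{2n-1}$ of $\mathbb{C}^n$, let $\{\mathbf{y}_\alpha^{(l)} : 1 \le \alpha \le m, 1 \le l \le k\}$ be i.i.d. copies of $\mathbf{y}$, let $Y_\alpha = \mathbf{y}_\alpha^{(1)} \otimes \cdots \otimes \mathbf{y}_\alpha^{(k)} \in \mathbb{C}^{n^k}$, and let $$M_{n,k,m}' = \sum_{\alpha=1}^m \tau_\alpha Y_\alpha Y_\alpha^*.$$ Then there exists a (deterministic) probability distribution function $F_c$ such that $$\lim_{n \to \infty} F^{M_{n,k,m}'} = F_c \quad \text{in probability},$$ where $F^{M_{n,k,m}'}$ is the empirical spectral distribution function of $M_{n,k,m}'$. Moreover, if $\tau_\alpha = 1$ for all $\alpha$, then $F_c$ is the distribution function of the Marčenko–Pastur law $$\frac{\sqrt{((1+\sqrt{c})^2-x)(x-(1-\sqrt{c})^2)}}{2\pi x} \mathbf{1}_{[(1-\sqrt{c})^2,(1+\sqrt{c})^2]}(x)\,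 dx + (1-c)\, \mathbf{1}_{\{0<c<1\}}\, \delta_0(dx).$$
   Context: The $k$-fold tensor (outer) product $Y_\alpha$ has entries $(Y_\alpha)_{(j_1,\ldots,j_k)} = \prod_{l=1}^k (\mathbf{y}_\alpha^{(l)})_{j_l}$ for $1 \le j_1,\ldots,j_k \le n$, and is identified with a column vector in $\mathbb{C}^{n^k}$; $*$ is conjugate transpose. For an $N \times N$ Hermitian matrix $A$ with eigenvalues $\lambda_1,\ldots,\lambda_N$ (with multiplicity), the empirical spectral distribution function is $F^A(x) = \frac{1}{N}\sum_{i=1}^N \mathbf{1}_{\{\lambda_i \le x\}}$, $x \in \mathbb{R}$. Convergence $F^{M_{n,k,m}'} \to F_c$ in probability means $L(F^{M_{n,k,m}'}, F_c) \to 0$ in probability, where $L$ is the Lévy distance of distribution functions: $L(F,G) = \inf\{\varepsilon > 0 : F(x-\varepsilon) - \varepsilon \le G(x) \le F(x+\varepsilon)+\varepsilon \ \text{for all } x \in \mathbb{R}\}$. Here $\mathbb{N}$ denotes the positive integers. *)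

(* Defs.v *)
From HB Require Import structures.
From mathcomp Require Import all_boot all_order all_algebra.
From mathcomp Require Import complex.
From mathcomp Require Import all_classical all_reals all_analysis.

Set Implicit Arguments.
Unset Strict Implicit.
Unset Printing Implicit Defensive.

Import Order.TTheory GRing.Theory Num.Theory.
Import numFieldNormedType.Exports.

Local Open Scope classical_set_scope.
Local Open Scope ring_scope.
Local Open Scope complex_scope.
Local Open Scope sesquilinear_scope.

HB.instance Definition _ (R : realType) := isPointed.Build R[i] 0.

Definition coord_preimages (R : realType) (n : nat) : set (set 'cV[R[i]]_n) :=
  [set A | exists (j : 'I_n) (B : set R), measurable B /\
     (A = [set v : 'cV[R[i]]_n | B (complex.Re (v j 0))] \/
      A = [set v : 'cV[R[i]]_n | B (complex.Im (v j 0))])].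

(* C^n with its Borel sigma-algebra, i.e. the product sigma-algebra of the 2n
   real coordinates *)
Definition Cvec (R : realType) (n : nat) :=
  g_sigma_algebraType (@coord_preimages R n).
HB.instance Definition _ (R : realType) (n : nat) := Measurable.on (Cvec R n).

Definition sqnorm (R : realType) (n : nat) (v : 'cV[R[i]]_n) : R :=
  \sum_(j < n) (complex.Re (v j 0) ^+ 2 + complex.Im (v j 0) ^+ 2).

(* The uniform distribution on S^(2n-1), as the (unique) Borel probability
   measure on C^n = R^(2n) carried by the sphere and invariant under O(2n); the
   elements of O(2n) are given as the isometries f of R^(2n) fixing 0. *)
Definition uniform_on_sphere (R : realType) (n : nat)
    (mu : probability (Cvec R n) R) : Prop :=
  mu [set v | sqnorm v = 1] = 1%E /\
  forall f : 'cV[R[i]]_n -> 'cV[R[i]]_n,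
    f 0 = 0 -> (forall u v, sqnorm (f u - f v) = sqnorm (u - v)) ->
    forall B : set (Cvec R n), measurable B -> mu (f @^-1` B) = mu B.

Definition mutually_independent d d' (T : measurableType d)
    (T' : measurableType d') (R : realType) (P : probability T R)
    (I : finType) (X : I -> {RV P >-> T'}) : Prop :=
  forall B : I -> set T', (forall i, measurable (B i)) ->
    P (\bigcap_(i in [set: I]) (X i @^-1` B i)) =
    (\prod_(i : I) P (X i @^-1` B i))%E.

(* The coordinates of C^(n^k) are the multi-indices (j_1, ..., j_k), enumerated
   by [enum_val]. *)
Definition tensor (R : realType) (n k : nat) (y : 'I_k -> 'cV[R[i]]_n) :
    'cV[R[i]]_#|{ffun 'I_k -> 'I_n}| :=
  \col_a \prod_(l < k) y l ((enum_val a : {ffun 'I_k -> 'I_n}) l) 0.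

(* [tau] is indexed from 0: [tau j] stands for tau_(j+1) *)
Definition sample_mx (R : realType) (n k m : nat) (tau : nat -> R)
    (y : 'I_m -> 'I_k -> 'cV[R[i]]_n) : 'M[R[i]]_#|{ffun 'I_k -> 'I_n}| :=
  \sum_(alpha < m)
    (tau alpha)%:C *: (tensor (y alpha) *m (tensor (y alpha)) ^t*).

(* roots of the characteristic polynomial, listed with multiplicity *)
Definition eigenvalues (R : realType) (N : nat) (A : 'M[R[i]]_N) : seq R[i] :=
  sval (closed_field_poly_normal (char_poly A)).

(* Only meant for Hermitian matrices, whose eigenvalues are real: Re z is then
   just z read in R. *)
Definition esd (R : realType) (N : nat) (A : 'M[R[i]]_N) (x : R) : R :=
  (count (fun z => complex.Re z <= x) (eigenvalues A))%:R / N%:R.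

Definition levy_dist (R : realType) (F G : R -> R) : R :=
  inf [set e : R | 0 < e /\
    forall x, F (x - e) - e <= G x /\ G x <= F (x + e) + e].

(* The variables may live on different probability spaces. *)
Definition cvg0_in_probability (R : realType) (d : nat -> measure_display)
    (T : forall n, measurableType (d n)) (P : forall n, probability (T n) R)
    (X : forall n, T n -> R) : Prop :=
  forall e : R, 0 < e ->
    P n [set w | e < `|X n w|] @[n --> \oo] --> 0%E.

Definition mp_density (R : realType) (c x : R) : R :=
  let a := (1 - Num.sqrt c) ^+ 2 in
  let b := (1 + Num.sqrt c) ^+ 2 in
  Num.sqrt ((b - x) * (x - a)) / (2 * pi * x) * \1_`[a, b] x.

Definition mp_law (R : realType) (c : R) (B : set R) : \bar R :=
  ((\int[lebesgue_measure]_(x in B) (mp_density c x)%:E) +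
   (if c < 1 then 1 - c else 0)%R%:E * \d_(0%R : R) B)%E.

(* Main.v *)
(* The argument follows the Stieltjes transform on the negative half-line. Let
   s_n(t) = N^-1 tr (M + t)^-1, with N = n^k and t > 0. Removing the summand
   tau_a Y_a Y_a^* from M turns the identity N = tr ((M + t) (M + t)^-1) into
   1 = t s_n + N^-1 sum_a tau_a x_a / (1 + tau_a x_a), where x_a = Y_a^* G_a Y_a
   and G_a, the resolvent without the a-th summand, is independent of Y_a. The
   second and fourth moments of the uniform distribution on the sphere show that
   x_a has variance O(k / n) around N^-1 tr G_a, so s_n(t) converges in
   probability to the root s of 1 = t s + c lim M^-1 sum_(j < M) tau_j s / (1 + tau_j s).
   That last limit exists because the moment bound A^q q^q makes the averages of
   tau_j^q e^(-u tau_j) converge for every u >= 0.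

   Difference quotients in t give the limits of all the averages of
   (lambda + 1)^-p over the spectrum, polynomials in (x + 1)^-1 approximate
   indicators of [0, a] from both sides, and the trace bound gives tightness:
   this yields the limiting distribution function and the Levy convergence. When
   all tau_j = 1 the root s is the Stieltjes transform of the Marchenko-Pastur
   law, computed by an explicit primitive. *)
Require Import Defs.
From HB Require Import structures.
From mathcomp Require Import all_boot all_order all_algebra.
From mathcomp Require Import complex.
From mathcomp Require Import all_classical all_reals all_analysis.
From mathcomp Require Import measurable_realfun ring lra zify.
Import Order.TTheory GRing.Theory Num.Theory.
Import numFieldNormedType.Exports.
Local Open Scope classical_set_scope.
Local Open Scope ring_scope.

Set Implicit Arguments.
Unset Strict Implicit.
Unset Printing Implicit Defensive.

(** * Expectations over finite powers of a probability space *)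

(** On the negative half-line everything is real and monotone: the denominators 1 + tau_a x_a are at
    least 1, and the residual of the limiting equation decreases in s at rate at least t, so a small
    residual at once places s_n(t) near the root. The weights may be unbounded; removing one summand
    is therefore measured by the trace bound 1 / t, in which tau does not appear, and the remaining
    errors are weighted by tau_a, whose average converges.

    The condition k / n -> 0 enters through one count. The fourth moments of a tensor carry the
    denominator (n (n + 1))^k and allow two index pairings per factor; their excess over the
    products of second moments is governed by ((n + 1)^k - n^k) / (n + 1)^k, which is at most k / (n
    + 1).

    The moment bound gives exponential Taylor expansions a positive radius that does not depend on
    the base point, hence a continuation in steps along u >= 0; 1 / (1 + s x) is then a
    superposition of exponentials.

    The sample spaces change with n, so convergence in probability is handled through outer measure,
    and measurability of the Levy distance is settled separately. *)

Section BoundedMeasurable.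
Context d (T : measurableType d) (R : realType).
Implicit Types f g : T -> R.

(** A bound that holds everywhere, and not just almost everywhere, makes integrability automatic on
    a probability space and survives the substitution of a coordinate. *)
Definition bm f := measurable_fun setT f /\ exists M : R, forall x, `|f x| <= M.

Lemma bm_cst (r : R) : bm (fun=> r).
Proof. by split => //; exists `|r|. Qed.

Lemma bmD f g : bm f -> bm g -> bm (fun x => f x + g x).
Proof.
move=> [mf [M fM]] [mg [N gN]]; split; first exact: measurable_funD.
by exists (M + N) => x; rewrite (le_trans (ler_normD _ _)) ?lerD.
Qed.

Lemma bmN f : bm f -> bm (fun x => - f x).
Proof.
move=> [mf [M fM]]; split; first exact: measurableT_comp.
by exists M => x; rewrite normrN.
Qed.

Lemma bmB f g : bm f -> bm g -> bm (fun x => f x - g x).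
Proof. by move=> bf bg; apply: bmD => //; apply: bmN. Qed.

Lemma bmM f g : bm f -> bm g -> bm (fun x => f x * g x).
Proof.
move=> [mf [M fM]] [mg [N gN]]; split; first exact: measurable_funM.
by exists (M * N) => x; rewrite normrM ler_pM.
Qed.

Lemma bm_abs f : bm f -> bm (fun x => `|f x|).
Proof.
move=> [mf [M fM]]; split; first exact: measurableT_comp.
by exists M => x; rewrite normr_id.
Qed.

Lemma bm_sum I (r : seq I) (F : I -> T -> R) :
  (forall i, bm (F i)) -> bm (fun x => \sum_(i <- r) F i x).
Proof.
move=> bF; elim: r => [|i r IH].
  by under eq_fun do rewrite big_nil; exact: bm_cst.
by under eq_fun do rewrite big_cons; exact: bmD.
Qed.

Section Expectation.
Variable P : probability T R.

Definition Ex f : R := Rintegral P setT f.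

Lemma bm_integrable f : bm f -> P.-integrable setT (EFin \o f).
Proof.
move=> [mf [M fM]]; apply: measurable_bounded_integrable => //.
  by rewrite (le_lt_trans (probability_le1 P measurableT)) ?ltry.
by exists M; split; rewrite ?num_real// => x Mx t _ /=; apply: le_trans (ltW Mx).
Qed.

Lemma Ex_cst r : Ex (fun=> r) = r.
Proof. by rewrite /Ex Rintegral_cst// [X in fine X](probability_setT P) mulr1. Qed.

Lemma ExD f g : bm f -> bm g -> Ex (fun x => f x + g x) = Ex f + Ex g.
Proof. by move=> bf bg; apply: RintegralD => //; exact: bm_integrable. Qed.

Lemma ExB f g : bm f -> bm g -> Ex (fun x => f x - g x) = Ex f - Ex g.
Proof. by move=> bf bg; apply: RintegralB => //; exact: bm_integrable. Qed.

Lemma ExZ r f : bm f -> Ex (fun x => r * f x) = r * Ex f.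
Proof. by move=> bf; apply: RintegralZl => //; exact: bm_integrable. Qed.

Lemma le_Ex f g : bm f -> bm g -> (forall x, f x <= g x) -> Ex f <= Ex g.
Proof.
move=> bf bg fg; apply: le_Rintegral => //; exact: bm_integrable.
Qed.

Lemma Ex_sum I (r : seq I) (F : I -> T -> R) :
  (forall i, bm (F i)) -> Ex (fun x => \sum_(i <- r) F i x) = \sum_(i <- r) Ex (F i).
Proof.
move=> bF; elim: r => [|i r IH].
  by under eq_fun do rewrite big_nil; rewrite Ex_cst big_nil.
under eq_fun do rewrite big_cons; rewrite ExD//; last exact: bm_sum.
by rewrite IH big_cons.
Qed.

Lemma eq_Ex_ae f g (N : set T) : bm f -> bm g -> measurable N -> P N = 0%E ->
  (forall x, ~ N x -> f x = g x) -> Ex f = Ex g.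
Proof.
move=> bf bg mN N0 fg; rewrite /Ex /Rintegral; congr fine.
rewrite (@negligible_integral _ _ _ P setT N)//; last exact: bm_integrable.
rewrite [RHS](@negligible_integral _ _ _ P setT N)//; last exact: bm_integrable.
by apply: eq_integral => x /set_mem [_ nN]; rewrite fg.
Qed.

Lemma markov_bm f (e : R) : bm f -> (forall x, 0 <= f x) -> 0 < e ->
  (P [set x | (e < f x)%R] <= (Ex f / e)%:E)%E.
Proof.
move=> bf f0 e0; have mf : measurable_fun setT f by case: bf.
have mA : measurable [set x : T | (e < f x)%R].
  rewrite (_ : mkset _ = setT `&` f @^-1` `]e, +oo[%classic).
    exact: mf (measurable_itv _).
  by rewrite setTI; apply/seteqP; split => x /=; rewrite in_itv /= andbT.
have fin := @bm_integrable f bf.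
rewrite EFinM lee_pdivlMr//.
rewrite /Ex fineK; last exact: integrable_fin_num.
rewrite muleC -integral_cst//.
apply: (@le_trans _ _ (\int[P]_(x in [set x | (e < f x)%R]) (f x)%:E)%E).
  apply: ge0_le_integral => //=.
  - by move=> _ _; rewrite lee_fin ltW.
  - by apply/measurable_EFinP; apply: measurable_funTS.
  - by move=> x ex; rewrite lee_fin ltW.
apply: ge0_subset_integral => //=; first exact/measurable_EFinP.
by move=> x _; rewrite lee_fin.
Qed.

End Expectation.
End BoundedMeasurable.

(** * Resampling one coordinate under a product law *)

Section Peel.
Context d (V : measurableType d) (R : realType) (I : finType).

Definition rects : set (set (I -> V)) :=
  [set A | exists B : I -> set V, (forall i, measurable (B i)) /\
     A = [set z | forall i, B i (z i)]].

(** A finite power of [V] as a function space. No product measure is built on it: a law [nu] is only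
    asked to factor over rectangles, which the joint law of an independent sample does. *)
Definition prodT := g_sigma_algebraType rects.
HB.instance Definition _ := Measurable.on prodT.

Definition upd (z : I -> V) (i : I) (v : V) : I -> V :=
  fun j => if j == i then v else z j.

Lemma measurable_rect (B : I -> set V) : (forall i, measurable (B i)) ->
  measurable ([set z : prodT | forall i, B i (z i)]).
Proof. by move=> mB; apply: sub_sigma_algebra; exists B. Qed.

Lemma measurable_coord i : measurable_fun setT (fun z : prodT => z i).
Proof.
move=> _ B mB; rewrite setTI.
rewrite (_ : _ @^-1` _ = [set z : prodT | forall j, (if j == i then B else setT) (z j)]).
  by apply: (@measurable_rect (fun j => if j == i then B else setT)) => j; case: ifP.
apply/seteqP; split => z /=; first by move=> Bz j; case: eqP => // ->.
by move=> /(_ i); rewrite eqxx.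
Qed.

Lemma measurable_to_prodT d' (S : measurableType d') (F : S -> prodT) :
  (forall i, measurable_fun setT (fun s => F s i)) -> measurable_fun setT F.
Proof.
move=> mF; apply: (@measurability _ _ _ _ setT F rects erefl).
move=> _ [_ [B [mB ->]]] <-; rewrite setTI.
rewrite (_ : _ @^-1` _ = \bigcap_(i in [set: I]) ((fun s => F s i) @^-1` B i)).
  apply: fin_bigcap_measurable => // i _.
  by rewrite -[X in measurable X]setTI; apply: mF.
by apply/seteqP; split => z /= H i => [_|]; exact: H.
Qed.

Lemma measurable_upd i : measurable_fun setT (fun p : V * prodT => upd p.2 i p.1 : prodT).
Proof.
apply: measurable_to_prodT => j; rewrite /upd; case: eqP => _.
  exact: measurable_fst.
by apply: (measurableT_comp (measurable_coord j)); exact: measurable_snd.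
Qed.

Variables (nu : probability prodT R) (mu : probability V R).
Hypothesis nu_rect : forall B : I -> set V, (forall i, measurable (B i)) ->
  nu [set z | forall i, B i (z i)] = (\prod_i mu (B i))%E.

(** Replacing coordinate [i] by an independent copy does not change the law: both measures agree on
    rectangles, which form a generating family stable under intersection. *)
Lemma prod_upd i (A : set prodT) : measurable A ->
  pushforward (mu \x nu)%E (fun p : V * prodT => upd p.2 i p.1 : prodT) A = nu A.
Proof.
move=> mA.
have mupd := measurable_upd i.
pose m1 := pushforward (mu \x nu)%E (fun p : V * prodT => upd p.2 i p.1 : prodT).
apply: (@measure_unique _ _ prodT rects (fun=> setT) _ _ _ _ m1 nu) => //.
- move=> _ _ [B [mB ->]] [C [mC ->]]; exists (fun j => B j `&` C j); split.
    by move=> j; apply: measurableI.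
  by apply/seteqP; split => z /= => [[Bz Cz] j|H]; [split|split => j; case: (H j)].
- by move=> _; exists (fun=> setT); split => //; apply/seteqP; split.
- by rewrite bigcup_const.
- move=> _ [B [mB ->]]; rewrite /m1 /pushforward.
  have E : (fun p : V * prodT => upd p.2 i p.1 : prodT) @^-1` [set z | forall j, B j (z j)] =
    B i `*` [set z : prodT | forall j, (if j == i then setT else B j) (z j)].
    apply/seteqP; split => -[v z] /=; rewrite /upd.
      move=> H; split; first by have := H i; rewrite eqxx.
      by move=> j; have := H j; case: eqP.
    by move=> [Bv H] j; have := H j; case: eqP => [->|].
  transitivity ((mu \x nu)%E (B i `*` [set z : prodT | forall j, (if j == i then setT else B j) (z j)])).
    by rewrite -E.
  rewrite product_measure1E//; last first.
    by apply: (@measurable_rect (fun j => if j == i then setT else B j)) => j; case: ifP.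
  transitivity (\prod_j mu (B j))%E; last by symmetry; exact: nu_rect.
  transitivity (mu (B i) * \prod_j mu (if j == i then setT else B j))%E.
    congr (_ * _)%E; apply: (@nu_rect (fun j => if j == i then setT else B j)).
    by move=> j; case: ifP.
  rewrite [RHS](bigD1 i)//= (bigD1 i)//= eqxx probability_setT mul1e.
  by congr (_ * _)%E; apply: eq_bigr => j /negbTE ->.
- move=> k; apply: (@le_lt_trans _ _ ((mu \x nu)%E (setT `*` setT))).
    by rewrite setXTT.
  by rewrite product_measure1E// lte_mul_pinfty// ?ge0_fin_numE//=
     (le_lt_trans (probability_le1 _ measurableT)) ?ltry.
Qed.

(** Fubini in one coordinate: [g] is the conditional expectation of [f] given all coordinates but
    [i]. Applied repeatedly, it integrates out the sample vectors one at a time. *)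
Lemma Ex_upd i (f : prodT -> R) (g : prodT -> R) : bm f ->
  (forall z, Ex mu (fun v => f (upd z i v)) = g z) -> Ex nu f = Ex nu g.
Proof.
move=> bf fg.
have bfu : bm (fun p : V * prodT => f (upd p.2 i p.1 : prodT)).
  case: bf => mf [M fM]; split; last by exists M.
  by apply: (measurableT_comp mf); exact: measurable_upd.
have bfz z : bm (fun v => f (upd z i v)).
  case: bf => mf [M fM]; split; last by exists M.
  apply: (measurableT_comp mf); apply: measurable_to_prodT => j.
  by rewrite /upd; case: eqP.
have muxnu : ((mu \x nu)%E setT < +oo)%E.
  apply: (@le_lt_trans _ _ (mu setT * nu setT)%E).
    by rewrite -setXTT product_measure1E.
  by rewrite !probability_setT mul1e ltry.
have intfu : (mu \x nu)%E.-integrable setT (EFin \o (fun p : V * prodT => f (upd p.2 i p.1 : prodT))).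
  case: bfu => mf [M fM]; apply: measurable_bounded_integrable => //.
  by exists M; split; rewrite ?num_real// => x Mx t _ /=; apply: le_trans (ltW Mx).
have -> : Ex nu f = fine (\int[nu]_z \int[mu]_v (f (upd z i v))%:E)%E.
  rewrite (integral21_prod_meas1 intfu) /Ex /Rintegral; congr fine.
  transitivity (\int[pushforward (mu \x nu)%E (fun p : V * prodT => upd p.2 i p.1 : prodT)]_z (f z)%:E)%E.
    apply: eq_measure_integral; first exact: measurable_upd.
    by move=> mu' A mA _; exact/esym/prod_upd.
  rewrite integral_pushforward//.
  - exact: measurable_upd.
  - by apply/measurable_EFinP; case: bf.
rewrite /Ex /Rintegral; congr fine; apply: eq_integral => z _.
by rewrite -fg /Ex /Rintegral fineK//; apply: integrable_fin_num => //; exact: bm_integrable.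
Qed.

End Peel.

Section ConjMorph.
Variable C : numClosedFieldType.
Implicit Types x y : C.
Lemma conjCM x y : (x * y)^* = x^* * y^*. Proof. exact: rmorphM. Qed.
Lemma conjCD x y : (x + y)^* = x^* + y^*. Proof. exact: rmorphD. Qed.
Lemma conjC_sum I (r : seq I) (P : pred I) (F : I -> C) :
  (\sum_(i <- r | P i) F i)^* = \sum_(i <- r | P i) (F i)^*.
Proof. exact: rmorph_sum. Qed.
Lemma conjC_prod I (r : seq I) (P : pred I) (F : I -> C) :
  (\prod_(i <- r | P i) F i)^* = \prod_(i <- r | P i) (F i)^*.
Proof. exact: rmorph_prod. Qed.
End ConjMorph.

(** * Measurability and expectation of complex-valued functions *)

Section ComplexMeasurable.
Context d (T : measurableType d) (R : realType).
Implicit Types f g : T -> R[i].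

Lemma ReD (x y : R[i]) : complex.Re (x + y) = complex.Re x + complex.Re y.
Proof. by case: x => a b; case: y. Qed.
Lemma ImD (x y : R[i]) : complex.Im (x + y) = complex.Im x + complex.Im y.
Proof. by case: x => a b; case: y. Qed.
Lemma ReM (x y : R[i]) : complex.Re (x * y) =
  complex.Re x * complex.Re y - complex.Im x * complex.Im y.
Proof. by case: x => a b; case: y. Qed.
Lemma ImM (x y : R[i]) : complex.Im (x * y) =
  complex.Re x * complex.Im y + complex.Im x * complex.Re y.
Proof. by case: x => a b; case: y. Qed.
Lemma ReN (x : R[i]) : complex.Re (- x) = - complex.Re x.
Proof. by case: x. Qed.
Lemma ImN (x : R[i]) : complex.Im (- x) = - complex.Im x.
Proof. by case: x. Qed.
Lemma Re_conj (x : R[i]) : complex.Re x^* = complex.Re x.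
Proof. by case: x. Qed.
Lemma Im_conj (x : R[i]) : complex.Im x^* = - complex.Im x.
Proof. by case: x. Qed.
Lemma ReV (x : R[i]) : complex.Re x^-1 =
  complex.Re x / (complex.Re x ^+ 2 + complex.Im x ^+ 2).
Proof. by case: x. Qed.
Lemma ImV (x : R[i]) : complex.Im x^-1 =
  - (complex.Im x / (complex.Re x ^+ 2 + complex.Im x ^+ 2)).
Proof. by case: x => a b. Qed.
Lemma Re_sum I (r : seq I) (P : pred I) (F : I -> R[i]) :
  complex.Re (\sum_(i <- r | P i) F i) = \sum_(i <- r | P i) complex.Re (F i).
Proof. by apply: (big_morph _ ReD). Qed.
Definition cm f := measurable_fun setT (fun x => complex.Re (f x)) /\
  measurable_fun setT (fun x => complex.Im (f x)).

Definition cbm f := bm (fun x => complex.Re (f x)) /\ bm (fun x => complex.Im (f x)).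

Lemma cm_ext f g : f =1 g -> cm g -> cm f.
Proof. by move=> /funext ->. Qed.

Lemma cbm_ext f g : f =1 g -> cbm g -> cbm f.
Proof. by move=> /funext ->. Qed.

Lemma cm_cst c : cm (fun=> c). Proof. by split. Qed.

Lemma cmD f g : cm f -> cm g -> cm (fun x => f x + g x).
Proof.
move=> [rf jf] [rg jg]; split.
  by under eq_fun do rewrite ReD; exact: measurable_funD.
by under eq_fun do rewrite ImD; exact: measurable_funD.
Qed.

Lemma cmM f g : cm f -> cm g -> cm (fun x => f x * g x).
Proof.
move=> [rf jf] [rg jg]; split.
  under eq_fun do rewrite ReM; apply: measurable_funB; exact: measurable_funM.
under eq_fun do rewrite ImM; apply: measurable_funD; exact: measurable_funM.
Qed.

Lemma cmN f : cm f -> cm (fun x => - f x).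
Proof.
move=> [rf jf]; split.
  by under eq_fun do rewrite ReN; exact: measurableT_comp.
by under eq_fun do rewrite ImN; exact: measurableT_comp.
Qed.

Lemma cm_conj f : cm f -> cm (fun x => (f x)^*).
Proof.
move=> [rf jf]; split; first by under eq_fun do rewrite Re_conj.
by under eq_fun do rewrite Im_conj; exact: measurableT_comp.
Qed.

Lemma measurable_invr : measurable_fun setT (fun x : R => x^-1).
Proof.
(* The inverse is continuous only off 0, where it takes the default value 0; the point 0 is treated
   separately. *)
rewrite -(setvU [set (0 : R)]); apply/measurable_funU => //.
  exact: measurableC.
split; last exact: measurable_fun_set1.
apply: open_continuous_measurable_fun; first exact: closed_openC.
by move=> x /set_mem x0; apply: inv_continuous; apply/eqP => x00; apply: x0.
Qed.

Lemma cmV f : cm f -> cm (fun x => (f x)^-1).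
Proof.
move=> [rf jf].
have mV : measurable_fun setT (fun x => (complex.Re (f x) ^+ 2 + complex.Im (f x) ^+ 2)^-1).
  apply: (measurableT_comp measurable_invr); apply: measurable_funD;
  exact: measurable_funX.
split; first by under eq_fun do rewrite ReV; exact: measurable_funM.
under eq_fun do rewrite ImV; apply: measurableT_comp => //.
exact: measurable_funM.
Qed.

Lemma cm_sum I (r : seq I) (P : pred I) (F : I -> T -> R[i]) :
  (forall i, cm (F i)) -> cm (fun x => \sum_(i <- r | P i) F i x).
Proof.
move=> bF; elim: r => [|i r IH].
  by under eq_fun do rewrite big_nil; exact: cm_cst.
under eq_fun do rewrite big_cons; case: (P i) => //; exact: cmD.
Qed.

Lemma cm_prod I (r : seq I) (P : pred I) (F : I -> T -> R[i]) :
  (forall i, cm (F i)) -> cm (fun x => \prod_(i <- r | P i) F i x).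
Proof.
move=> bF; elim: r => [|i r IH].
  by under eq_fun do rewrite big_nil; exact: cm_cst.
under eq_fun do rewrite big_cons; case: (P i) => //; exact: cmM.
Qed.

Definition cm_mx m n (A : T -> 'M[R[i]]_(m, n)) := forall i j, cm (fun x => A x i j).

Lemma cm_mulmx m n p (A : T -> 'M[R[i]]_(m, n)) (B : T -> 'M[R[i]]_(n, p)) :
  cm_mx A -> cm_mx B -> cm_mx (fun x => A x *m B x).
Proof.
move=> mA mB i j; under eq_fun do rewrite mxE.
by apply: cm_sum => k; exact: cmM.
Qed.

Lemma cm_det n (A : T -> 'M[R[i]]_n) : cm_mx A -> cm (fun x => \det (A x)).
Proof.
move=> mA; apply: cm_sum => s; apply: cmM; first exact: cm_cst.
by apply: cm_prod => i.
Qed.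

(** By Cramer's formula the entries of the inverse are rational functions of the entries. *)
Lemma cm_invmx n (A : T -> 'M[R[i]]_n) : cm_mx A ->
  (forall x, A x \in unitmx) -> cm_mx (fun x => invmx (A x)).
Proof.
move=> mA uA i j.
under eq_fun do rewrite /invmx uA !mxE.
apply: cmM; first by apply: cmV; exact: cm_det.
apply: cmM; first exact: cm_cst.
by apply: cm_det => a b; under eq_fun do rewrite !mxE; exact: mA.
Qed.

Lemma cbm_cst c : cbm (fun=> c). Proof. by split; exact: bm_cst. Qed.

Lemma cbmD f g : cbm f -> cbm g -> cbm (fun x => f x + g x).
Proof.
move=> [rf jf] [rg jg]; split.
  by under eq_fun do rewrite ReD; exact: bmD.
by under eq_fun do rewrite ImD; exact: bmD.
Qed.

Lemma cbmM f g : cbm f -> cbm g -> cbm (fun x => f x * g x).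
Proof.
move=> [rf jf] [rg jg]; split.
  under eq_fun do rewrite ReM; apply: bmB; exact: bmM.
under eq_fun do rewrite ImM; apply: bmD; exact: bmM.
Qed.

Lemma cbm_conj f : cbm f -> cbm (fun x => (f x)^*).
Proof.
move=> [rf jf]; split; first by under eq_fun do rewrite Re_conj.
by under eq_fun do rewrite Im_conj; exact: bmN.
Qed.

Lemma cbmN f : cbm f -> cbm (fun x => - f x).
Proof.
move=> [rf jf]; split.
  by under eq_fun do rewrite ReN; exact: bmN.
by under eq_fun do rewrite ImN; exact: bmN.
Qed.

Lemma cbm_sum I (r : seq I) (P : pred I) (F : I -> T -> R[i]) :
  (forall i, cbm (F i)) -> cbm (fun x => \sum_(i <- r | P i) F i x).
Proof.
move=> bF; elim: r => [|i r IH].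
  by under eq_fun do rewrite big_nil; exact: cbm_cst.
under eq_fun do rewrite big_cons; case: (P i) => //; exact: cbmD.
Qed.

Lemma cbm_prod I (r : seq I) (P : pred I) (F : I -> T -> R[i]) :
  (forall i, cbm (F i)) -> cbm (fun x => \prod_(i <- r | P i) F i x).
Proof.
move=> bF; elim: r => [|i r IH].
  by under eq_fun do rewrite big_nil; exact: cbm_cst.
under eq_fun do rewrite big_cons; case: (P i) => //; exact: cbmM.
Qed.

Lemma cbm_norm f (M : R) : cm f -> (forall x, `|f x| <= (M%:C)%C) -> cbm f.
Proof.
move=> [rf jf] fM; split; split => //; exists M => x.
  by rewrite -lecR; apply: le_trans (fM x); exact: normc_ge_Re.
rewrite -lecR; apply: le_trans (fM x).
rewrite -normrN -ReiNIm (le_trans (normc_ge_Re _))// normrM.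
by rewrite [X in _ * X](_ : _ = 1) ?mulr1// normc_def /= expr0n expr1n add0r sqrtr1.
Qed.

Section ComplexExpectation.
Variable P : probability T R.

Definition EC f : R[i] :=
  (Ex P (fun x => complex.Re (f x)) +i* Ex P (fun x => complex.Im (f x)))%C.

Lemma EC_cst c : EC (fun=> c) = c.
Proof. by rewrite /EC !Ex_cst; case: c. Qed.

Lemma ECD f g : cbm f -> cbm g -> EC (fun x => f x + g x) = EC f + EC g.
Proof.
move=> [rf jf] [rg jg]; apply/eqP; rewrite eq_complex; apply/andP; split; apply/eqP => /=.
  by under eq_fun do rewrite ReD; rewrite ExD.
by under eq_fun do rewrite ImD; rewrite ExD.
Qed.

Lemma ECZ c f : cbm f -> EC (fun x => c * f x) = c * EC f.
Proof.
move=> [rf jf]; case: c => a b; apply/eqP; rewrite eq_complex; apply/andP; split; apply/eqP => /=.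
  under eq_fun do rewrite ReM; rewrite ExB ?ExZ//; apply: bmM => //; exact: bm_cst.
under eq_fun do rewrite ImM; rewrite ExD ?ExZ//; apply: bmM => //; exact: bm_cst.
Qed.

Lemma EC_sum I (r : seq I) (F : I -> T -> R[i]) :
  (forall i, cbm (F i)) -> EC (fun x => \sum_(i <- r) F i x) = \sum_(i <- r) EC (F i).
Proof.
move=> bF; elim: r => [|i r IH].
  by under eq_fun do rewrite big_nil; rewrite EC_cst big_nil.
under eq_fun do rewrite big_cons; rewrite ECD//; last exact: cbm_sum.
by rewrite IH big_cons.
Qed.

Lemma eq_EC_ae f g (N : set T) : cbm f -> cbm g -> measurable N -> P N = 0%E ->
  (forall x, ~ N x -> f x = g x) -> EC f = EC g.
Proof.
move=> [rf jf] [rg jg] mN N0 fg; rewrite /EC; congr Complex.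
  by apply: (eq_Ex_ae rf rg mN N0) => x /fg ->.
by apply: (eq_Ex_ae jf jg mN N0) => x /fg ->.
Qed.

End ComplexExpectation.
End ComplexMeasurable.

Section Factor.
Context d (V : measurableType d) (R : realType) (I : finType).
Variables (nu : probability (prodT V I) R) (mu : probability V R).
Hypothesis nu_rect : forall B : I -> set V, (forall i, measurable (B i)) ->
  nu [set z | forall i, B i (z i)] = (\prod_i mu (B i))%E.

Lemma EC_upd i (f g : prodT V I -> R[i]) : cbm f ->
  (forall z, EC mu (fun v => f (upd z i v)) = g z) -> EC nu f = EC nu g.
Proof.
move=> [rf jf] fg; rewrite /EC; congr Complex.
  by apply: (Ex_upd nu_rect (i := i) rf) => z; rewrite -fg.
by apply: (Ex_upd nu_rect (i := i) jf) => z; rewrite -fg.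
Qed.

Lemma cbm_coord i (psi : V -> R[i]) : cbm psi -> cbm (fun z : prodT V I => psi (z i)).
Proof.
by move=> [[m1 [M1 b1]] [m2 [M2 b2]]]; split; split;
  [exact: (measurableT_comp m1 (measurable_coord i))|exists M1|
   exact: (measurableT_comp m2 (measurable_coord i))|exists M2].
Qed.

(** Each factor sees a single coordinate, distinct factors see distinct ones because [e] is
    injective, and [g] ignores them all; so [EC_upd] splits off one factor at a time. In the
    application [e] lists the k vectors of one tensor and [g] comes from the resolvent without that
    tensor. *)
Lemma EC_factor (J : eqType) (s : seq J) (e : J -> I) (psi : J -> V -> R[i])
    (g : prodT V I -> R[i]) :
  injective e -> uniq s -> (forall j, cbm (psi j)) -> cbm g ->
  (forall z j v, g (upd z (e j) v) = g z) ->
  EC nu (fun z => g z * \prod_(j <- s) psi j (z (e j))) =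
  EC nu g * \prod_(j <- s) EC mu (psi j).
Proof.
move=> inj_e + bpsi bg ginv.
elim: s => [_|j s IH /= /andP[js us]].
  rewrite big_nil mulr1; congr EC; apply/funext => z.
  by rewrite big_nil mulr1.
rewrite big_cons mulrCA -IH// -ECZ; last first.
  by apply: cbmM => //; apply: cbm_prod => k; exact: cbm_coord.
apply: (EC_upd (i := e j)).
  by apply: cbmM => //; apply: cbm_prod => k; exact: cbm_coord.
move=> z; under eq_fun => v.
  rewrite ginv big_cons /upd eqxx mulrCA mulrC.
  under eq_big_seq => k ks.
    rewrite (_ : (e k == e j) = false); last first.
      by apply/negbTE; apply: contra js => /eqP /inj_e <-.
    over.
  over.
by rewrite ECZ// mulrC.
Qed.

End Factor.

(** * Moments of the uniform distribution on the complex sphere *)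

Lemma conjCN (C : numClosedFieldType) (x : C) : (- x)^* = - x^*.
Proof. exact: rmorphN. Qed.

Section Sphere.
Context (R : realType) (n : nat).
Local Open Scope complex_scope.
Local Open Scope ring_scope.
Implicit Types v : Cvec R n.

Lemma cm_entry j : cm (fun v => (v : 'cV[R[i]]_n) j 0).
Proof.
split=> _ B mB; rewrite setTI; apply: sub_sigma_algebra; exists j, B; split => //;
  [by left|by right].
Qed.

Lemma cm_Cvec f : (forall j, cm (fun v => (f v : 'cV[R[i]]_n) j 0)) ->
  measurable_fun setT (f : Cvec R n -> Cvec R n).
Proof.
move=> mf; apply: (@measurability _ _ (Cvec R n) (Cvec R n) setT f (@coord_preimages R n)) => //.
move=> _ [_ [j [B [mB [->|->]]]]] <-.
  by have [+ _] := mf j; apply.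
by have [_ +] := mf j; apply.
Qed.

Lemma measurable_sqnorm : measurable_fun setT (fun v => sqnorm (v : 'cV[R[i]]_n)).
Proof.
apply: measurable_sum => j; have [mr mi] := cm_entry j.
by apply: measurable_funD; exact: measurable_funX.
Qed.

Lemma measurable_sphere : measurable [set v : Cvec R n | sqnorm (v : 'cV[R[i]]_n) = 1].
Proof.
rewrite -[X in measurable X]setTI.
exact: (measurable_sqnorm measurableT (measurable_set1 1)).
Qed.

(* Almost surely the identity, [clamp] makes every function of the sample
   considered below bounded everywhere. *)
Definition clamp (v : 'cV[R[i]]_n) : 'cV[R[i]]_n := if sqnorm v == 1 then v else 0.

Lemma cl_entryE (v : 'cV[R[i]]_n) j :
  clamp v j 0 = (\1_[set v : Cvec R n | sqnorm (v : 'cV[R[i]]_n) = 1] v)%:C * v j 0.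
Proof.
rewrite /clamp indicE; case: eqP => v1.
  by rewrite mem_set// mul1r.
by rewrite memNset// mul0r mxE.
Qed.

Lemma norm_entry (v : 'cV[R[i]]_n) j : `|v j 0| ^+ 2 <= (sqnorm v)%:C.
Proof.
rewrite -add_Re2_Im2 lecR /sqnorm (bigD1 j)//= lerDl; apply: sumr_ge0 => i _.
by rewrite addr_ge0// sqr_ge0.
Qed.

Lemma norm_clamp_entry (v : 'cV[R[i]]_n) j : `|clamp v j 0| <= 1.
Proof.
rewrite /clamp; case: eqP => v1; last by rewrite mxE normr0 ler01.
by rewrite -(@ler_pXn2r _ 2)// ?nnegrE// expr1n (le_trans (norm_entry v j))// v1.
Qed.

Lemma cm_clamp j : cm (fun v => clamp v j 0).
Proof.
under eq_fun do rewrite cl_entryE; apply: cmM; last exact: cm_entry.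
split => //=; exact: measurable_indic measurable_sphere.
Qed.

Lemma cbm_clamp j : cbm (fun v => clamp v j 0).
Proof.
by apply: (cbm_norm (M := 1) (cm_clamp j)) => v; exact: norm_clamp_entry.
Qed.

Variable mu : probability (Cvec R n) R.
Hypothesis mu_unif : uniform_on_sphere mu.

Lemma Ex_pushforward (f : Cvec R n -> Cvec R n) (phi : Cvec R n -> R) :
  measurable_fun setT f -> bm phi ->
  (forall B, measurable B -> mu (f @^-1` B) = mu B) ->
  Ex mu (fun v => phi (f v)) = Ex mu phi.
Proof.
move=> mf bphi fmu.
rewrite /Ex /Rintegral; congr fine.
transitivity (\int[pushforward mu f]_z (phi z)%:E)%E.
  rewrite integral_pushforward//.
    by apply/measurable_EFinP; case: bphi.
  apply: (@bm_integrable _ _ _ mu (phi \o f)).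
  case: bphi => mphi [M phiM]; split; last by exists M => x; exact: phiM.
  exact: measurableT_comp.
by apply: eq_measure_integral => A mA _; exact: fmu.
Qed.

(** Compatibility with differences together with preservation of the norm yields an isometry fixing
    0, the form in which uniformity states invariance. *)
Lemma EC_isometry (f : 'cV[R[i]]_n -> 'cV[R[i]]_n) (phi : Cvec R n -> R[i]) :
  (forall u v, f (u - v) = f u - f v) -> (forall v, sqnorm (f v) = sqnorm v) ->
  (forall j, cm (fun v : Cvec R n => f v j 0)) -> cbm phi ->
  EC mu (fun v => phi (f v)) = EC mu phi.
Proof.
move=> fB fN mf [rphi jphi].
have mf' := cm_Cvec mf.
have fmu (B : set (Cvec R n)) : measurable B -> mu (f @^-1` B) = mu B.
  case: mu_unif => _; apply; first by have := fB 0 0; rewrite !subrr.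
  by move=> u v; rewrite -fB fN.
by rewrite /EC; congr Complex; apply: Ex_pushforward.
Qed.

Definition mon4 (a b c d : 'I_n) (v : 'cV[R[i]]_n) : R[i] :=
  v a 0 * (v b 0)^* * v c 0 * (v d 0)^*.

Lemma cbm_mon4 a b c d : cbm (fun v => mon4 a b c d (clamp v)).
Proof.
apply: cbmM; last by apply: cbm_conj; exact: cbm_clamp.
apply: cbmM; last exact: cbm_clamp.
apply: cbmM; first exact: cbm_clamp.
by apply: cbm_conj; exact: cbm_clamp.
Qed.

Definition m4 a b c d : R[i] := EC mu (fun v => mon4 a b c d (clamp v)).

Lemma clamp_isometry (f : 'cV[R[i]]_n -> 'cV[R[i]]_n) v :
  (forall u v, f (u - v) = f u - f v) -> (forall v, sqnorm (f v) = sqnorm v) ->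
  clamp (f v) = f (clamp v).
Proof.
move=> fB fN; rewrite /clamp fN; case: ifP => // _.
by have := fB 0 0; rewrite !subrr.
Qed.

Lemma mulrACA4 (K : comNzRingType) (e1 e2 e3 e4 x1 x2 x3 x4 : K) :
  e1 * x1 * (e2 * x2) * (e3 * x3) * (e4 * x4) =
  e1 * e2 * e3 * e4 * (x1 * x2 * x3 * x4).
Proof. ring. Qed.

Definition phase (j : 'I_n) (v : 'cV[R[i]]_n) : 'cV[R[i]]_n :=
  \col_i ((if i == j then 'i%C else 1) * v i 0).

(** Multiplying one complex coordinate by the imaginary unit is a quarter turn in a real plane,
    hence an element of O(2n). A moment is therefore fixed by the phase factor that it picks up. *)
Lemma m4_phase j a b c d : m4 a b c d =
  (if a == j then 'i%C else 1) * (if b == j then 'i%C else 1)^* *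
  (if c == j then 'i%C else 1) * (if d == j then 'i%C else 1)^* * m4 a b c d.
Proof.
have pB u v : phase j (u - v) = phase j u - phase j v.
  by apply/colP => i; rewrite !mxE mulrBr.
have pN v : sqnorm (phase j v) = sqnorm v.
  apply: eq_bigr => i _; rewrite !mxE; case: eqP => _; rewrite ?mul1r//.
  by case: (v i 0) => x y /=; rewrite !(mul0r, mul1r, add0r, sub0r) sqrrN addrC.
have mp i : cm (fun v : Cvec R n => phase j v i 0).
  under eq_fun do rewrite mxE; apply: cmM; first exact: cm_cst.
  exact: cm_entry.
rewrite {1}/m4 -(EC_isometry pB pN mp (cbm_mon4 a b c d)).
rewrite /m4 -ECZ; last exact: cbm_mon4.
congr EC; apply/funext => v; rewrite clamp_isometry// /mon4 !mxE !rmorphM /=.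
exact: mulrACA4.
Qed.

(** The phase of an unbalanced index is turned. If [a = d], index [b] occurs once and yields the
    factor conj(i). If [a != d], index [a] occurs in position one and perhaps three, and yields i or
    i^2 = -1. None of these is 1, so the moment vanishes. *)
Lemma m4_0 a b c d : a != b -> (a != d) || (b != c) -> m4 a b c d = 0.
Proof.
move=> ab; case: (eqVneq a d) => /= [<- bc|ad _].
  have := m4_phase b a b c a; rewrite (negbTE ab) eqxx (eq_sym c) (negbTE bc).
  rewrite conjC1 !mulr1 mul1r => h.
  suff : (1 - ('i%C : R[i])^*) * m4 a b c a = 0.
    by move=> /eqP; rewrite mulf_eq0 eq_complex /= !subr0 oner_eq0 /= => /eqP.
  by rewrite mulrBl mul1r -h subrr.
have := m4_phase a a b c d; rewrite eqxx (eq_sym b) (negbTE ab) (eq_sym d) (negbTE ad).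
rewrite conjC1 !mulr1 => h.
suff : (1 - ('i%C : R[i]) * (if c == a then 'i%C else 1)) * m4 a b c d = 0.
  move=> /eqP; rewrite mulf_eq0 => /orP[|/eqP//].
  case: (c == a); first by rewrite -expr2 sqr_i opprK -(natrD _ 1 1) pnatr_eq0.
  by rewrite mulr1 eq_complex /= subr0 oner_eq0.
by rewrite mulrBl mul1r -h subrr.
Qed.

Lemma m4_swap a b c d : m4 a b c d = m4 c d a b.
Proof. by congr EC; apply/funext => v; rewrite /mon4; ring. Qed.

Lemma m4_swap2 a b c d : m4 a b c d = m4 a d c b.
Proof. by congr EC; apply/funext => v; rewrite /mon4; ring. Qed.

Definition rot (s : R) (a b : 'I_n) (v : 'cV[R[i]]_n) : 'cV[R[i]]_n :=
  \col_i (if i == a then s%:C * (v a 0 + v b 0) else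
          if i == b then s%:C * (v a 0 - v b 0) else v i 0).

(** Invariance under (v_a, v_b) -> ((v_a + v_b) / sqrt 2, (v_a - v_b) / sqrt 2). With x, y the pure
    fourth moments and z the mixed one, expansion gives x = (x + y + 4 z) / 4 and the same value for
    y; hence x = y and x = 2 z. *)
Lemma m4_rot a b : a != b ->
  (m4 a a a a = m4 b b b b) * (m4 a a a a = 2 * m4 a a b b).
Proof.
move=> ab; pose s : R := Num.sqrt 2^-1.
have s2 : s ^+ 2 = 2^-1 by rewrite sqr_sqrtr// invr_ge0 ler0n.
have ba : (b == a) = false by rewrite eq_sym (negbTE ab).
have pB u v : rot s a b (u - v) = rot s a b u - rot s a b v.
  by apply/colP => i; rewrite !mxE; case: eqP => _ //; [|case: eqP => _ //]; ring.
have pN v : sqnorm (rot s a b v) = sqnorm v.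
  rewrite /sqnorm [LHS](bigD1 a)//= [RHS](bigD1 a)//= [in LHS](bigD1 b) ?ba//=.
  rewrite [in RHS](bigD1 b) ?ba//= !mxE !eqxx ba !addrA; congr (_ + _); last first.
    by apply: eq_bigr => i /andP[/negbTE ia /negbTE ib]; rewrite !mxE ia ib.
  case: (v a 0) => x y; case: (v b 0) => z w /=; rewrite !mul0r !subr0 !addr0.
  transitivity (2 * s ^+ 2 * (x ^+ 2 + y ^+ 2 + z ^+ 2 + w ^+ 2)); first by ring.
  by rewrite s2 divff ?mul1r// pnatr_eq0.
have mp i : cm (fun v : Cvec R n => rot s a b v i 0).
  under eq_fun do rewrite mxE; case: eqP => _; [|case: eqP => _; last exact: cm_entry];
    apply: cmM; try exact: cm_cst; apply: cmD; try apply: cmN; exact: cm_entry.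
have sC : (s%:C) ^+ 2 = 2^-1 :> R[i].
  by rewrite -rmorphXn /= s2 fmorphV rmorph_nat.
have sJ : (s%:C)^* = s%:C :> R[i] by exact: conjc_real.
(* The sign [e] is 1 for the new coordinate [a] and -1 for the new coordinate [b], so one expansion
   serves both. *)
have key (e : R[i]) i : e ^+ 2 = 1 -> e^* = e ->
   (forall v, rot s a b v i 0 = s%:C * (v a 0 + e * v b 0)) ->
   m4 i i i i = 4^-1 * (m4 a a a a + m4 b b b b + 4 * m4 a a b b).
  move=> e2 eJ ei.
  have cj (x y : R[i]) : (s%:C * (x + e * y))^* = s%:C * (x^* + e * y^*).
    by rewrite conjCM conjCD conjCM eJ sJ.
  rewrite {1}/m4 -(EC_isometry pB pN mp (cbm_mon4 i i i i)).
  (* The sixteen monomials of the expansion; the coefficient is [e] to the number of indices [b],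
     reduced by [e ^+ 2 = 1]. *)
  pose L := [:: (a, a, a, a, 1); (a,a,a,b,e); (a,a,b,a,e); (a,a,b,b,1);
    (a,b,a,a,e); (a,b,a,b,1); (a,b,b,a,1); (a,b,b,b,e);
    (b,a,a,a,e); (b,a,a,b,1); (b,a,b,a,1); (b,a,b,b,e);
    (b,b,a,a,1); (b,b,a,b,e); (b,b,b,a,e); (b,b,b,b,1)].
  transitivity (EC mu (fun v => 4^-1 * \sum_(x <- L) (x.2 * mon4 x.1.1.1.1 x.1.1.1.2 x.1.1.2 x.1.2 (clamp v)))).
    congr EC; apply/funext => v; rewrite clamp_isometry// /mon4 !ei.
    rewrite !cj /L !big_cons big_nil /=.
    set A := clamp v a 0; set B := clamp v b 0.
    transitivity ((s%:C ^+ 2) ^+ 2 * ((A + e * B) * (A^* + e * B^*) * (A + e * B) * (A^* + e * B^*))).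
      by ring.
    rewrite sC (_ : (2^-1 : R[i]) ^+ 2 = 4^-1); last first.
      by rewrite exprVn -natrX.
    congr (_ * _).
    have e3 : e ^+ 3 = e by rewrite exprS e2 mulr1.
    have e4 : e ^+ 4 = 1 by rewrite exprS e3 -expr2.
    transitivity (A ^+ 2 * A^* ^+ 2 + e * (2 * A ^+ 2 * A^* * B^* + 2 * A * B * A^* ^+ 2)
     + e ^+ 2 * (A ^+ 2 * B^* ^+ 2 + 4 * A * B * A^* * B^* + B ^+ 2 * A^* ^+ 2)
     + e ^+ 3 * (2 * A * B * B^* ^+ 2 + 2 * B ^+ 2 * A^* * B^*) + e ^+ 4 * (B ^+ 2 * B^* ^+ 2)).
      by ring.
    by rewrite e2 e3 e4; ring.
  rewrite ECZ; last first.
    by apply: cbm_sum => x; apply: cbmM; [exact: cbm_cst|exact: cbm_mon4].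
  congr (_ * _); rewrite EC_sum; last first.
    by move=> x; apply: cbmM; [exact: cbm_cst|exact: cbm_mon4].
  transitivity (\sum_(x <- L) (x.2 * m4 x.1.1.1.1 x.1.1.1.2 x.1.1.2 x.1.2)).
    by apply: eq_bigr => x _; rewrite ECZ//; exact: cbm_mon4.
  rewrite /L !big_cons big_nil /=.
  (* The swaps bring two different indices to the front, as [m4_0] requires, and turn every mixed
     balanced moment into [m4 a a b b]. Six of the sixteen terms survive. *)
  rewrite (m4_swap a a a b) (m4_swap a a b a) (m4_swap b b a b) (m4_swap b b b a).
  rewrite (m4_swap2 a b b a) (m4_swap2 b a a b) (m4_swap b b a a).
  rewrite !(@m4_0 a b) ?ab ?ba ?orbT// !(@m4_0 b a) ?ba ?ab ?orbT//.
  by ring.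
have ka : m4 a a a a = 4^-1 * (m4 a a a a + m4 b b b b + 4 * m4 a a b b).
  apply: (key 1); rewrite ?expr1n ?conjC1// => v.
  by rewrite mxE eqxx mul1r.
have kb : m4 b b b b = 4^-1 * (m4 a a a a + m4 b b b b + 4 * m4 a a b b).
  apply: (key (-1)) => [||v]; rewrite ?sqrrN ?expr1n ?conjCN ?conjC1//.
  by rewrite mxE ba eqxx mulN1r.
have ab4 : m4 a a a a = m4 b b b b by rewrite ka -kb.
split=> //.
have h : 4 * m4 a a a a = m4 a a a a + m4 b b b b + 4 * m4 a a b b.
  by rewrite {1}ka mulrA divff ?mul1r// pnatr_eq0.
rewrite -ab4 in h.
have h2 : 2 * m4 a a a a = 2 * (2 * m4 a a b b).
  by apply: (addrI (2 * m4 a a a a)); rewrite -mulrDl -natrD h; ring.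
by apply: (mulfI _ h2); rewrite pnatr_eq0.
Qed.


Lemma sum_norm_clamp v : sqnorm (v : 'cV[R[i]]_n) = 1 ->
  \sum_j (clamp v j 0 * (clamp v j 0)^*) = 1.
Proof.
move=> v1; rewrite /clamp v1 eqxx.
under eq_bigr do rewrite -normCK -add_Re2_Im2.
by rewrite -rmorph_sum /= [X in X%:C](_ : _ = 1).
Qed.

Lemma null_sphere : mu (~` [set v : Cvec R n | sqnorm (v : 'cV[R[i]]_n) = 1]) = 0%E.
Proof.
rewrite probability_setC; last exact: measurable_sphere.
by case: mu_unif => -> _; rewrite subee.
Qed.

Lemma sum_m4 a b : \sum_c m4 a b c c = EC mu (fun v => clamp v a 0 * (clamp v b 0)^*).
Proof.
rewrite -EC_sum; last by move=> c; exact: cbm_mon4.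
apply: (@eq_EC_ae _ _ _ _ _ _ (~` [set v : Cvec R n | sqnorm (v : 'cV[R[i]]_n) = 1])).
- by apply: cbm_sum => c; exact: cbm_mon4.
- by apply: cbmM; [exact: cbm_clamp|apply: cbm_conj; exact: cbm_clamp].
- by apply: measurableC; exact: measurable_sphere.
- exact: null_sphere.
move=> v /contrapT v1; rewrite /mon4; under eq_bigr do rewrite -mulrA.
by rewrite -mulr_sumr sum_norm_clamp// mulr1.
Qed.

Lemma sum2_m4 : \sum_a \sum_c m4 a a c c = 1.
Proof.
under eq_bigr do rewrite sum_m4.
rewrite -EC_sum; last first.
  by move=> c; apply: cbmM; [exact: cbm_clamp|apply: cbm_conj; exact: cbm_clamp].
rewrite -[RHS](EC_cst mu 1).
apply: (@eq_EC_ae _ _ _ _ _ _ (~` [set v : Cvec R n | sqnorm (v : 'cV[R[i]]_n) = 1])).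
- by apply: cbm_sum => c; apply: cbmM; [exact: cbm_clamp|apply: cbm_conj; exact: cbm_clamp].
- exact: cbm_cst.
- by apply: measurableC; exact: measurable_sphere.
- exact: null_sphere.
by move=> v /contrapT v1; rewrite sum_norm_clamp.
Qed.

(** By [m4_rot] a single number p determines all these moments. Since |v|^2 = 1 almost surely they
    add up to 1, that is n (n + 1) p / 2 = 1. *)
Lemma m4_diag (a c : 'I_n) : m4 a a c c = (1 + (a == c)%:R) / (n * n.+1)%:R.
Proof.
pose p := m4 a a a a.
have pE b : m4 b b b b = p.
  by have [->//|ab] := eqVneq b a; have [] := m4_rot ab.
have rE b e : m4 b b e e = (1 + (b == e)%:R) * (p / 2).
  have [->|be] := eqVneq b e.
    by rewrite pE -(natrD _ 1 1) mulrC divfK// pnatr_eq0.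
  have [_ h] := m4_rot be; rewrite pE in h.
  by rewrite addr0 mul1r h [2 * _]mulrC mulfK// pnatr_eq0.
have n0 : (n * n.+1)%:R != 0 :> R[i].
  by rewrite pnatr_eq0 muln_eq0 negb_or /= andbT -lt0n (leq_ltn_trans _ (ltn_ord a)).
rewrite rE; congr (_ * _).
have := sum2_m4; under eq_bigr do under eq_bigr do rewrite rE.
under eq_bigr => b _.
  rewrite -mulr_suml big_split /= sumr_const card_ord (bigD1 b)//= eqxx.
  rewrite big1 ?addr0; last by move=> e /negbTE be; rewrite eq_sym be.
  over.
rewrite sumr_const card_ord /= => h.
apply: (mulIf n0); rewrite mulVf//; apply: etrans h.
by rewrite natrM -[n.+1]addn1 natrD -[RHS]mulr_natr; ring.
Qed.

(** A Wick formula: one term for each way of pairing the plain indices [a], [c] with the conjugated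
    ones [b], [e]. The denominator n (n + 1) replaces the n^2 of a Gaussian vector with entries of
    variance 1 / n. *)
Lemma m4E (a b c e : 'I_n) : m4 a b c e =
  (((a == b) && (c == e))%:R + ((a == e) && (b == c))%:R) / (n * n.+1)%:R.
Proof.
have [<-|ab] := eqVneq a b.
  have [<-|ce] := eqVneq c e.
    by rewrite m4_diag /= andbb.
  rewrite m4_swap m4_0//.
    case: (eqVneq a e) ce => [->|_ _]; last by rewrite addr0 mul0r.
    by rewrite eq_sym => /negbTE ->; rewrite addr0 mul0r.
  by case: (eqVneq c a) ce => //= ->; rewrite eq_sym.
rewrite add0r; have [<-|ae] := eqVneq a e => /=; last first.
  by rewrite mul0r m4_0// ae.
have [<-|bc] := eqVneq b c; last by rewrite mul0r m4_0// bc orbT.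
by rewrite m4_swap2 m4_diag (negbTE ab) addr0.
Qed.

(** Second moments come from the fourth by contracting two indices, because |v|^2 = 1 almost
    surely. *)
Lemma m2E (a b : 'I_n) :
  EC mu (fun v => clamp v a 0 * (clamp v b 0)^*) = (a == b)%:R / n%:R.
Proof.
have n0 : n%:R != 0 :> R[i].
  by rewrite pnatr_eq0 -lt0n (leq_ltn_trans _ (ltn_ord a)).
have n1 : n.+1%:R != 0 :> R[i] by rewrite pnatr_eq0.
rewrite -sum_m4; under eq_bigr do rewrite m4E eqxx andbT.
rewrite -mulr_suml big_split /= sumr_const card_ord (bigD1 a)//= eqxx /=.
rewrite big1 ?addr0; last by move=> e /negbTE be; rewrite eq_sym be.
rewrite (eq_sym b a) -mulr_natr natrM invfM mulrA.
by apply: (canLR (mulfK n1)); rewrite mulrAC -[n.+1]addn1 natrD; ring.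
Qed.

End Sphere.

(** * Resolvents of positive semidefinite matrices *)

Section Resolvent.
Local Open Scope sesquilinear_scope.
Variable C : numClosedFieldType.

Lemma adjM m n p (A : 'M[C]_(m, n)) (B : 'M[C]_(n, p)) :
  (A *m B)^t* = B^t* *m A^t*.
Proof. by rewrite trmx_mul map_mxM. Qed.

Lemma adjD m n (A B : 'M[C]_(m, n)) : (A + B)^t* = A^t* + B^t*.
Proof. by apply/matrixP => i j; rewrite !mxE conjCD. Qed.

Lemma adjZ m n a (A : 'M[C]_(m, n)) : (a *: A)^t* = a^* *: A^t*.
Proof. by apply/matrixP => i j; rewrite !mxE conjCM. Qed.

Lemma adj_scalar n (a : C) : (a%:M : 'M[C]_n)^t* = (a^*)%:M.
Proof. by rewrite tr_scalar_mx map_scalar_mx. Qed.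

Variable N : nat.
Implicit Types (A B M G : 'M[C]_N) (u v Y : 'cV[C]_N).

Definition nsq v : C := (v^t* *m v) 0 0.
Definition qf A v : C := (v^t* *m A *m v) 0 0.

Lemma nsqE v : nsq v = \sum_i `|v i 0| ^+ 2.
Proof. by rewrite /nsq mxE; apply: eq_bigr => i _; rewrite !mxE normCK mulrC. Qed.

Lemma nsq_ge0 v : 0 <= nsq v.
Proof. by rewrite nsqE; apply: sumr_ge0 => i _; rewrite exprn_ge0. Qed.

Lemma nsq_eq0 v : (nsq v == 0) = (v == 0).
Proof.
apply/eqP/eqP => [|->]; last by rewrite /nsq mulmx0 mxE.
rewrite nsqE => /psumr_eq0P h; apply/colP => i; rewrite mxE.
have := h (fun i _ => exprn_ge0 2 (normr_ge0 (v i 0))) i isT.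
by move=> /eqP; rewrite expf_eq0 /= normr_eq0 => /eqP.
Qed.

Lemma nsq_entry v i : `|v i 0| ^+ 2 <= nsq v.
Proof.
rewrite nsqE (bigD1 i)//= lerDl; apply: sumr_ge0 => j _; exact: exprn_ge0.
Qed.

Definition psd A := A^t* = A /\ forall v, 0 <= qf A v.

Lemma qfD A B v : qf (A + B) v = qf A v + qf B v.
Proof. by rewrite /qf mulmxDr mulmxDl mxE. Qed.

Lemma qfZ a A v : qf (a *: A) v = a * qf A v.
Proof. by rewrite /qf -scalemxAr -scalemxAl mxE. Qed.

Lemma qfN A v : qf (- A) v = - qf A v.
Proof. by rewrite /qf mulmxN mulNmx mxE. Qed.

Lemma qf_delta A a : qf A (delta_mx a 0) = A a a.
Proof.
have Ae b : (A *m (delta_mx a 0 : 'cV[C]_N)) b 0 = A b a.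
  rewrite mxE (bigD1 a)//= mxE !eqxx mulr1 big1 ?addr0// => j /negbTE ja.
  by rewrite mxE ja mulr0.
rewrite /qf -mulmxA mxE (bigD1 a)//= Ae !mxE !eqxx conjC1 mul1r big1 ?addr0// => j /negbTE ja.
by rewrite !mxE ja conjC0 mul0r.
Qed.

Lemma qf_scalar t v : qf t%:M v = t * nsq v.
Proof. by rewrite /qf /nsq mul_mx_scalar -scalemxAl mxE. Qed.

Lemma psd0 : psd 0.
Proof.
split; first by apply/matrixP => i j; rewrite !mxE conjC0.
by move=> v; rewrite /qf mulmx0 mul0mx mxE.
Qed.

Lemma psdD A B : psd A -> psd B -> psd (A + B).
Proof.
move=> [hA pA] [hB pB]; split; first by rewrite adjD hA hB.
by move=> v; rewrite qfD addr_ge0.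
Qed.

Lemma psd_rank1 a Y : 0 <= a -> psd (a *: (Y *m Y^t*)).
Proof.
move=> a0; split; first by rewrite adjZ adjM trmxCK geC0_conj.
move=> v; rewrite qfZ mulr_ge0//.
have -> : qf (Y *m Y^t*) v = `|(Y^t* *m v) 0 0| ^+ 2.
  rewrite /qf mulmxA -mulmxA -{1}[Y]trmxCK -adjM mxE big_ord1 normCK mulrC.
  by rewrite !mxE.
exact: exprn_ge0.
Qed.

Lemma psd_sum (I : Type) (r : seq I) (P : pred I) (F : I -> 'M[C]_N) :
  (forall i, P i -> psd (F i)) -> psd (\sum_(i <- r | P i) F i).
Proof. by move=> h; apply: big_ind => //; [exact: psd0|exact: psdD]. Qed.

Section OneMatrix.
Variables (M : 'M[C]_N) (t : C).
Hypotheses (psdM : psd M) (t0 : 0 < t).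

Let B := M + t%:M.
Definition resolvent := invmx B.
Let G := resolvent.

Let tJ : t^* = t. Proof. by rewrite geC0_conj// ltW. Qed.

Let Bherm : B^t* = B.
Proof. by rewrite adjD adj_scalar tJ; case: psdM => ->. Qed.

Lemma qf_shift_ge v : t * nsq v <= qf B v.
Proof. by rewrite qfD qf_scalar lerDr; case: psdM. Qed.

Lemma shift_unit : B \in unitmx.
Proof.
rewrite -row_free_unit; apply: inj_row_free => v vB.
have : nsq (v^t*) == 0.
  rewrite eq_le nsq_ge0 andbT -(pmulr_rle0 _ t0).
  by apply: le_trans (qf_shift_ge _) _; rewrite /qf trmxCK vB mul0mx mxE.
by rewrite nsq_eq0 => /eqP/(congr1 (fun w : 'cV_N => w^t*)); rewrite trmxCK => ->;
  apply/matrixP => i j; rewrite !mxE conjC0.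
Qed.

Lemma mulBG : B *m G = 1%:M. Proof. exact: mulmxV shift_unit. Qed.
Lemma mulGB : G *m B = 1%:M. Proof. exact: mulVmx shift_unit. Qed.

Lemma resolvent_herm : G^t* = G.
Proof.
by rewrite -[LHS]mulmx1 -mulBG mulmxA -{1}Bherm -adjM mulBG adj_scalar conjC1 mul1mx.
Qed.

(** With w = G v, the form v^* G v equals w^* (M + t) w, which is at least t |w|^2. *)
Lemma qf_resolvent v : t * nsq (G *m v) <= qf G v.
Proof.
apply: le_trans (qf_shift_ge _) _.
by rewrite /qf adjM resolvent_herm -!mulmxA (mulmxA B) mulBG mul1mx.
Qed.

Lemma qf_resolvent_ge0 v : 0 <= qf G v.
Proof. by apply: le_trans (qf_resolvent v); rewrite mulr_ge0 ?nsq_ge0// ltW. Qed.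

(** No diagonalization is involved: the squared norm x of column [a] satisfies t x <= G_aa by
    [qf_resolvent] and G_aa^2 <= x because G_aa is an entry of the column. Hence (t x)^2 <= x. *)
Lemma resolvent_col a : \sum_b `|G b a| ^+ 2 <= t^-2.
Proof.
pose e : 'cV[C]_N := delta_mx a 0.
have Ge b : (G *m e) b 0 = G b a.
  rewrite mxE (bigD1 a)//= mxE !eqxx mulr1 big1 ?addr0// => j /negbTE ja.
  by rewrite mxE ja mulr0.
have qe : qf G e = G a a by exact: qf_delta.
have -> : \sum_b `|G b a| ^+ 2 = nsq (G *m e).
  by rewrite nsqE; under [in RHS]eq_bigr do rewrite Ge.
set x := nsq _; have x0 : 0 <= x by exact: nsq_ge0.
have h1 : t * x <= G a a by rewrite -qe; exact: qf_resolvent.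
have Gaa : 0 <= G a a by rewrite -qe; exact: qf_resolvent_ge0.
have h2 : G a a ^+ 2 <= x.
  by have := nsq_entry (G *m e) a; rewrite Ge ger0_norm.
have tx0 : 0 <= t * x by rewrite mulr_ge0// ltW.
have [->|xn0] := eqVneq x 0; first by rewrite invr_ge0 exprn_ge0// ltW.
have xp : 0 < x by rewrite lt_neqAle eq_sym xn0.
rewrite -(ler_pM2l (exprn_gt0 2 t0)) divff ?expf_neq0 ?gt_eqF//.
rewrite -(ler_pM2r xp) mul1r; apply: le_trans h2.
rewrite (_ : _ * x * x = (t * x) ^+ 2); last by rewrite exprMn expr2 mulrA -!expr2 -mulrA -expr2.
by rewrite ler_pXn2r// nnegrE.
Qed.

Lemma resolvent_entry a b : `|G b a| <= t^-1.
Proof.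
rewrite -(@ler_pXn2r _ 2)// ?nnegrE// ?invr_ge0 ?(ltW t0)// exprVn.
apply: le_trans (resolvent_col a).
by rewrite (bigD1 b)//= lerDl; apply: sumr_ge0 => j _; exact: exprn_ge0.
Qed.

Lemma tr_resolvent_ge0 : 0 <= \tr G.
Proof.
by apply: sumr_ge0 => a _; rewrite -qf_delta; exact: qf_resolvent_ge0.
Qed.

End OneMatrix.

Section RankOne.
Variables (M : 'M[C]_N) (t tau : C) (Y : 'cV[C]_N).
Hypotheses (psdM : psd M) (t0 : 0 < t) (tau0 : 0 <= tau).
Let M' := M + tau *: (Y *m Y^t*).
Let G := resolvent M t.
Let G' := resolvent M' t.
Let psdM' : psd M'. Proof. by apply: psdD => //; exact: psd_rank1. Qed.
Let x := qf G Y.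
Let g := qf G' Y.

Lemma resolventB : G - G' = tau *: (G *m Y *m (Y^t* *m G')).
Proof.
have : G *m (M' + t%:M - (M + t%:M)) *m G' = G - G'.
  by rewrite mulmxBr mulmxBl mulGB// mul1mx -mulmxA mulBG// mulmx1.
move=> <-; rewrite opprD addrACA subrr addr0 addrAC subrr add0r.
by rewrite -scalemxAr -scalemxAl !mulmxA.
Qed.

Let x0 : 0 <= x. Proof. exact: qf_resolvent_ge0. Qed.
Let d0 : 0 < 1 + tau * x.
Proof. by rewrite ltr_pwDl// mulr_ge0. Qed.

(** The Sherman-Morrison formula for the quadratic form, obtained by evaluating the resolvent
    identity [resolventB] at [Y]. *)
Lemma sherman : g = x / (1 + tau * x).
Proof.
have : x - g = tau * x * g.
  have -> : x - g = qf (G - G') Y by rewrite qfD qfN.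
  rewrite resolventB qfZ -mulrA; congr (_ * _).
  transitivity (((Y^t* *m G *m Y) *m (Y^t* *m G' *m Y)) 0 0).
    by rewrite /qf !mulmxA.
  by rewrite mxE big_ord1.
move=> h; apply: (canRL (mulfK (lt0r_neq0 d0))).
by rewrite mulrDr mulr1 (mulrC g) -h addrC subrK.
Qed.

Lemma resolvent_mul_col : G' *m Y = (1 + tau * x)^-1 *: (G *m Y).
Proof.
have : G *m Y - G' *m Y = (tau * g) *: (G *m Y).
  rewrite -mulmxBl resolventB -scalemxAl.
  transitivity (tau *: ((G *m Y) *m (Y^t* *m G' *m Y))); first by rewrite !mulmxA.
  by rewrite [Y^t* *m _ *m _]mx11_scalar mul_mx_scalar scalerA.
move=> h; have -> : G' *m Y = G *m Y - (G *m Y - G' *m Y) by rewrite subKr.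
rewrite h -[X in X - _]scale1r -scalerBl; congr (_ *: _).
rewrite sherman mulrA; apply: (mulIf (lt0r_neq0 d0)).
by rewrite mulVf ?lt0r_neq0// mulrBl mul1r divfK ?lt0r_neq0// addrK.
Qed.

(** The difference of traces is tau |G Y|^2 / (1 + tau x), and t |G Y|^2 <= x. The bound 1 / t is
    thus uniform in [tau] and [Y], which is what unbounded weights demand. *)
Lemma tr_resolventB : (0 <= \tr G - \tr G') /\ (\tr G - \tr G' <= t^-1).
Proof.
have -> : \tr G - \tr G' = tau * (1 + tau * x)^-1 * nsq (G *m Y).
  rewrite -raddfB /= resolventB linearZ /= mxtrace_mulC -mulrA; congr (_ * _).
  have G'h : G'^t* = G' by exact: (resolvent_herm psdM' t0).
  rewrite trace_mx11 -{1}G'h -adjM.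
  by rewrite resolvent_mul_col adjZ geC0_conj ?invr_ge0 ?ltW// -scalemxAl mxE.
have n0 := nsq_ge0 (G *m Y).
split; first by rewrite !mulr_ge0// invr_ge0 ltW.
rewrite -(ler_pM2l t0) divff ?gt_eqF//.
have e (a b c n : C) : a * (b * c * n) = b * (a * n) * c by ring.
rewrite e ler_pdivrMr// mul1r.
apply: (@le_trans _ _ (tau * x)); last by rewrite lerDr.
by rewrite ler_wpM2l// (qf_resolvent psdM t0).
Qed.

End RankOne.
End Resolvent.

(** * Variance of a quadratic form in a random tensor *)

Section PairingKernel.
Variables n k : nat.
Notation J := {ffun 'I_k -> 'I_n}.
Implicit Types a b c e : J.

(** The numerator in [m4E]: how many of the two pairings are compatible with the indices. *)
Definition pairing1 (w x y z : 'I_n) : nat := ((w == x) && (y == z)) + ((w == z) && (x == y)).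
Definition pairing a b c e : nat := \prod_(l < k) pairing1 (a l) (b l) (c l) (e l).
(* [pairing] is (n (n + 1))^k times a fourth moment of the random tensor, and
   [pairing0] is n^(2k) times the corresponding product of second moments. *)
Definition pairing0 a b c e : nat := \prod_(l < k) ((a l == b l) && (c l == e l)).

Lemma pairing0_le a b c e : (pairing0 a b c e <= pairing a b c e)%N.
Proof. by apply: leq_prod => l _; exact: leq_addr. Qed.

Lemma pairing_sym a b c e : pairing a b c e = pairing c e a b.
Proof.
apply: eq_bigr => l _; rewrite /pairing1 andbC; congr (_ + nat_of_bool _)%N.
by rewrite andbC (eq_sym (b l)) (eq_sym (a l)).
Qed.

Lemma pairing0_sym a b c e : pairing0 a b c e = pairing0 c e a b.
Proof. by apply: eq_bigr => l _; rewrite andbC. Qed.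

Lemma pairing0E a b c e : pairing0 a b c e = ((a == b) && (c == e)) :> nat.
Proof.
case: (boolP ((a == b) && (c == e))) => [/andP[/eqP <- /eqP <-]|].
  by rewrite /pairing0 big1// => l _; rewrite !eqxx.
move=> h; have [l hl|hall] := pickP (fun l => ~~ ((a l == b l) && (c l == e l))).
  by rewrite /pairing0 (bigD1 l)//= (negbTE hl).
case/negP: h; apply/andP; split; apply/eqP/ffunP => l;
  by have /negbFE/andP[/eqP h1 /eqP h2] := hall l; rewrite ?h1 ?h2.
Qed.

Lemma sum_pairing (F : 'I_k -> 'I_n -> 'I_n -> nat) :
  (\sum_(c : J) \sum_(e : J) \prod_(l < k) F l (c l) (e l) =
   \prod_(l < k) \sum_(x : 'I_n) \sum_(y : 'I_n) F l x y)%N.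
Proof.
rewrite bigA_distr_bigA /=; apply: eq_bigr => c _.
by rewrite bigA_distr_bigA.
Qed.

Lemma sum_eq_pair (w : 'I_n) (x : 'I_n) :
  (\sum_(y : 'I_n) \sum_(z : 'I_n) ((w == z) && (x == y)) = 1)%N.
Proof.
rewrite (bigD1 x)//= (bigD1 w)//= !eqxx big1 ?big1//.
  by move=> y yx; rewrite big1// => z _; rewrite (eq_sym x) (negbTE yx) andbF.
by move=> z /negbTE zw; rewrite eq_sym zw.
Qed.

Lemma sum_eq_diag (t : bool) :
  (\sum_(y : 'I_n) \sum_(z : 'I_n) (t && (y == z)) = n * t)%N.
Proof.
under eq_bigr => y _.
  rewrite (bigD1 y)//= eqxx andbT big1; last first.
    by move=> z /negbTE zw; rewrite eq_sym zw andbF.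
  over.
by rewrite sum_nat_const card_ord addn0.
Qed.

Lemma leq_exp2r_le j : (n ^ j <= n.+1 ^ j)%N.
Proof. by case: j => // j; rewrite leq_exp2r. Qed.

(** The difference between the product of the x + 1 and the product of the x is largest when all x
    equal n. It is written with sums to avoid truncated subtraction, and the second conjunct
    strengthens the induction. *)
Lemma prod_succ_sub (s : seq nat) : all (leq^~ n) s ->
  (\prod_(x <- s) x.+1 + n ^ size s <= n.+1 ^ size s + \prod_(x <- s) x)%N /\
  (\prod_(x <- s) x <= n ^ size s)%N.
Proof.
elim: s => [|x s IH] /=; first by rewrite !big_nil !expn0.
move=> /andP[xn /IH[]]; rewrite !big_cons !expnS => h1 h2; split; last exact: leq_mul.
move: h1 h2; set p := (\prod_(j <- s) j.+1)%N; set q := (\prod_(j <- s) j)%N.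
have : (n ^ size s <= n.+1 ^ size s)%N by exact: leq_exp2r_le.
move: p q (n ^ _)%N (n.+1 ^ _)%N => p q u v uv h1 h2.
have h3 : (x.+1 * p <= x.+1 * (v - u + q))%N by rewrite leq_mul2l; lia.
have h4 : (x.+1 * (v - u) <= n.+1 * (v - u))%N by rewrite leq_mul2r; lia.
by nia.
Qed.

(** Both sums factor over the k positions: position l contributes n [a_l = b_l] + 1 to the first and
    n [a_l = b_l] to the second. The worst case of the difference is a = b. *)
Lemma sum_pairing_sub a b :
  (\sum_(c : J) \sum_(e : J) (pairing a b c e - pairing0 a b c e) <= n.+1 ^ k - n ^ k)%N.
Proof.
have s1 : (\sum_(c : J) \sum_(e : J) pairing a b c e = \prod_(l < k) (n * (a l == b l)).+1)%N.
  rewrite /pairing (sum_pairing (fun l => pairing1 (a l) (b l))); apply: eq_bigr => l _.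
  under eq_bigr do rewrite big_split /=.
  by rewrite big_split /= sum_eq_pair sum_eq_diag addn1.
have s0 : (\sum_(c : J) \sum_(e : J) pairing0 a b c e = \prod_(l < k) (n * (a l == b l)))%N.
  rewrite /pairing0 (sum_pairing (fun l x y => (a l == b l) && (x == y) : nat)).
  by apply: eq_bigr => l _; rewrite sum_eq_diag.
have -> : (\sum_(c : J) \sum_(e : J) (pairing a b c e - pairing0 a b c e) =
   \sum_(c : J) \sum_(e : J) pairing a b c e - \sum_(c : J) \sum_(e : J) pairing0 a b c e)%N.
  rewrite -sumnB => [|c _]; last by apply: leq_sum => e _; exact: pairing0_le.
  by apply: eq_bigr => c _; rewrite sumnB// => e _; exact: pairing0_le.
rewrite s1 s0.
have := @prod_succ_sub [seq (n * (a l == b l))%N | l : 'I_k] _.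
rewrite size_image card_ord !big_image /= => -[].
  by rewrite all_map; apply/allP => l _ /=; case: (a l == b l); rewrite ?muln1 ?muln0.
move=> h _; rewrite leq_subLR addnBA ?leq_exp2r_le//.
by rewrite leq_subRL ?(leq_trans (leq_exp2r_le k)) ?leq_addl// addnC [leqRHS]addnC.
Qed.

(** The inequality 1 - (n / (n + 1))^k <= k / (n + 1) without denominators. This is the origin of
    the ratio k / n in the variance. *)
Lemma bernoulli_nat : ((n.+1 ^ k - n ^ k) * n.+1 <= k * n.+1 ^ k)%N.
Proof.
elim: k => [|j IH]; first by rewrite !expn0 subnn.
have : (n ^ j <= n.+1 ^ j)%N by exact: leq_exp2r_le.
rewrite !expnS; move: IH; move: (n ^ j)%N (n.+1 ^ j)%N => u v; nia.
Qed.

(** Schur's test: the kernel is symmetric and nonnegative, so |w_p w_q| <= (|w_p|^2 + |w_q|^2) / 2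
    bounds the form by the row sum times the sum of the |w_p|^2. The former is estimated by
    [sum_pairing_sub], the latter by n^k columns of size [K]. *)
Lemma pairing_quad_bound (C : numFieldType) (w : J * J -> C) (K : C) :
  (forall a, \sum_b `|w (a, b)| ^+ 2 <= K) ->
  `|\sum_p \sum_q w p * w q *
     (pairing p.1 p.2 q.1 q.2 - pairing0 p.1 p.2 q.1 q.2)%:R|
    <= (n ^ k * (n.+1 ^ k - n ^ k))%:R * K.
Proof.
move=> wK.
pose kap (p q : J * J) : C := (pairing p.1 p.2 q.1 q.2 - pairing0 p.1 p.2 q.1 q.2)%:R.
have kap0 p q : 0 <= kap p q by exact: ler0n.
pose S := \sum_p \sum_q `|w p| ^+ 2 * kap p q.
have SE : S = \sum_p \sum_q `|w q| ^+ 2 * kap p q.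
  rewrite exchange_big /=; apply: eq_bigr => p _; apply: eq_bigr => q _.
  by rewrite /kap pairing_sym pairing0_sym.
apply: (@le_trans _ _ S); last first.
  apply: (@le_trans _ _ (\sum_p `|w p| ^+ 2 * (n.+1 ^ k - n ^ k)%:R)).
    apply: ler_sum => p _; rewrite -mulr_sumr ler_wpM2l ?exprn_ge0//.
    rewrite -natr_sum ler_nat -(pair_bigA _ (fun c e => pairing p.1 p.2 c e - pairing0 p.1 p.2 c e))%N /=.
    exact: sum_pairing_sub.
  rewrite -mulr_suml natrM -mulrA [X in _ <= X]mulrCA mulrC ler_wpM2l ?ler0n//.
  have -> : \sum_p `|w p| ^+ 2 = \sum_a \sum_b `|w (a, b)| ^+ 2.
    by rewrite pair_bigA; apply: eq_bigr => -[].
  apply: (@le_trans _ _ (\sum_(a : J) K)); first by apply: ler_sum => a _; exact: wK.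
  by rewrite sumr_const card_ffun !card_ord mulr_natl.
apply: (@le_trans _ _ (\sum_p \sum_q `|w p| * `|w q| * kap p q)).
  apply: le_trans (ler_norm_sum _ _ _) _; apply: ler_sum => p _.
  apply: le_trans (ler_norm_sum _ _ _) _; apply: ler_sum => q _.
  by rewrite !normrM (ger0_norm (kap0 p q)).
have S2 : 2 * S = \sum_p \sum_q (`|w p| ^+ 2 + `|w q| ^+ 2) * kap p q.
  rewrite mulr_natl mulr2n {2}SE -big_split; apply: eq_bigr => p _.
  by rewrite -big_split; apply: eq_bigr => q _; rewrite mulrDl.
rewrite -(ler_pM2l (_ : 0 < 2 :> C)) ?ltr0n// S2 mulr_sumr.
apply: ler_sum => p _; rewrite mulr_sumr; apply: ler_sum => q _.
rewrite mulrA ler_wpM2r// -subr_ge0.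
have -> : `|w p| ^+ 2 + `|w q| ^+ 2 - 2 * (`|w p| * `|w q|) = (`|w p| - `|w q|) ^+ 2 by ring.
by rewrite real_exprn_even_ge0// realB// normr_real.
Qed.

End PairingKernel.

Lemma sum_enum_rank (C : nmodType) (J : finType) (F : 'I_#|J| -> C) :
  \sum_i F i = \sum_a F (enum_rank a).
Proof.
rewrite (reindex_onto enum_rank (@enum_val _ _)) /=; last by move=> i _; exact: enum_valK.
by apply: eq_bigl => a; rewrite enum_rankK eqxx.
Qed.

(** * Second moment of the centred quadratic form *)

Section QuadraticFormVariance.
Local Open Scope sesquilinear_scope.
Variables (R : realType) (n k : nat) (I : finType) (e : 'I_k -> I).
Hypothesis inj_e : injective e.
Variables (mu : probability (Cvec R n) R) (nu : probability (prodT (Cvec R n) I) R).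
Hypothesis mu_unif : uniform_on_sphere mu.
Hypothesis nu_rect : forall B : I -> set (Cvec R n), (forall i, measurable (B i)) ->
  nu [set z | forall i, B i (z i)] = (\prod_i mu (B i))%E.
Hypothesis n_gt0 : (0 < n)%N.
Notation J := {ffun 'I_k -> 'I_n}.
Notation W := (prodT (Cvec R n) I).
Implicit Types z : W.

Definition clamped_tensor z : 'cV[R[i]]_#|{: J}| := tensor (fun l => clamp (z (e l))).
Notation Y := clamped_tensor.

Variables (G : W -> 'M[R[i]]_#|{: J}|) (K : R).
Hypothesis G_cbm : forall i j, cbm (fun z => G z i j).
Hypothesis G_upd : forall z l v, G (upd z (e l) v) = G z.
Hypothesis G_col : forall z a, \sum_b `|G z b a| ^+ 2 <= (K%:C)%C.
Hypothesis G_herm : forall z, (G z)^t* = G z.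

Let w z (p : J * J) : R[i] := G z (enum_rank p.2) (enum_rank p.1).
Let cl z (l : 'I_k) (j : 'I_n) : R[i] := clamp (z (e l)) j 0.
Let N : R[i] := (n ^ k)%:R.
Let D : R[i] := ((n * n.+1) ^ k)%:R.
Let T z := \tr (G z) / N.

Let N0 : N != 0. Proof. by rewrite pnatr_eq0 -lt0n expn_gt0 n_gt0. Qed.
Let D0 : 0 < D. Proof. by rewrite ltr0n expn_gt0 muln_gt0 n_gt0. Qed.

Let qfE z : qf (G z) (Y z) = \sum_p w z p * \prod_l (cl z l (p.1 l) * (cl z l (p.2 l))^*).
Proof.
rewrite /qf -mulmxA mxE sum_enum_rank.
under eq_bigr => b _.
  rewrite [(G z *m Y z) _ _]mxE sum_enum_rank mulr_sumr.
  over.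
rewrite exchange_big pair_bigA /=; apply: eq_bigr => p _.
rewrite !mxE !enum_rankK conjC_prod /w mulrCA; congr (_ * _).
by rewrite -big_split /=; apply: eq_bigr => l _; rewrite mulrC.
Qed.

Let trE z : \tr (G z) = \sum_p w z p * (p.1 == p.2)%:R.
Proof.
rewrite /mxtrace sum_enum_rank.
rewrite -(pair_bigA _ (fun a b => w z (a, b) * (a == b)%:R)) /=.
apply: eq_bigr => a _; rewrite (bigD1 a)//= eqxx mulr1 big1 ?addr0// => b /negbTE ba.
by rewrite eq_sym ba mulr0.
Qed.

Let cbm_w p : cbm (fun z => w z p). Proof. exact: G_cbm. Qed.

Let cbm_T : cbm T.
Proof.
by apply: cbmM; [apply: cbm_sum => i; exact: G_cbm|exact: cbm_cst].
Qed.

Let w_upd z l v p : w (upd z (e l) v) p = w z p.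
Proof. by rewrite /w G_upd. Qed.

Let T_upd z l v : T (upd z (e l) v) = T z.
Proof. by rewrite /T G_upd. Qed.

Let cbm_cl l j : cbm (fun z => cl z l j).
Proof. exact: (cbm_coord (e l) (@cbm_clamp R n j)). Qed.

Let EC4 p q : EC nu (fun z => w z p * w z q *
    \prod_l mon4 (p.1 l) (p.2 l) (q.1 l) (q.2 l) (clamp (z (e l)))) =
  EC nu (fun z => w z p * w z q) * ((pairing p.1 p.2 q.1 q.2)%:R / D).
Proof.
rewrite (@EC_factor _ _ _ _ nu mu nu_rect _ (index_enum 'I_k) e
  (fun l v => mon4 (p.1 l) (p.2 l) (q.1 l) (q.2 l) (clamp v)) (fun z => w z p * w z q))//.
- congr (_ * _); rewrite /D natrX /pairing natr_prod.
  rewrite (eq_bigr (fun l => (pairing1 (p.1 l) (p.2 l) (q.1 l) (q.2 l))%:R / (n * n.+1)%:R)).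
    by rewrite big_split prodr_const card_ord exprVn.
  by move=> l _; rewrite -/(m4 _ _ _ _ _) m4E// /pairing1 natrD.
- exact: index_enum_uniq.
- by move=> l; exact: cbm_mon4.
- exact: cbmM.
- by move=> z l v; rewrite !w_upd.
Qed.

Let EC2 p : EC nu (fun z => w z p * T z *
    \prod_l (cl z l (p.1 l) * (cl z l (p.2 l))^*)) =
  EC nu (fun z => w z p * T z) * ((p.1 == p.2)%:R / N).
Proof.
rewrite (@EC_factor _ _ _ _ nu mu nu_rect _ (index_enum 'I_k) e
  (fun l v => clamp v (p.1 l) 0 * (clamp v (p.2 l) 0)^*) (fun z => w z p * T z))//.
- congr (_ * _); rewrite /N natrX.
  rewrite (eq_bigr (fun l => ((p.1 l == p.2 l) : nat)%:R / n%:R)); last first.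
    by move=> l _; rewrite m2E.
  rewrite big_split prodr_const card_ord exprVn; congr (_ * _).
  rewrite -natr_prod; congr (_%:R).
  have [<-|pne] := eqVneq p.1 p.2; first by rewrite big1// => l _; rewrite eqxx.
  have [l hl|hall] := pickP (fun l => p.1 l != p.2 l).
    by rewrite (bigD1 l)//= (negbTE hl).
  by case/eqP: pne; apply/ffunP => l; have /negbFE/eqP := hall l.
- exact: index_enum_uniq.
- by move=> l; apply: cbmM; [exact: cbm_clamp|apply: cbm_conj; exact: cbm_clamp].
- exact: cbmM.
- by move=> z l v; rewrite w_upd T_upd.
Qed.

Let cbm_mon (p q : J * J) : cbm (fun z => \prod_l mon4 (p.1 l) (p.2 l) (q.1 l) (q.2 l) (clamp (z (e l)))).
Proof. by apply: cbm_prod => l; exact: (cbm_coord (e l) (@cbm_mon4 R n (p.1 l) (p.2 l) (q.1 l) (q.2 l))). Qed.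

Let cbm_mon2 (p : J * J) : cbm (fun z => \prod_l (cl z l (p.1 l) * (cl z l (p.2 l))^*)).
Proof. by apply: cbm_prod => l; apply: cbmM => //; exact: cbm_conj. Qed.

(** The conditional expectation of [X z ^+ 2] given [G]: the products of vector entries are replaced
    by their moments, and the cross term -2 T^2 has merged with T^2. *)
Let H z := \sum_p \sum_q w z p * w z q * ((pairing p.1 p.2 q.1 q.2)%:R / D) - T z ^+ 2.

Let X z := qf (G z) (Y z) - T z.

Let X2E z : X z ^+ 2 = \sum_p \sum_q (w z p * w z q *
    \prod_l mon4 (p.1 l) (p.2 l) (q.1 l) (q.2 l) (clamp (z (e l)))) +
  (-2 * (\sum_p (w z p * T z * \prod_l (cl z l (p.1 l) * (cl z l (p.2 l))^*))) + T z ^+ 2).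
Proof.
rewrite /X sqrrB -addrA; congr (_ + (_ + _)).
  rewrite expr2 {1}qfE mulr_suml; apply: eq_bigr => p _.
  rewrite qfE mulr_sumr; apply: eq_bigr => q _.
  rewrite mulrACA; congr (_ * _); rewrite -big_split /=; apply: eq_bigr => l _.
  by rewrite mulrA.
rewrite qfE mulNr mulr_natl mulr_suml; congr (- (_ *+ _)).
by apply: eq_bigr => p _; rewrite mulrAC.
Qed.

Let HE z : H z = \sum_p \sum_q (w z p * w z q * ((pairing p.1 p.2 q.1 q.2)%:R / D)) +
  (-2 * (\sum_p (w z p * T z * ((p.1 == p.2)%:R / N))) + T z ^+ 2).
Proof.
rewrite /H; congr (_ + _).
have -> : \sum_p w z p * T z * ((p.1 == p.2)%:R / N) = T z ^+ 2.
  transitivity (T z * (\tr (G z) / N)); last by rewrite expr2.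
  rewrite trE mulr_suml mulr_sumr; apply: eq_bigr => p _.
  by rewrite mulrAC [_ * T z]mulrC !mulrA.
by rewrite mulNr mulr_natl mulr2n opprD addrNK.
Qed.

Let cbm_H : cbm H.
Proof.
apply: cbmD; last by apply: cbmN; apply: cbmM.
apply: cbm_sum => p; apply: cbm_sum => q.
by apply: cbmM; [exact: cbmM|exact: cbm_cst].
Qed.

Let EC_X2 : EC nu (fun z => X z ^+ 2) = EC nu H.
Proof.
have cT2 : cbm (fun z => T z ^+ 2).
  by rewrite (_ : (fun z => _) = fun z => T z * T z); [exact: cbmM|apply/funext => z; rewrite expr2].
rewrite (_ : H = fun z => \sum_p \sum_q (w z p * w z q * ((pairing p.1 p.2 q.1 q.2)%:R / D)) +
  (-2 * (\sum_p (w z p * T z * ((p.1 == p.2)%:R / N))) + T z ^+ 2)); last first.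
  by apply/funext => z; exact: HE.
transitivity (EC nu (fun z => \sum_p \sum_q (w z p * w z q *
    \prod_l mon4 (p.1 l) (p.2 l) (q.1 l) (q.2 l) (clamp (z (e l)))) +
  (-2 * (\sum_p (w z p * T z * \prod_l (cl z l (p.1 l) * (cl z l (p.2 l))^*))) + T z ^+ 2))).
  by congr EC; apply/funext => z; exact: X2E.
have c1 p q : cbm (fun z => w z p * w z q * \prod_l mon4 (p.1 l) (p.2 l) (q.1 l) (q.2 l) (clamp (z (e l)))).
  by apply: cbmM; [exact: cbmM|exact: cbm_mon].
have c2 p q : cbm (fun z => w z p * w z q * ((pairing p.1 p.2 q.1 q.2)%:R / D)).
  by apply: cbmM; [exact: cbmM|exact: cbm_cst].
have c3 p : cbm (fun z => w z p * T z * \prod_l (cl z l (p.1 l) * (cl z l (p.2 l))^*)).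
  by apply: cbmM; [exact: cbmM|exact: cbm_mon2].
have c4 p : cbm (fun z => w z p * T z * ((p.1 == p.2)%:R / N)).
  by apply: cbmM; [exact: cbmM|exact: cbm_cst].
have EC3 (A B : W -> R[i]) : cbm A -> cbm B ->
    EC nu (fun z => A z + (-2 * B z + T z ^+ 2)) =
    EC nu A + (-2 * EC nu B + EC nu (fun z => T z ^+ 2)).
  move=> cA cB; have cB2 : cbm (fun z => -2 * B z) by apply: cbmM => //; exact: cbm_cst.
  by rewrite ECD//; [rewrite ECD// ECZ|exact: cbmD].
have cs1 : cbm (fun z => \sum_p \sum_q (w z p * w z q *
    \prod_l mon4 (p.1 l) (p.2 l) (q.1 l) (q.2 l) (clamp (z (e l))))).
  by apply: cbm_sum => p; apply: cbm_sum => q; exact: c1.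
have cs2 : cbm (fun z => \sum_p \sum_q (w z p * w z q * ((pairing p.1 p.2 q.1 q.2)%:R / D))).
  by apply: cbm_sum => p; apply: cbm_sum => q; exact: c2.
rewrite (EC3 _ _ cs1 (cbm_sum _ _ c3)) (EC3 _ _ cs2 (cbm_sum _ _ c4)).
congr (_ + (-2 * _ + _)).
  rewrite EC_sum => [|p]; last by apply: cbm_sum => q; exact: c1.
  rewrite EC_sum => [|p]; last by apply: cbm_sum => q; exact: c2.
  apply: eq_bigr => p _.
  rewrite EC_sum => [|q]; last exact: c1.
  rewrite EC_sum => [|q]; last exact: c2.
  apply: eq_bigr => q _; rewrite EC4.
  have -> : EC nu (fun z => w z p * w z q * ((pairing p.1 p.2 q.1 q.2)%:R / D)) =
    EC nu (fun z => ((pairing p.1 p.2 q.1 q.2)%:R / D) * (w z p * w z q)).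
    by congr EC; apply/funext => z; rewrite mulrC.
  by rewrite ECZ; [exact: mulrC|exact: cbmM].
rewrite (EC_sum _ _ c3) (EC_sum _ _ c4); apply: eq_bigr => p _.
rewrite EC2.
have -> : EC nu (fun z => w z p * T z * ((p.1 == p.2)%:R / N)) =
  EC nu (fun z => ((p.1 == p.2)%:R / N) * (w z p * T z)).
  by congr EC; apply/funext => z; rewrite mulrC.
by rewrite ECZ; [exact: mulrC|exact: cbmM].
Qed.

Let Im_qf z : complex.Im (qf (G z) (Y z)) = 0.
Proof.
have /(congr1 (fun c => complex.Im c)) : (qf (G z) (Y z))^* = qf (G z) (Y z).
  have adj00 (B : 'M[R[i]]_1) : (B^t*) 0 0 = (B 0 0)^* by rewrite !mxE.
  by rewrite /qf -adj00 !adjM trmxCK G_herm mulmxA.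
rewrite Im_conj => /eqP; rewrite eq_sym -addr_eq0 -mulr2n mulrn_eq0 /=.
by move/eqP.
Qed.

Let Im_tr z : complex.Im (\tr (G z)) = 0.
Proof.
have /(congr1 (fun c => complex.Im c)) : (\tr (G z))^* = \tr (G z).
  by rewrite -{2}(G_herm z) /mxtrace conjC_sum; apply: eq_bigr => i _; rewrite !mxE.
rewrite Im_conj => /eqP; rewrite eq_sym -addr_eq0 -mulr2n mulrn_eq0 /=.
by move/eqP.
Qed.

Let trC z : \tr (G z) = (complex.Re (\tr (G z)))%:C%C.
Proof. by rewrite [LHS]complexE Im_tr mulr0 addr0. Qed.

Let XE z : X z = (complex.Re (qf (G z) (Y z)) - complex.Re (\tr (G z)) / (n ^ k)%:R)%:C%C.
Proof.
rewrite /X /T /N trC [qf _ _]complexE Im_qf mulr0 addr0 rmorphB rmorphM fmorphV rmorph_nat.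
by [].
Qed.

(** Splitting [pairing] into [pairing0] and an excess separates the square of the trace. Its
    coefficient 1 / D - 1 / N^2 is nonpositive and is dropped; the excess is handled by
    [pairing_quad_bound] and [bernoulli_nat]. *)
Let Re_H z : complex.Re (H z) <= K * k%:R / n.+1%:R.
Proof.
(* The index set is nonempty since n > 0, so some column bounds [K] from below by 0. *)
have K0 : 0 <= K.
  have [a] : exists a : 'I_#|{: J}|, True.
    by exists (enum_rank [ffun=> Ordinal n_gt0]).
  move=> _; rewrite -ler0c; apply: le_trans (G_col z a); apply: sumr_ge0 => b _.
  exact: exprn_ge0.
pose V := \sum_p \sum_q w z p * w z q *
  (pairing p.1 p.2 q.1 q.2 - pairing0 p.1 p.2 q.1 q.2)%:R.
have -> : H z = V / D + \tr (G z) ^+ 2 * (D^-1 - N ^- 2).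
  rewrite /H mulrBr addrA; congr (_ - _); last by rewrite /T exprMn exprVn.
  have -> : \tr (G z) ^+ 2 = \sum_p \sum_q w z p * w z q * (pairing0 p.1 p.2 q.1 q.2)%:R.
    rewrite expr2 {1}trE mulr_suml; apply: eq_bigr => p _.
    rewrite trE mulr_sumr; apply: eq_bigr => q _.
    by rewrite mulrACA -natrM pairing0E mulnb.
  rewrite -mulrDl -big_split mulr_suml; apply: eq_bigr => p _.
  rewrite -big_split mulr_suml; apply: eq_bigr => q _ /=.
  by rewrite -mulrDr -natrD subnK ?pairing0_le// mulrA.
rewrite ReD -[leRHS]addr0; apply: lerD.
  have h : `|V / D| <= (K * k%:R / n.+1%:R)%:C%C; last first.
    rewrite -lecR; apply: le_trans h; apply: le_trans (normc_ge_Re _).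
    by rewrite lecR ler_norm.
  have D1 : 0 <= D^-1 by rewrite invr_ge0 ltW.
  rewrite normrM (ger0_norm D1).
  rewrite ler_pdivrMr//.
  apply: le_trans (@pairing_quad_bound n k _ (w z) (K%:C)%C _) _.
    move=> a; apply: le_trans (G_col z (enum_rank a)).
    by rewrite sum_enum_rank.
  rewrite /D -!(rmorph_nat (real_complex R)) -!rmorphM lecR.
  rewrite [leRHS]mulrAC ler_pdivlMr ?ltr0n// [_ * K]mulrC -!mulrA ler_wpM2l//.
  rewrite -!natrM ler_nat expnMn -mulnA [leqRHS]mulnCA leq_mul2l; apply/orP; right.
  exact: bernoulli_nat.
rewrite trC -rmorphXn /= ReM /= mul0r subr0.
have -> : complex.Re (D^-1 - N ^- 2) = (((n * n.+1) ^ k)%:R : R)^-1 - (n ^ k)%:R ^- 2.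
  by rewrite /D /N -!(rmorph_nat (real_complex R)) -rmorphXn -!fmorphV -rmorphB.
apply: mulr_ge0_le0; first exact: sqr_ge0.
rewrite subr_le0 lef_pV2 ?posrE -?natrX ?ltr0n ?expn_gt0 ?muln_gt0 ?n_gt0//.
by rewrite ler_nat -mulnn expnMn leq_mul2l leq_exp2r_le orbT.
Qed.

Lemma variance_quadratic_form :
  Ex nu (fun z => (complex.Re (qf (G z) (Y z)) - complex.Re (\tr (G z)) / (n ^ k)%:R) ^+ 2)
    <= K * k%:R / n.+1%:R.
Proof.
have -> : Ex nu (fun z => (complex.Re (qf (G z) (Y z)) - complex.Re (\tr (G z)) / (n ^ k)%:R) ^+ 2)
   = complex.Re (EC nu (fun z => X z ^+ 2)).
  by congr Ex; apply/funext => z; rewrite XE -rmorphXn.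
rewrite EC_X2 /= -[leRHS](Ex_cst nu); apply: le_Ex => //; first by case: cbm_H.
exact: bm_cst.
Qed.

End QuadraticFormVariance.

(** * The approximate equation for the Stieltjes transform *)

Section SampleResolvent.
Local Open Scope sesquilinear_scope.
Local Open Scope complex_scope.
Local Open Scope ring_scope.
Variables (R : realType) (n k m : nat).
Notation J := {ffun 'I_k -> 'I_n}.
Notation I := ('I_m * 'I_k)%type.
Notation W := (prodT (Cvec R n) I).
Variables (mu : probability (Cvec R n) R) (nu : probability W R).
Hypothesis mu_unif : uniform_on_sphere mu.
Hypothesis nu_rect : forall B : I -> set (Cvec R n), (forall i, measurable (B i)) ->
  nu [set z | forall i, B i (z i)] = (\prod_i mu (B i))%E.
Hypothesis n_gt0 : (0 < n)%N.
Variables (tau : nat -> R) (t : R).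
Hypotheses (tau_gt0 : forall j, 0 < tau j) (t_gt0 : 0 < t).
Implicit Types z : W.

Definition csample z : 'M[R[i]]_#|{: J}| :=
  sample_mx tau (fun al l => clamp (z (al, l) : 'cV[R[i]]_n)).

Let Y (al : 'I_m) z : 'cV[R[i]]_#|{: J}| := clamped_tensor (fun l => (al, l)) z.
Let rk (al : 'I_m) z := (tau al)%:C *: (Y al z *m (Y al z)^t*).
Let Mal (al : 'I_m) z := \sum_(be < m | be != al) rk be z.
Let G z := resolvent (csample z) (t%:C).
Let Gal (al : 'I_m) z := resolvent (Mal al z) (t%:C).
Let N : R := (n ^ k)%:R.
Definition csample_stieltjes z : R := complex.Re (\tr (G z)) / N.
Notation s := csample_stieltjes.
Let x al z := complex.Re (qf (Gal al z) (Y al z)).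
Let T al z := complex.Re (\tr (Gal al z)) / N.

Let tC : 0 < t%:C. Proof. by rewrite ltcR. Qed.
Let tauC al : 0 <= (tau al)%:C. Proof. by rewrite ler0c ltW. Qed.
Let N0 : 0 < N. Proof. by rewrite ltr0n expn_gt0 n_gt0. Qed.

Let csampleE z : csample z = \sum_(al < m) rk al z. Proof. by []. Qed.

Lemma psd_csample z : psd (csample z).
Proof. by apply: psd_sum => al _; exact: psd_rank1. Qed.

Let psd_Mal al z : psd (Mal al z).
Proof. by apply: psd_sum => be _; exact: psd_rank1. Qed.

Let csample_split al z : csample z = Mal al z + rk al z.
Proof. by rewrite csampleE (bigD1 al)//= addrC. Qed.

Let cbm_Y al i j : cbm (fun z => Y al z i j).
Proof.
rewrite (ord1 j) (_ : (fun z => _) =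
  fun z => \prod_(l < k) clamp (z (al, l)) ((enum_val i : J) l) 0); last first.
  by apply/funext => z; rewrite mxE.
by apply: cbm_prod => l; exact: (cbm_coord (al, l) (@cbm_clamp R n _)).
Qed.

Let cbm_Yadj al i j : cbm (fun z => (Y al z)^t* i j).
Proof.
rewrite (_ : (fun z => _) = fun z => (Y al z j i)^*); first exact: cbm_conj.
by apply/funext => z; rewrite mxE; congr (_^*); rewrite mxE.
Qed.

Let cm_of_cbm d (U : measurableType d) (f : U -> R[i]) : cbm f -> cm f.
Proof. by move=> [[? _] [? _]]. Qed.

Let cbm_rk al i j : cbm (fun z => rk al z i j).
Proof.
rewrite (_ : (fun z => _) =
  fun z => (tau al)%:C * \sum_h Y al z i h * (Y al z)^t* h j); last first.
  by apply/funext => z; rewrite mxE; congr (_ * _); rewrite mxE.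
apply: cbmM; first exact: cbm_cst.
by apply: cbm_sum => h; apply: cbmM.
Qed.

Let cbm_sum_rk (P : pred 'I_m) i j : cbm (fun z => (\sum_(al < m | P al) rk al z) i j).
Proof.
apply: cbm_ext => [z|]; first by rewrite summxE; reflexivity.
by apply: cbm_sum => al; exact: cbm_rk.
Qed.

Let cbm_resolvent (P : pred 'I_m) i j :
  cbm (fun z => resolvent (\sum_(al < m | P al) rk al z) t%:C i j).
Proof.
have pM z : psd (\sum_(al < m | P al) rk al z).
  by apply: psd_sum => al _; exact: psd_rank1.
apply: (cbm_norm (M := t^-1)); last first.
  by move=> z; rewrite fmorphV; exact: resolvent_entry.
apply: cm_invmx => [a b|z]; last exact: shift_unit.
apply: cm_ext => [z|]; first by rewrite mxE; reflexivity.
apply: cmD; last exact: cm_cst.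
by apply: cm_of_cbm; exact: cbm_sum_rk.
Qed.

Let cbm_Gal al i j : cbm (fun z => Gal al z i j). Proof. exact: cbm_resolvent. Qed.

Let Gal_upd al z l v : Gal al (upd z (al, l) v) = Gal al z.
Proof.
suff E : Mal al (upd z (al, l) v) = Mal al z by rewrite /Gal E.
apply: eq_bigr => be /negbTE beal.
suff E : Y be (upd z (al, l) v) = Y be z by rewrite /rk E.
rewrite /Y /clamped_tensor; congr tensor; apply/funext => l'.
by rewrite /upd xpair_eqE beal.
Qed.

Let variance_x al : Ex nu (fun z => (x al z - T al z) ^+ 2) <= t ^- 2 * k%:R / n.+1%:R.
Proof.
apply: (@variance_quadratic_form R n k I (fun l => (al, l)) _ mu nu mu_unif nu_rect
  n_gt0 (Gal al) (t ^- 2)).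
- by move=> l l' [].
- by move=> i j; exact: cbm_Gal.
- by move=> z l v; exact: Gal_upd.
- move=> z a; apply: le_trans (resolvent_col (psd_Mal al z) tC a) _.
  by rewrite fmorphV rmorphXn.
- by move=> z; exact: (resolvent_herm (psd_Mal al z) tC).
Qed.

Let x_ge0 al z : 0 <= x al z.
Proof.
have := qf_resolvent_ge0 (psd_Mal al z) tC (Y al z).
by rewrite lecE /= => /andP[_].
Qed.

Let xE al z : qf (Gal al z) (Y al z) = (x al z)%:C.
Proof.
by apply/esym/RRe_real/ger0_real; exact: (qf_resolvent_ge0 (psd_Mal al z) tC).
Qed.

Lemma csample_stieltjes_ge0 z : 0 <= s z.
Proof.
apply: divr_ge0; last exact: ltW.
by have := tr_resolvent_ge0 (psd_csample z) tC; rewrite lecE /= => /andP[_].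
Qed.

Let trGE z : \tr (G z) = (N * s z)%:C.
Proof.
rewrite mulrC divfK ?gt_eqF//; apply/esym/RRe_real/ger0_real.
exact: (tr_resolvent_ge0 (psd_csample z) tC).
Qed.

Let s_near_T al z : `|s z - T al z| <= (t * N)^-1.
Proof.
have [h1 h2] := tr_resolventB (Y al z) (psd_Mal al z) tC (tauC al).
rewrite -[X in _ - \tr (resolvent X _)]csample_split -/(Gal al z) -/(G z) in h1 h2.
rewrite /s /T -mulrBl normrM (ger0_norm (_ : 0 <= N^-1)) ?invr_ge0 ?(ltW N0)//.
rewrite invfM ler_wpM2r ?invr_ge0 ?(ltW N0)//.
rewrite distrC ger0_norm.
  by move: h2; rewrite lecE -fmorphV ReD ReN => /andP[_].
by move: h1; rewrite lecE ReD ReN => /andP[_].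
Qed.

Let main_identity z :
  1 - t * s z - N^-1 * \sum_(al < m) (tau al * x al z / (1 + tau al * x al z)) = 0.
Proof.
have h : N%:C = t%:C * \tr (G z) + \sum_(al < m) (tau al)%:C * qf (G z) (Y al z).
  transitivity (\tr ((csample z + (t%:C)%:M) *m G z)).
    rewrite (mulBG (psd_csample z) tC) mxtrace1 card_ffun !card_ord.
    by rewrite /N rmorph_nat.
  rewrite mulmxDl raddfD /= addrC mul_scalar_mx linearZ /=; congr (_ + _).
  rewrite csampleE mulmx_suml raddf_sum /=; apply: eq_bigr => al _.
  rewrite /rk -scalemxAl mxtraceZ -mulmxA mxtrace_mulC trace_mx11.
  by [].
have g al : qf (G z) (Y al z) = (x al z / (1 + tau al * x al z))%:C.
  rewrite /G (csample_split al) (sherman (Y al z) (psd_Mal al z) tC (tauC al)) -/(Gal al z) xE.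
  by rewrite rmorphM fmorphV rmorphD rmorphM rmorph1.
move: h; under eq_bigr do rewrite g -rmorphM.
rewrite trGE -rmorphM -rmorph_sum -rmorphD => /complexI h.
rewrite (eq_bigr (fun al : 'I_m => tau al * x al z / (1 + tau al * x al z))) in h; last first.
  by move=> al _; rewrite mulrA.
move: h; set S := \sum_(al < m) _ => h.
apply: (mulfI (lt0r_neq0 N0)); rewrite mulr0.
transitivity (N - (t * (N * s z) + S)); last by rewrite -h subrr.
by field; rewrite gt_eqF.
Qed.

Lemma frac_lipschitz (a u v : R) : 0 <= a -> 0 <= u -> 0 <= v ->
  `|a * u / (1 + a * u) - a * v / (1 + a * v)| <= a * `|u - v|.
Proof.
move=> a0 u0 v0.
have au : 0 < 1 + a * u by rewrite ltr_pwDl// mulr_ge0.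
have av : 0 < 1 + a * v by rewrite ltr_pwDl// mulr_ge0.
have -> : a * u / (1 + a * u) - a * v / (1 + a * v) =
   a * (u - v) / ((1 + a * u) * (1 + a * v)).
  by field; rewrite !gt_eqF.
rewrite !normrM (ger0_norm a0) normfV (gtr0_norm (mulr_gt0 au av)).
rewrite ler_pdivrMr ?mulr_gt0// ler_peMr ?mulr_ge0//.
by rewrite -[leLHS]mulr1 ler_pM// lerDl mulr_ge0.
Qed.

Let Phi z := 1 - t * s z - N^-1 * \sum_(al < m) (tau al * s z / (1 + tau al * s z)).

(** A measurable majorant of the residual [Phi], to which Markov's inequality applies. The first
    summand is the fluctuation of x_a, the second the cost of replacing the trace without summand a
    by the full trace. *)
Let Bd z := N^-1 * \sum_(al < m) tau al * (`|x al z - T al z| + (t * N)^-1).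

Let Phi_le z : `|Phi z| <= Bd z.
Proof.
have -> : Phi z = N^-1 * \sum_(al < m) (tau al * x al z / (1 + tau al * x al z)
   - tau al * s z / (1 + tau al * s z)).
  rewrite sumrB mulrBr /Phi; congr (_ - _).
  by apply/eqP; rewrite -subr_eq0; apply/eqP; exact: main_identity.
rewrite normrM ger0_norm ?invr_ge0 ?(ltW N0)// ler_wpM2l ?invr_ge0 ?(ltW N0)//.
apply: le_trans (ler_norm_sum _ _ _) _; apply: ler_sum => al _.
apply: le_trans (frac_lipschitz _ _ _) _; rewrite ?(ltW (tau_gt0 _)) ?csample_stieltjes_ge0//.
rewrite ler_wpM2l ?(ltW (tau_gt0 _))//.
rewrite (_ : x al z - s z = (x al z - T al z) - (s z - T al z)); last by ring.
by apply: le_trans (ler_normB _ _) _; rewrite lerD2l.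
Qed.

Let bm_xT al : bm (fun z => x al z - T al z).
Proof.
apply: bmB.
  suff [//] : cbm (fun z => qf (Gal al z) (Y al z)).
  rewrite (_ : (fun z => _) = fun z => \sum_a (\sum_b (Y al z)^t* 0 b * Gal al z b a) * Y al z a 0).
    by apply: cbm_sum => a; apply: cbmM => //; apply: cbm_sum => b; apply: cbmM.
  apply/funext => z; rewrite /qf mxE; apply: eq_bigr => a _; congr (_ * _).
  by rewrite mxE.
apply: bmM; last exact: bm_cst.
by suff [//] : cbm (fun z => \tr (Gal al z)); apply: cbm_sum => a.
Qed.

Let bm_Bd : bm Bd.
Proof.
apply: bmM; first exact: bm_cst.
apply: bm_sum => al; apply: bmM; first exact: bm_cst.
by apply: bmD; [exact: bm_abs|exact: bm_cst].
Qed.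

(** The inequality |u| <= e + u^2 / e passes from the first absolute moment to the variance; [e]
    stays free and is fixed once the target probability is known. *)
Let Ex_Bd e : 0 < e -> Ex nu Bd <= (N^-1 * \sum_(al < m) tau al) *
  (e + e^-1 * (t ^- 2 * k%:R / n.+1%:R) + (t * N)^-1).
Proof.
move=> e0; rewrite /Bd ExZ; last first.
  apply: bm_sum => al; apply: bmM; first exact: bm_cst.
  by apply: bmD; [exact: bm_abs|exact: bm_cst].
rewrite -mulrA ler_wpM2l ?invr_ge0 ?(ltW N0)//.
rewrite Ex_sum => [|al]; last first.
  by apply: bmM; [exact: bm_cst|apply: bmD; [exact: bm_abs|exact: bm_cst]].
rewrite mulr_suml; apply: ler_sum => al _.
rewrite ExZ; last by apply: bmD; [exact: bm_abs|exact: bm_cst].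
rewrite ler_wpM2l ?(ltW (tau_gt0 _))//.
rewrite ExD; [|exact: bm_abs|exact: bm_cst].
rewrite Ex_cst lerD2r.
have bsq : bm (fun z => (x al z - T al z) ^+ 2).
  by rewrite (_ : (fun z => _) = fun z => (x al z - T al z) * (x al z - T al z)); [exact: bmM|apply/funext => z; rewrite expr2].
apply: (@le_trans _ _ (Ex nu (fun z => e + e^-1 * (x al z - T al z) ^+ 2))).
  apply: le_Ex; first exact: bm_abs.
    by apply: bmD; [exact: bm_cst|apply: bmM => //; exact: bm_cst].
  move=> z; set u := _ - _.
  rewrite -(ler_pM2l e0) mulrDr mulrA divff ?gt_eqF// mul1r -normr_id -(real_normK (num_real u)).
  have := sqr_ge0 (`|u| - e); have := sqr_ge0 (`|u|); have := normr_ge0 u; rewrite normr_id.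
  by move: `|u| => v; nra.
rewrite ExD; [|exact: bm_cst|by apply: bmM => //; exact: bm_cst].
by rewrite Ex_cst lerD2l ExZ// ler_wpM2l ?invr_ge0 ?(ltW e0).
Qed.

Lemma stieltjes_equation_whp (e dl : R) : 0 < e -> 0 < dl ->
  exists B : set W, [/\ measurable B,
    [set z | dl < `|1 - t * s z - N^-1 * \sum_(al < m) (tau al * s z / (1 + tau al * s z))|] `<=` B
  & (nu B <= ((N^-1 * \sum_(al < m) tau al) *
     (e + e^-1 * (t ^- 2 * k%:R / n.+1%:R) + (t * N)^-1) / dl)%:E)%E].
Proof.
move=> e0 dl0; exists [set z | dl < Bd z]; split.
- have [mB _] := bm_Bd.
  rewrite (_ : mkset _ = setT `&` Bd @^-1` `]dl, +oo[%classic).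
    exact: mB (measurable_itv _).
  by rewrite setTI; apply/seteqP; split => z /=; rewrite in_itv /= andbT.
- by move=> z /= h; apply: lt_le_trans h _; exact: Phi_le.
apply: le_trans (markov_bm nu bm_Bd _ dl0) _.
  by move=> z; apply: le_trans (Phi_le z).
by rewrite lee_fin ler_wpM2r ?invr_ge0 ?(ltW dl0)// Ex_Bd.
Qed.

End SampleResolvent.

(** * Averages of the weights *)

Section ExponentialTaylor.
Variable R : realType.
Implicit Types x : R.

(* [exp_rem p] is the absolute value of the Taylor remainder of order p of
   exp(-x), written so that (exp_rem p.+1)' = exp_rem p. *)
Fixpoint exp_rem (p : nat) x : R :=
  if p is p'.+1 then x ^+ p' / p'`!%:R - exp_rem p' x else expR (- x).

Lemma is_derive_exp_rem p x : is_derive x 1 (exp_rem p.+1) (exp_rem p x).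
Proof.
elim: p => [|p IH].
  rewrite (_ : exp_rem 1 = fun y => 1 - expR (- y)); last first.
    by apply/funext => y /=; rewrite expr0 fact0 divr1.
  by apply: is_derive_eq; rewrite /= add0r mul1r mulrN1 opprK.
rewrite (_ : exp_rem p.+2 = (p.+1)`!%:R^-1 *: (@id R ^+ p.+1) - exp_rem p.+1); last first.
  by apply/funext => y; rewrite fctE /= /GRing.scale /= mulrC.
have -> : exp_rem p.+1 x = x ^+ p / p`!%:R - exp_rem p x by [].
move: (exp_rem p x) (exp_rem p.+1) IH => dg g dgx.
apply: is_derive_eq; rewrite /GRing.scale /= mulr1; congr (_ - _).
by rewrite factS natrM invfM mulrACA mulVf ?pnatr_eq0// mul1r mulrC.
Qed.

(** Each remainder of positive order vanishes at 0 and has the previous remainder as its derivative,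
    so nonnegativity propagates by monotonicity. *)
Lemma exp_rem_ge0 p x : 0 <= x -> 0 <= exp_rem p x.
Proof.
elim: p x => [|p IH] x x0; first exact: expR_ge0.
have -> : 0 = exp_rem p.+1 0.
  elim: p {IH} => [|p IH] /=; first by rewrite oppr0 expR0 expr0 fact0 divr1 subrr.
  by rewrite expr0n mul0r sub0r; move: IH => /= <-; rewrite oppr0.
have dx y : derivable (exp_rem p.+1) y 1.
  by have [] := is_derive_exp_rem p y.
apply: (@ger0_derive1_ndecry _ _ 0) => //.
  move=> y; rewrite in_itv /= andbT => y0; rewrite derive1E.
  have [_ ->] := is_derive_exp_rem p y; apply: IH; exact: ltW.
apply: continuous_subspaceT => y.
by apply/differentiable_continuous/derivable1_diffP.
Qed.

Lemma exp_rem_le p x : 0 <= x -> exp_rem p x <= x ^+ p / p`!%:R.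
Proof. by move=> x0; rewrite -subr_ge0; have := exp_rem_ge0 p.+1 x0. Qed.

Lemma expRN_taylor p x :
  expR (- x) = \sum_(i < p) (- x) ^+ i / i`!%:R + (-1) ^+ p * exp_rem p x.
Proof.
elim: p => [|p IH]; first by rewrite big_ord0 add0r expr0 mul1r.
rewrite big_ord_recr /= -addrA {1}IH; congr (_ + _).
by rewrite exprS [(- x) ^+ p]exprNn; ring.
Qed.

Lemma expRN_taylor_bound p x : 0 <= x ->
  `|expR (- x) - \sum_(i < p) (- x) ^+ i / i`!%:R| <= x ^+ p / p`!%:R.
Proof.
move=> x0; rewrite (expRN_taylor p) addrAC subrr add0r normrM normrX normrN1 expr1n mul1r.
by rewrite ger0_norm ?exp_rem_ge0 ?exp_rem_le.
Qed.

(** The quotient q^q / q! is one term of the series of exp(q). *)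
Lemma exprn_le_fact q : q%:R ^+ q <= q`!%:R * expR 1 ^+ q :> R.
Proof.
case: q => [|q]; first by rewrite !expr0 fact0 mulr1.
rewrite -ler_pdivrMl ?ltr0n ?fact_gt0// mulrC -expRM_natl mulr1.
by apply: le_trans (expR_ge1Dxn q (ler0n _ q.+1)); rewrite lerDr.
Qed.

End ExponentialTaylor.

Section Averages.
Variable R : realType.

Lemma cvgn_approx (u : R^nat) :
  (forall e, 0 < e -> exists l, \forall n \near \oo, `|l - u n| <= e) -> cvgn u.
Proof.
move=> h; apply/cauchy_cvgP/cauchy_exP => e e0.
have e20 : 0 < e / 2 by rewrite divr_gt0.
have [l hl] := h _ e20; exists l.
apply: filterS hl => n /=; rewrite -ball_normE /= => /le_lt_trans; apply.
by rewrite gtr_pMr// invf_lt1// ltr1n.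
Qed.

Variable tau : nat -> R.
Hypothesis tau_ge0 : forall j, 0 <= tau j.

Definition avg (g : R -> R) (M : nat) : R := M%:R^-1 * \sum_(j < M) g (tau j).

Lemma avg_ge0 g M : (forall x, 0 <= x -> 0 <= g x) -> 0 <= avg g M.
Proof.
by move=> g0; rewrite mulr_ge0 ?invr_ge0// sumr_ge0// => j _; exact: g0.
Qed.

Lemma avgB g h M : avg (fun x => g x - h x) M = avg g M - avg h M.
Proof. by rewrite /avg sumrB mulrBr. Qed.

Lemma avgD g h M : avg (fun x => g x + h x) M = avg g M + avg h M.
Proof. by rewrite /avg big_split mulrDr. Qed.

Lemma avgZ a g M : avg (fun x => a * g x) M = a * avg g M.
Proof. by rewrite /avg -mulr_sumr mulrCA. Qed.

Lemma avg_cst a M : (0 < M)%N -> avg (fun=> a) M = a.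
Proof.
move=> M0; rewrite /avg sumr_const card_ord -[a *+ M]mulr_natl mulrA mulVf ?mul1r//.
by rewrite pnatr_eq0 -lt0n.
Qed.

Lemma le_avg g h M : (forall x, 0 <= x -> g x <= h x) -> avg g M <= avg h M.
Proof.
move=> gh; rewrite -subr_ge0 -avgB; apply: avg_ge0 => x x0.
by rewrite subr_ge0 gh.
Qed.

Lemma norm_avg g M : `|avg g M| <= avg (fun x => `|g x|) M.
Proof.
rewrite /avg normrM ger0_norm ?invr_ge0// ler_wpM2l ?invr_ge0//.
exact: ler_norm_sum.
Qed.

(** Closeness in mean for large M suffices, which matters since the functions to be approximated
    need not be close uniformly on an unbounded set of weights. *)
Lemma cvg_avg_approx g :
  (forall e, 0 < e -> exists h, cvgn (avg h) /\
     \forall M \near \oo, avg (fun x => `|h x - g x|) M <= e) -> cvgn (avg g).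
Proof.
move=> H; apply: cvgn_approx => e e0.
have e20 : 0 < e / 2 by rewrite divr_gt0.
have [h [ch hg]] := H _ e20.
exists (limn (avg h)); have /cvgrPdist_le /(_ _ e20) ch2 := ch; near=> M.
rewrite (_ : _ - _ = (limn (avg h) - avg h M) + avg (fun x => h x - g x) M); last first.
  by rewrite avgB addrA subrK.
apply: le_trans (ler_normD _ _) _; rewrite [leRHS]splitr; apply: lerD.
  by near: M.
by apply: le_trans (norm_avg _ _) _; near: M.
Unshelve. all: by end_near. Qed.

Lemma cvg_avg_lin (n : nat) (a : nat -> R) (g : nat -> R -> R) :
  (forall i, cvgn (avg (g i))) -> cvgn (avg (fun x => \sum_(i < n) a i * g i x)).
Proof.
move=> cg; elim: n => [|n IH].
  rewrite (_ : avg _ = fun=> 0); first exact: is_cvg_cst.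
  apply/funext => M; rewrite /avg; under eq_bigr do rewrite big_ord0.
  by rewrite big1 ?mulr0.
rewrite (_ : avg _ = (fun M => avg (fun x => \sum_(i < n) a i * g i x) M + a n * avg (g n) M)).
  by apply: is_cvgD => //; apply: is_cvgM => //; exact: is_cvg_cst.
by apply/funext => M; rewrite -avgZ -avgD; congr avg; apply/funext => x; rewrite big_ord_recr.
Qed.

Variables (mom : nat -> R) (A : R).
Hypothesis tau_mom : forall q, (0 < q)%N -> avg (fun x => x ^+ q) M @[M --> \oo] --> mom q.
Hypothesis A_gt0 : 0 < A.
Hypothesis mom_le : forall q, (0 < q)%N -> `|mom q| <= A ^+ q * q%:R ^+ q.

Definition expmom (q : nat) (u x : R) : R := x ^+ q * expR (- (u * x)).

Lemma cvg_expmom0 q : cvgn (avg (expmom q 0)).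
Proof.
case: q => [|q].
  rewrite (_ : expmom 0 0 = fun=> 1); last first.
    by apply/funext => x; rewrite /expmom mul0r oppr0 expR0 mulr1.
  apply: (cvgP (1 : R)); apply: cvg_near_cst; near=> M; rewrite avg_cst//.
  by near: M; exists 1%N.
rewrite (_ : expmom q.+1 0 = fun x => x ^+ q.+1).
  by apply/cvg_ex; exists (mom q.+1); exact: tau_mom.
by apply/funext => x; rewrite /expmom mul0r oppr0 expR0 mulr1.
Unshelve. all: by end_near. Qed.

(* Since q^q <= e^q q!, the Taylor coefficients of the limit of the averages of
   x^q e^(-u x), as a function of u, grow at most geometrically with a ratio
   independent of q: convergence propagates from u to u + h0. *)
Let c0 : R := 2 * (A * expR 1) + 1.
Let h0 : R := (2 * c0)^-1.

Let c0_gt0 : 0 < c0.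
Proof. by rewrite ltr_wpDl// !mulr_ge0 ?expR_ge0 ?(ltW A_gt0)// ler0n. Qed.

(** The binomial coefficient of p + q over p is one term of the expansion of 2^(p + q). *)
Let fact_split p q : (p + q)`!%:R <= 2 ^+ (p + q) * (p`!%:R * q`!%:R) :> R.
Proof.
rewrite -natrX -!natrM ler_nat -(bin_fact (leq_addr q p)) addKn leq_mul2r.
rewrite -[2%N]/(1 + 1)%N expnDn.
have plt : (p < (p + q).+1)%N by rewrite ltnS leq_addr.
by rewrite (bigD1 (Ordinal plt))//= !exp1n !muln1 leq_addr orbT.
Qed.

(** In p the growth is c0^p whatever [q] is; [q] only affects the prefactor. This makes the step
    length [h0] the same for all [q]. *)
Let mom_fact p q : (0 < p)%N -> mom (p + q) / p`!%:R <= c0 ^+ (p + q) * q`!%:R.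
Proof.
move=> p0; rewrite ler_pdivrMr ?ltr0n ?fact_gt0//.
apply: le_trans (ler_norm _) _; apply: le_trans (mom_le _) _; first by rewrite addn_gt0 p0.
apply: (@le_trans _ _ (A ^+ (p + q) * (2 ^+ (p + q) * (p`!%:R * q`!%:R) * expR 1 ^+ (p + q)))).
  rewrite ler_wpM2l ?exprn_ge0 ?(ltW A_gt0)//.
  apply: le_trans (exprn_le_fact _ _) _.
  by rewrite ler_wpM2r ?exprn_ge0 ?expR_ge0.
rewrite (_ : _ * _ = (2 * (A * expR 1)) ^+ (p + q) * (q`!%:R * p`!%:R)); last first.
  by rewrite !exprMn; ring.
rewrite -mulrA ler_wpM2r ?mulr_ge0//.
by rewrite lerXn2r ?nnegrE ?lerDl ?mulr_ge0 ?expR_ge0 ?(ltW A_gt0) ?(ltW c0_gt0).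
Qed.

Let taylor_pt q u p x : 0 <= x -> 0 <= u -> 0 <= h0 ->
  forall h, 0 <= h -> h <= h0 ->
  `|\sum_(i < p) (- h) ^+ i / i`!%:R * expmom (i + q) u x - expmom q (u + h) x| <=
    h0 ^+ p / p`!%:R * x ^+ (p + q).
Proof.
move=> x0 u0 h00 h hge hle.
have -> : \sum_(i < p) (- h) ^+ i / i`!%:R * expmom (i + q) u x =
  expmom q u x * \sum_(i < p) (- (h * x)) ^+ i / i`!%:R.
  rewrite mulr_sumr; apply: eq_bigr => i _.
  by rewrite /expmom exprD -(mulNr h x) exprMn; ring.
have -> : expmom q (u + h) x = expmom q u x * expR (- (h * x)).
  by rewrite /expmom mulrDl opprD expRD mulrA.
rewrite -mulrBr normrM distrC.
have hx : 0 <= h * x by rewrite mulr_ge0.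
apply: (@le_trans _ _ (x ^+ q * ((h * x) ^+ p / p`!%:R))).
  apply: ler_pM => //; last exact: expRN_taylor_bound.
  rewrite /expmom normrM ger0_norm ?exprn_ge0// ger0_norm ?expR_ge0//.
  by rewrite ler_piMr ?exprn_ge0// -expR0 ler_expR oppr_le0 mulr_ge0.
rewrite exprMn (_ : _ * _ = h ^+ p * (x ^+ (p + q) / p`!%:R)); last first.
  by rewrite exprD; ring.
rewrite [leRHS](_ : _ = h0 ^+ p * (x ^+ (p + q) / p`!%:R)); last by ring.
by rewrite ler_wpM2r ?divr_ge0 ?exprn_ge0// lerXn2r ?nnegrE.
Qed.

Let h0_gt0 : 0 < h0. Proof. by rewrite invr_gt0 mulr_gt0. Qed.

Let cvg_expmom_step u : 0 <= u -> (forall q, cvgn (avg (expmom q u))) ->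
  forall h, 0 <= h -> h <= h0 -> forall q, cvgn (avg (expmom q (u + h))).
Proof.
move=> u0 cu h hge hle q; apply: cvg_avg_approx => e e0.
(* As h0 c0 = 1 / 2, the Taylor error of order p is at most 2^-p C. The term q! in [C] comes from
   [mom_fact]; the term 1 pays for replacing the average of x^(p + q) by its limit plus 1. *)
pose C : R := c0 ^+ q * (q`!%:R + 1).
have C0 : 0 < C by rewrite mulr_gt0 ?exprn_gt0// ltr_wpDl.
have [p [p0 hp]] : exists p, (0 < p)%N /\ (2^-1) ^+ p * C <= e.
  have /cvgrPdist_le /(_ (e / C) (divr_gt0 e0 C0)) [p0 _ hp] : (2^-1 : R) ^+ n @[n --> \oo] --> (0 : R).
    by apply: cvg_expr; rewrite ger0_norm ?invr_ge0// invf_lt1// ltr1n.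
  exists p0.+1; split => //; have := hp p0.+1 (leqnSn p0).
  rewrite /= sub0r normrN ger0_norm ?exprn_ge0 ?invr_ge0//.
  by rewrite ler_pdivlMr.
exists (fun x => \sum_(i < p) (- h) ^+ i / i`!%:R * expmom (i + q) u x); split.
  exact: (@cvg_avg_lin p (fun i => (- h) ^+ i / i`!%:R) (fun i => expmom (i + q) u)).
have ml : \forall M \near \oo, avg (fun x => x ^+ (p + q)) M <= mom (p + q) + 1.
  have pq : (0 < p + q)%N by rewrite addn_gt0 p0.
  have := cvgr_le _ (tau_mom pq); apply; rewrite ltrDl; exact: ltr01.
apply: filterS ml => M ml.
apply: (@le_trans _ _ (avg (fun x => h0 ^+ p / p`!%:R * x ^+ (p + q)) M)).
  by apply: le_avg => x x0; exact: taylor_pt (ltW h0_gt0) _ hge hle.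
rewrite avgZ; apply: le_trans hp.
apply: (@le_trans _ _ (h0 ^+ p / p`!%:R * (mom (p + q) + 1))).
  by rewrite ler_wpM2l// divr_ge0 ?exprn_ge0 ?(ltW h0_gt0).
have hc : h0 ^+ p * c0 ^+ p = 2^-1 ^+ p.
  by rewrite -exprMn; congr (_ ^+ p); rewrite /h0; field; rewrite gt_eqF.
rewrite -hc -!mulrA ler_wpM2l ?exprn_ge0 ?(ltW h0_gt0)//.
have -> : p`!%:R^-1 * (mom (p + q) + 1) = mom (p + q) / p`!%:R + p`!%:R^-1 by ring.
have -> : c0 ^+ p * C = c0 ^+ (p + q) * q`!%:R + c0 ^+ (p + q) by rewrite exprD /C; ring.
apply: lerD; first exact: mom_fact.
apply: (@le_trans _ _ 1); first by rewrite invf_le1 ?ler1n ?ltr0n fact_gt0.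
by rewrite exprn_ege1// lerDr !mulr_ge0 ?expR_ge0 ?(ltW A_gt0).
Qed.

Lemma cvg_expmom u : 0 <= u -> forall q, cvgn (avg (expmom q u)).
Proof.
move=> u0.
have H (i : nat) v : 0 <= v -> v <= i%:R * h0 -> forall q, cvgn (avg (expmom q v)).
  elim: i v => [|i IH] v v0 vi.
    have -> : v = 0 by apply/le_anti; rewrite v0 andbT -(mul0r h0).
    exact: cvg_expmom0.
  have [vh|hv] := leP v h0.
    by rewrite -[v]add0r; apply: cvg_expmom_step => //; exact: cvg_expmom0.
  have -> : v = (v - h0) + h0 by rewrite subrK.
  have v1 : 0 <= v - h0 by rewrite subr_ge0 ltW.
  apply: cvg_expmom_step => //; [|exact: ltW].
  by apply: IH => //; rewrite lerBlDr -[X in _ + X]mul1r -mulrDl natr1.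
apply: (H (Num.truncn (u / h0)).+1) => //.
by rewrite -ler_pdivrMr// ltW// truncnS_gt.
Qed.

(** 1 / (1 + s x) is the integral of exp(- v (1 + s x)) over v >= 0. A Riemann sum of mesh h with J
    terms is a finite combination of functions [expmom 0], and being geometric it can be compared
    with the integral explicitly: discretization and truncation each cost at most h, uniformly in x
    >= 0. *)
Lemma cvg_avg_resolvent s : 0 <= s -> cvgn (avg (fun x => (1 + s * x)^-1)).
Proof.
move=> s0; apply: cvg_avg_approx => e e0.
pose h := e / 2; have h_gt0 : 0 < h by rewrite divr_gt0.
(* The discarded tail is h / (1 - r) times r^J. Here h / (1 - r) <= h + 1 and r <= exp(- h) for
   every x >= 0, so [J] can be chosen independently of x. *)
have [J hJ] : exists J : nat, (h + 1) * expR (- h) ^+ J <= h.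
  have h1 : 0 < h + 1 by rewrite addr_gt0.
  have /cvgrPdist_le /(_ (h / (h + 1)) (divr_gt0 h_gt0 h1)) [J _ HJ] :
      (expR (- h)) ^+ n @[n --> \oo] --> (0 : R).
    by apply: cvg_expr; rewrite ger0_norm ?expR_ge0// -expR0 ltr_expR oppr_lt0.
  exists J; have := HJ J (leqnn J).
  by rewrite /= sub0r normrN ger0_norm ?exprn_ge0 ?expR_ge0// ler_pdivlMr// mulrC.
exists (fun x => \sum_(j < J) (h * expR (- (j%:R * h))) * expmom 0 (j%:R * h * s) x); split.
  apply: (@cvg_avg_lin J (fun j => h * expR (- (j%:R * h))) (fun j => expmom 0 (j%:R * h * s))).
  by move=> j; apply: cvg_expmom; rewrite !mulr_ge0// ltW.
exists 1%N => // M /= M1; rewrite -(avg_cst e M1); apply: le_avg => x x0.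
have sx : 0 <= s * x by rewrite mulr_ge0.
pose y := h * (1 + s * x); pose r := expR (- y).
have y0 : 0 < y by rewrite mulr_gt0// ltr_pwDl.
have -> : \sum_(j < J) (h * expR (- (j%:R * h))) * expmom 0 (j%:R * h * s) x =
  h * \sum_(j < J) r ^+ j.
  rewrite mulr_sumr; apply: eq_bigr => j _; rewrite /expmom expr0 mul1r -mulrA -expRD.
  by congr (_ * _); rewrite /r -expRM_natl; congr expR; rewrite /y; ring.
have r1 : r < 1 by rewrite -expR0 ltr_expR oppr_lt0.
have r0 : 0 <= r by exact: expR_ge0.
have dr : 0 < 1 - r by rewrite subr_gt0.
have geo : \sum_(j < J) r ^+ j = (1 - r ^+ J) / (1 - r).
  apply: (canRL (mulfK (lt0r_neq0 dr))); rewrite mulrC -opprB mulNr -subrX1; ring.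
have er : 1 - y <= r by apply: le_trans (expR_ge1Dx _).
have er2 : r * (1 + y) <= 1.
  rewrite -[leRHS](expRxMexpNx_1 y) mulrC ler_wpM2r//; exact: expR_ge1Dx.
have b1 : h / (1 - r) - (1 + s * x)^-1 <= h.
  have -> : (1 + s * x)^-1 = h / y by rewrite /y invfM mulrA divff ?mul1r// gt_eqF.
  rewrite lerBlDr ler_pdivrMr//.
  have -> : (h + h / y) * (1 - r) = h * ((1 + y - r * (1 + y)) / y).
    by field; rewrite gt_eqF.
  by rewrite ler_peMr ?(ltW h_gt0)// ler_pdivlMr// mul1r; lra.
have b2 : 0 <= h / (1 - r) - (1 + s * x)^-1.
  have -> : (1 + s * x)^-1 = h / y by rewrite /y invfM mulrA divff ?mul1r// gt_eqF.
  by rewrite subr_ge0 ler_pM2l// lef_pV2 ?posrE//; lra.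
have rJ : h / (1 - r) * r ^+ J <= h.
  apply: le_trans hJ; apply: ler_pM.
  - by rewrite divr_ge0// ltW.
  - exact: exprn_ge0.
  - rewrite lerBlDr in b1; apply: le_trans b1 _; rewrite lerD2l invf_le1 ?ltr_pwDl//.
    by rewrite lerDl.
  rewrite lerXn2r ?nnegrE ?expR_ge0// ler_expR lerN2 /y.
  by rewrite ler_peMr ?(ltW h_gt0)// lerDl.
have rJ0 : 0 <= h / (1 - r) * r ^+ J by rewrite mulr_ge0 ?exprn_ge0// divr_ge0// ltW.
rewrite geo (_ : _ - _ = (h / (1 - r) - (1 + s * x)^-1) - h / (1 - r) * r ^+ J); last by ring.
apply: le_trans (ler_normB _ _) _; rewrite ger0_norm// ger0_norm// [e]splitr.
exact: lerD.
Qed.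

Lemma cvg_avg_frac s : 0 <= s -> cvgn (avg (fun x => s * x / (1 + s * x))).
Proof.
move=> s0; rewrite (_ : avg _ = fun M => avg (fun=> 1) M - avg (fun x => (1 + s * x)^-1) M).
  apply: is_cvgB; last exact: cvg_avg_resolvent.
  apply: (cvgP (1 : R)); apply: cvg_near_cst; near=> M; rewrite avg_cst//.
  by near: M; exists 1%N.
apply/funext => M; rewrite -avgB /avg; congr (_ * _); apply: eq_bigr => j _.
by field; rewrite gt_eqF// ltr_pwDl// mulr_ge0.
Unshelve. all: by end_near. Qed.

End Averages.

(** * Convergence in probability of positive functionals *)

Section SmallSets.
Variables (R : realType) (d : nat -> measure_display) (T : forall n, measurableType (d n)).
Variable P : forall n, probability (T n) R.
Implicit Types (E : forall n, set (T n)) (X : forall n, T n -> R).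

(* No measurability of [E] is required: [small] is about outer measure. *)
Definition small E := forall eta : R, 0 < eta -> \forall n \near \oo,
  exists B : set (T n), [/\ measurable B, E n `<=` B & (P n B <= eta%:E)%E].

Lemma small_sub E E' : (\forall n \near \oo, E n `<=` E' n) -> small E' -> small E.
Proof.
move=> EE' sE' eta eta0; near=> n.
have [B [mB E'B PB]] : exists B : set (T n),
    [/\ measurable B, E' n `<=` B & (P n B <= eta%:E)%E].
  by near: n; exact: sE'.
exists B; split => //; apply: subset_trans E'B; near: n; exact: EE'.
Unshelve. all: by end_near. Qed.

Lemma smallU E E' : small E -> small E' -> small (fun n => E n `|` E' n).
Proof.
move=> sE sE' eta eta0; have e2 : 0 < eta / 2 by rewrite divr_gt0.
near=> n.
have [B [mB EB PB]] : exists B : set (T n),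
    [/\ measurable B, E n `<=` B & (P n B <= (eta / 2)%:E)%E].
  by near: n; exact: sE.
have [B' [mB' EB' PB']] : exists B : set (T n),
    [/\ measurable B, E' n `<=` B & (P n B <= (eta / 2)%:E)%E].
  by near: n; exact: sE'.
exists (B `|` B'); split; [exact: measurableU|exact: setUSS|].
apply: le_trans (measureU2 _ mB mB') _.
by rewrite [eta]splitr EFinD leeD.
Unshelve. all: by end_near. Qed.

Lemma small0 : small (fun n => set0).
Proof. by move=> eta eta0; near=> n; exists set0; split=> //; rewrite measure0 lee_fin ltW.
Unshelve. all: by end_near. Qed.

Lemma small_bigU (N : nat) (E : nat -> forall n, set (T n)) :
  (forall i, small (E i)) -> small (fun n => [set w | exists2 i, (i < N)%N & E i n w]).
Proof.
move=> sE; elim: N => [|N IH].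
  by apply: small_sub small0; near=> n => w [].
apply: small_sub (smallU IH (sE N)); near=> n => w [j].
rewrite ltnS leq_eqVlt => /orP[/eqP ->|jN] Ew; first by right.
by left; exists j.
Unshelve. all: by end_near. Qed.

(** A set of outer probability at most 1 / 2 is not everything. Inequalities between deterministic
    limits can thus be read off at one good sample point. *)
Lemma small_notT E : small E -> \forall n \near \oo, exists w, ~ E n w.
Proof.
move=> /(_ 2^-1); rewrite invr_gt0 => /(_ (ltr0n _ 2)).
apply: filterS => n [B [mB EB PB]]; apply: contrapT => /forallNP allE.
have BT : B = setT.
  by apply/seteqP; split => // w _; apply: EB; apply: contrapT; exact: allE.
move: PB; rewrite BT probability_setT lee_fin => h.
by have := le_lt_trans h (_ : 2^-1 < 1); rewrite ltxx invf_lt1// ltr1n => /(_ isT).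
Qed.

Definition cvgp X (l : R) := forall e : R, 0 < e -> small (fun n => [set w | e < `|X n w - l|]).

Lemma cvgp_cst l : cvgp (fun n _ => l) l.
Proof.
move=> e e0; apply: small_sub small0; near=> n => w /=.
by rewrite subrr normr0 ltNge (ltW e0).
Unshelve. all: by end_near. Qed.

Lemma cvgpD X X' l l' : cvgp X l -> cvgp X' l' -> cvgp (fun n w => X n w + X' n w) (l + l').
Proof.
move=> cX cX' e e0; have e2 : 0 < e / 2 by rewrite divr_gt0.
apply: small_sub (smallU (cX _ e2) (cX' _ e2)); near=> n => w /= h.
apply: contrapT => /not_orP[/negP h1 /negP h2]; move: h; apply/negP.
rewrite -!leNgt in h1 h2 *; rewrite opprD addrACA [e]splitr.
by apply: le_trans (ler_normD _ _) _; exact: lerD.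
Unshelve. all: by end_near. Qed.

Lemma cvgpZ a X l : cvgp X l -> cvgp (fun n w => a * X n w) (a * l).
Proof.
move=> cX e e0; have [->|a0] := eqVneq a 0.
  apply: small_sub small0; near=> n => w /=.
  by rewrite !mul0r subrr normr0 ltNge (ltW e0).
have ea : 0 < e / `|a| by rewrite divr_gt0// normr_gt0.
apply: small_sub (cX _ ea); near=> n => w /=.
by rewrite -mulrBr normrM ltr_pdivrMr ?normr_gt0// mulrC.
Unshelve. all: by end_near. Qed.

Lemma cvgp_sum (N : nat) (a : nat -> R) (X : nat -> forall n, T n -> R) (l : nat -> R) :
  (forall i, cvgp (X i) (l i)) ->
  cvgp (fun n w => \sum_(i < N) a i * X i n w) (\sum_(i < N) a i * l i).
Proof.
move=> cX; elim: N => [|N IH].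
  rewrite big_ord0 (_ : (fun n w => _) = fun n _ => 0); first exact: cvgp_cst.
  by apply: functional_extensionality_dep => n; apply/funext => w; rewrite big_ord0.
rewrite big_ord_recr /= (_ : (fun n w => _) =
  fun n w => \sum_(i < N) a i * X i n w + a N * X N n w).
  by apply: cvgpD => //; exact: cvgpZ.
by apply: functional_extensionality_dep => n; apply/funext => w; rewrite big_ord_recr.
Qed.

Lemma cvgp_le X X' l l' e : cvgp X l -> cvgp X' l' ->
  (\forall n \near \oo, forall w, X n w <= X' n w + e) -> l <= l' + e.
Proof.
move=> cX cX' XX'; apply/ler_addgt0Pl => eta eta0.
have e2 : 0 < eta / 2 by rewrite divr_gt0.
have h := small_notT (smallU (cX _ e2) (cX' _ e2)).
have : \forall n \near \oo, l <= eta + (l' + e).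
  near=> n.
  have [w /not_orP[/negP h1 /negP h2]] : exists w,
      ~ ([set w | eta / 2 < `|X n w - l|] `|` [set w | eta / 2 < `|X' n w - l'|]) w.
    by near: n.
  have h3 : X n w <= X' n w + e by move: w {h1 h2}; near: n.
  rewrite -!leNgt !ler_norml in h1 h2; lra.
by move=> [N _ /(_ N (leqnn N))].
Unshelve. all: by end_near. Qed.

Lemma cvgp_unique X l l' : cvgp X l -> cvgp X l' -> l = l'.
Proof.
move=> h h'; apply/le_anti; rewrite -[l' in X in X && _]addr0 -[l in X in _ && X]addr0.
by apply/andP; split; [apply: (cvgp_le h h')|apply: (cvgp_le h' h)]; near=> n => w; rewrite addr0.
Unshelve. all: by end_near. Qed.

Lemma cvgp_near X X' l : (\forall n \near \oo, forall w, X n w = X' n w) ->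
  cvgp X' l -> cvgp X l.
Proof.
move=> XX' cX' e e0; apply: small_sub (cX' e e0).
by apply: filterS XX' => n h w /=; rewrite h.
Qed.

Lemma cvgp_approx_to X l :
  (forall e, 0 < e -> exists X' l', [/\ cvgp X' l', `|l' - l| <= e &
    \forall n \near \oo, forall w, `|X n w - X' n w| <= e]) -> cvgp X l.
Proof.
move=> H e e0; have e3 : 0 < e / 3 by rewrite divr_gt0.
have [X' [l' [cX' ll' XX']]] := H _ e3.
apply: small_sub (cX' _ e3); near=> n => w /= h.
have h1 : `|X n w - X' n w| <= e / 3 by move: w {h}; near: n.
apply: contrapT => /negP; rewrite -leNgt => h2; move: h; apply/negP; rewrite -leNgt.
rewrite (_ : X n w - l = (X n w - X' n w) + (X' n w - l') + (l' - l)); last by ring.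
apply: le_trans (ler_normD _ _) _; apply: le_trans (lerD (ler_normD _ _) ll') _.
lra.
Unshelve. all: by end_near. Qed.

(** Two approximants differ everywhere by at most the sum of their errors, so by [cvgp_le] their
    limits form a Cauchy sequence; its limit is the limit of [X]. *)
Lemma cvgp_approx X :
  (forall e, 0 < e -> exists X' l', cvgp X' l' /\
    \forall n \near \oo, forall w, `|X n w - X' n w| <= e) -> exists l, cvgp X l.
Proof.
move=> H.
have H' (j : nat) : exists Xl : (forall n, T n -> R) * R, cvgp Xl.1 Xl.2 /\
    \forall n \near \oo, forall w, `|X n w - Xl.1 n w| <= j.+1%:R^-1.
  by have [|X' [l' ?]] := H j.+1%:R^-1; [rewrite invr_gt0|exists (X', l')].
have {}H' := choice H'; case: H' => f Hf.
have close i j : `|(f i).2 - (f j).2| <= i.+1%:R^-1 + j.+1%:R^-1.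
  have [ci Xi] := Hf i; have [cj Xj] := Hf j.
  have h1 : (f i).2 <= (f j).2 + (i.+1%:R^-1 + j.+1%:R^-1).
    apply: (cvgp_le ci cj); near=> n.
    have g1 : forall w, `|X n w - (f i).1 n w| <= i.+1%:R^-1 by near: n.
    have g2 : forall w, `|X n w - (f j).1 n w| <= j.+1%:R^-1 by near: n.
    move=> w; move: (g1 w) (g2 w); rewrite !ler_norml.
    by move: (i.+1%:R^-1) (j.+1%:R^-1) => ei ej /andP[? ?] /andP[? ?]; lra.
  have h2 : (f j).2 <= (f i).2 + (i.+1%:R^-1 + j.+1%:R^-1).
    apply: (cvgp_le cj ci); near=> n.
    have g1 : forall w, `|X n w - (f i).1 n w| <= i.+1%:R^-1 by near: n.
    have g2 : forall w, `|X n w - (f j).1 n w| <= j.+1%:R^-1 by near: n.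
    move=> w; move: (g1 w) (g2 w); rewrite !ler_norml.
    by move: (i.+1%:R^-1) (j.+1%:R^-1) => ei ej /andP[? ?] /andP[? ?]; lra.
  by rewrite ler_norml; move: h1 h2; move: (i.+1%:R^-1) (j.+1%:R^-1) => ei ej *; lra.
have inv0 (e : R) : 0 < e -> exists j, forall i, (j <= i)%N -> i.+1%:R^-1 <= e.
  move=> e0; exists (Num.truncn e^-1) => i ji.
  rewrite -[e]invrK lef_pV2 ?posrE ?invr_gt0//.
  by apply: ltW; apply: lt_le_trans (truncnS_gt _) _; rewrite ler_nat ltnS.
have cl : cvgn (fun j => (f j).2).
  apply: cvgn_approx => e e0; have e2 : 0 < e / 2 by rewrite divr_gt0.
  have [j hj] := inv0 _ e2; exists (f j).2; exists j => // i /= ji.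
  by apply: le_trans (close _ _) _; rewrite [e]splitr lerD// hj.
exists (limn (fun j => (f j).2)); apply: cvgp_approx_to => e e0.
have [j hj] := inv0 _ e0.
have /cvgrPdist_le /(_ _ e0) [j' _ hj'] := cl.
have [c1 c2] := Hf (maxn j j').
exists (f (maxn j j')).1, (f (maxn j j')).2; split => //.
  by rewrite distrC; apply: hj'; rewrite /= leq_maxr.
apply: filterS c2 => n h w; apply: le_trans (h w) _; apply: hj; exact: leq_maxl.
Unshelve. all: by end_near. Qed.

End SmallSets.

(** * Positive normalized functionals and inverse powers *)

Section PositiveMeans.
Variable R : realType.
Implicit Types (f g : R -> R) (Lam : (R -> R) -> R).

(* Spectra are nonnegative, so boundedness is only asked on [0, +oo[. *)
Definition bmp f := measurable_fun setT f /\ exists M : R, forall x, 0 <= x -> `|f x| <= M.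

Lemma bmp_cst c : bmp (fun=> c). Proof. by split => //; exists `|c|. Qed.

Lemma bmpD f g : bmp f -> bmp g -> bmp (fun x => f x + g x).
Proof.
move=> [mf [M fM]] [mg [N gN]]; split; first exact: measurable_funD.
by exists (M + N) => x x0; rewrite (le_trans (ler_normD _ _)) ?lerD ?fM ?gN.
Qed.

Lemma bmpM f g : bmp f -> bmp g -> bmp (fun x => f x * g x).
Proof.
move=> [mf [M fM]] [mg [N gN]]; split; first exact: measurable_funM.
by exists (M * N) => x x0; rewrite normrM ler_pM ?fM ?gN.
Qed.

Lemma bmpZ c f : bmp f -> bmp (fun x => c * f x).
Proof. by move=> bf; apply: bmpM => //; exact: bmp_cst. Qed.

Lemma bmp_sum (N : nat) (a : nat -> R) (g : nat -> R -> R) : (forall i, bmp (g i)) ->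
  bmp (fun x => \sum_(i < N) a i * g i x).
Proof.
move=> bg; elim: N => [|N IH].
  by rewrite (_ : (fun x => _) = fun=> 0); [exact: bmp_cst|apply/funext => x; rewrite big_ord0].
rewrite (_ : (fun x => _) = fun x => \sum_(i < N) a i * g i x + a N * g N x).
  by apply: bmpD => //; exact: bmpZ.
by apply/funext => x; rewrite big_ord_recr.
Qed.

Definition ind_le (a x : R) : R := (x <= a)%R%:R.

Lemma bmp_ind a : bmp (ind_le a).
Proof.
split; last by exists 1 => x _; rewrite /ind_le; case: (x <= a)%R; rewrite ?normr1 ?normr0.
rewrite (_ : ind_le a = \1_`]-oo, a]%classic); first exact: measurable_indic.
by apply/funext => x; rewrite indicE /ind_le mem_setE in_itv.
Qed.

Definition rpow (p : nat) (t x : R) : R := (x + t) ^- p.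

Lemma bmp_rpow p t : 0 < t -> bmp (rpow p t).
Proof.
move=> t0; split.
  rewrite /rpow; apply: (measurableT_comp (@measurable_invr R)).
  apply: measurable_funX; exact: measurable_funD.
exists (t ^- p) => x x0; have xt : t <= x + t by rewrite lerDr.
have xt0 : 0 < x + t by apply: lt_le_trans xt.
rewrite /rpow ger0_norm ?invr_ge0 ?exprn_ge0 ?(ltW xt0)//.
by rewrite lef_pV2 ?posrE ?exprn_gt0// lerXn2r ?nnegrE ?(ltW t0) ?(ltW xt0).
Qed.

(** A quantitative derivative in t of (x + t)^-(p + 1), uniform in x >= 0. The factorization of
    a^-(q + 1) - b^-(q + 1) replaces the mean value theorem: at q = p it brackets the quotient
    between b^-(p + 2) and a^-(p + 2), at q = p + 1 it bounds the width of that bracket. *)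
Lemma rpow_diff p t dl x : 0 < t -> 0 < dl -> 0 <= x ->
  `|(p.+1%:R * dl)^-1 * (rpow p.+1 t x - rpow p.+1 (t + dl) x) - rpow p.+2 t x|
    <= dl * (p.+2%:R * t ^- p.+3).
Proof.
move=> t0 d0 x0; rewrite /rpow.
set a := x + t; set b := x + (t + dl).
have ta : t <= a by rewrite lerDr.
have a0 : 0 < a by apply: lt_le_trans ta.
have ab : a + dl = b by rewrite /a /b addrA.
have b0 : 0 < b by rewrite -ab addr_gt0.
have pw (q : nat) : q.+1%:R * dl * b ^- q.+2 <= a ^- q.+1 - b ^- q.+1 <= q.+1%:R * dl * a ^- q.+2.
  have aV : 0 < a^-1 by rewrite invr_gt0.
  have bV : 0 < b^-1 by rewrite invr_gt0.
  have baV : b^-1 <= a^-1 by rewrite lef_pV2 ?posrE// -ab lerDl ltW.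
  have e1 : a^-1 - b^-1 = dl * (a^-1 * b^-1).
    by rewrite -ab; field; rewrite ab !gt_eqF.
  have s1 : q.+1%:R * b^-1 ^+ q <= \sum_(i < q.+1) a^-1 ^+ (q.+1.-1 - i) * b^-1 ^+ i.
    rewrite -[q.+1 in X in X <= _]card_ord mulr_natl -sumr_const; apply: ler_sum => i _.
    have iq : (i <= q)%N by rewrite -ltnS.
    rewrite -{1}(subnK iq) exprD ler_wpM2r ?exprn_ge0 ?(ltW bV)//.
    by rewrite lerXn2r ?nnegrE ?(ltW aV) ?(ltW bV).
  have s2 : \sum_(i < q.+1) a^-1 ^+ (q.+1.-1 - i) * b^-1 ^+ i <= q.+1%:R * a^-1 ^+ q.
    rewrite -[q.+1 in X in _ <= X]card_ord mulr_natl -sumr_const; apply: ler_sum => i _.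
    have iq : (i <= q)%N by rewrite -ltnS.
    rewrite -[in X in _ <= X](subnK iq) exprD ler_wpM2l ?exprn_ge0 ?(ltW aV)//.
    by rewrite lerXn2r ?nnegrE ?(ltW aV) ?(ltW bV).
  rewrite -!exprVn subrXX e1.
  have c1 (v : R) : q.+1%:R * dl * v ^+ q.+2 = dl * (v * v * (q.+1%:R * v ^+ q)).
    by rewrite !exprS; ring.
  rewrite !c1 -(mulrA dl) !(ler_pM2l d0); apply/andP; split.
    apply: ler_pM; last exact: s1.
    - by rewrite mulr_ge0// ltW.
    - by rewrite mulr_ge0// exprn_ge0// ltW.
    - by rewrite ler_wpM2r// ltW.
  apply: ler_pM; last exact: s2.
  - by rewrite mulr_ge0// ltW.
  - by apply: sumr_ge0 => i _; rewrite mulr_ge0// exprn_ge0// ltW.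
  - by rewrite ler_wpM2l// ltW.
have pd : 0 < p.+1%:R * dl by rewrite mulr_gt0// ltr0n.
have /andP[h1 h2] := pw p; have /andP[h3 h4] := pw p.+1.
have h5 : a ^- p.+3 <= t ^- p.+3.
  by rewrite lef_pV2 ?posrE ?exprn_gt0// lerXn2r ?nnegrE ?(ltW t0) ?(ltW a0).
have g1 : b ^- p.+2 <= (p.+1%:R * dl)^-1 * (a ^- p.+1 - b ^- p.+1).
  by rewrite mulrC ler_pdivlMr// mulrC.
have g2 : (p.+1%:R * dl)^-1 * (a ^- p.+1 - b ^- p.+1) <= a ^- p.+2.
  by rewrite mulrC ler_pdivrMr// mulrC.
have h6 : p.+2%:R * dl * a ^- p.+3 <= dl * (p.+2%:R * t ^- p.+3).
  by rewrite (mulrC _ dl) -mulrA ler_pM2l// ler_pM2l ?ltr0n.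
have h7 := le_trans h4 h6.
have Z0 : 0 <= dl * (p.+2%:R * t ^- p.+3).
  by rewrite !mulr_ge0 ?invr_ge0 ?exprn_ge0 ?(ltW t0) ?(ltW d0).
rewrite ler_norml; move: g1 g2 h7 Z0.
move: (_ * (a ^- p.+1 - _)) (a ^- p.+2) (b ^- p.+2) (dl * _) => q1 q2 q3 q4 *; lra.
Qed.

(** The properties of an average that the limit argument uses, shared by the mean over a spectrum
    and the integral against the Marchenko-Pastur law. *)
Definition pmean Lam := [/\ forall c, Lam (fun=> c) = c,
  forall f g, bmp f -> bmp g -> Lam (fun x => f x + g x) = Lam f + Lam g,
  forall c f, bmp f -> Lam (fun x => c * f x) = c * Lam f &
  forall f g, bmp f -> bmp g -> (forall x, 0 <= x -> f x <= g x) -> Lam f <= Lam g].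

Section OneMean.
Variable Lam : (R -> R) -> R.
Hypothesis pL : pmean Lam.

Lemma pmeanB f g : bmp f -> bmp g -> Lam (fun x => f x - g x) = Lam f - Lam g.
Proof.
case: pL => _ LD LZ _ bf bg.
rewrite (_ : (fun x => _) = fun x => f x + (-1) * g x); last first.
  by apply/funext => x; rewrite mulN1r.
by rewrite LD ?LZ ?mulN1r//; exact: bmpZ.
Qed.

Lemma pmean_sum (N : nat) (a : nat -> R) (g : nat -> R -> R) : (forall i, bmp (g i)) ->
  Lam (fun x => \sum_(i < N) a i * g i x) = \sum_(i < N) a i * Lam (g i).
Proof.
case: pL => Lc LD LZ _ bg; elim: N => [|N IH].
  rewrite big_ord0 (_ : (fun x => _) = fun=> 0) ?Lc//.
  by apply/funext => x; rewrite big_ord0.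
rewrite big_ord_recr /= -IH (_ : (fun x => _) = fun x => \sum_(i < N) a i * g i x + a N * g N x).
  by rewrite LD ?LZ//; [exact: bmp_sum|exact: bmpZ].
by apply/funext => x; rewrite big_ord_recr.
Qed.

Lemma pmean_close f g e : bmp f -> bmp g ->
  (forall x, 0 <= x -> `|f x - g x| <= e) -> `|Lam f - Lam g| <= e.
Proof.
case: pL => Lc LD LZ Lle bf bg fg.
rewrite -pmeanB// ler_norml; apply/andP; split.
  rewrite -[leLHS]Lc; apply: Lle; first exact: bmp_cst.
    by rewrite (_ : (fun x => _) = fun x => f x + (-1) * g x);
      [apply: bmpD => //; exact: bmpZ|apply/funext => x; rewrite mulN1r].
  by move=> x /fg; rewrite ler_norml => /andP[].
rewrite -[leRHS]Lc; apply: Lle.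
- by rewrite (_ : (fun x => _) = fun x => f x + (-1) * g x);
    [apply: bmpD => //; exact: bmpZ|apply/funext => x; rewrite mulN1r].
- exact: bmp_cst.
by move=> x /fg; rewrite ler_norml => /andP[].
Qed.

Lemma pmean_rpow_diff p t dl : 0 < t -> 0 < dl ->
  `|(p.+1%:R * dl)^-1 * (Lam (rpow p.+1 t) - Lam (rpow p.+1 (t + dl))) - Lam (rpow p.+2 t)|
    <= dl * (p.+2%:R * t ^- p.+3).
Proof.
move=> t0 d0; have td0 : 0 < t + dl by rewrite addr_gt0.
have b1 := bmp_rpow p.+1 t0; have b2 := bmp_rpow p.+1 td0; have b3 := bmp_rpow p.+2 t0.
have b4 : bmp (fun x => rpow p.+1 t x - rpow p.+1 (t + dl) x).
  rewrite (_ : (fun x => _) = fun x => rpow p.+1 t x + (-1) * rpow p.+1 (t + dl) x).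
    by apply: bmpD => //; exact: bmpZ.
  by apply/funext => x; rewrite mulN1r.
rewrite -pmeanB//; case: pL => _ _ LZ _; rewrite -LZ//.
apply: pmean_close => //; first exact: bmpZ.
by move=> x x0; exact: rpow_diff.
Qed.

End OneMean.
End PositiveMeans.

Section IndicatorApproximation.
Variable R : realType.

Lemma bernoulli_lb (s : R) k : 0 <= s -> 1 + k%:R * s <= (1 + s) ^+ k.
Proof.
move=> s0; elim: k => [|k IH]; first by rewrite mul0r addr0 expr0.
rewrite exprS; apply: (@le_trans _ _ ((1 + s) * (1 + k%:R * s))).
  rewrite -natr1; have : 0 <= k%:R * s * s by rewrite !mulr_ge0.
  by move: (k%:R : R) => c h; nra.
by rewrite ler_wpM2l// addr_ge0.
Qed.

Lemma bernoulli_sub_lb (s : R) k : 0 <= s <= 1 -> 1 - k%:R * s <= (1 - s) ^+ k.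
Proof.
move=> /andP[s0 s1]; elim: k => [|k IH]; first by rewrite mul0r subr0 expr0.
rewrite exprS; apply: (@le_trans _ _ ((1 - s) * (1 - k%:R * s))).
  rewrite -natr1; have : 0 <= k%:R * s * s by rewrite !mulr_ge0.
  by move: (k%:R : R) => c h; nra.
by rewrite ler_wpM2l// subr_ge0.
Qed.

(** From (1 - s)^k (1 + s)^k <= 1 and (1 + s)^k >= k s. *)
Lemma bernoulli_sub_ub (s : R) k : 0 < s <= 1 -> (0 < k)%N -> (1 - s) ^+ k <= (k%:R * s)^-1.
Proof.
move=> /andP[s0 s1] k0; have ks : 0 < k%:R * s by rewrite mulr_gt0// ltr0n.
rewrite -[leRHS]mul1r ler_pdivlMr//.
apply: (@le_trans _ _ ((1 - s) ^+ k * (1 + s) ^+ k)).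
  rewrite ler_wpM2l ?exprn_ge0 ?subr_ge0//; apply: le_trans (bernoulli_lb k (ltW s0)).
  by rewrite lerDr.
rewrite -exprMn exprn_ile1//; last by nra.
by rewrite mulr_ge0 ?subr_ge0// addr_ge0// ltW.
Qed.

Definition upoly (p : {poly R}) (x : R) : R := p.[(x + 1)^-1].

Lemma upolyE p x : upoly p x = \sum_(i < size p) p`_i * rpow i 1 x.
Proof. by rewrite /upoly horner_coef; apply: eq_bigr => i _; rewrite /rpow exprVn. Qed.

Lemma bmp_upoly p : bmp (upoly p).
Proof.
rewrite (_ : upoly p = fun x => \sum_(i < size p) p`_i * rpow i 1 x).
  by apply: (@bmp_sum R (size p) (fun i => p`_i) (fun i => rpow i 1)) => i; exact: bmp_rpow.
by apply/funext => x; exact: upolyE.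
Qed.

(** With u = 1 / (x + 1), the polynomial is 1 + e / 2 - (1 - u^n)^K for K close to th^-n, where th
    is the value of u midway between a and b. For u above th the product K u^n is large and the
    power is nearly 0; for u below th the product is small and the power is nearly 1. The shift e /
    2 makes it a majorant of the indicator. *)
Lemma upoly_ind_approx (a b e : R) : 0 <= a -> a < b -> 0 < e ->
  exists p : {poly R}, forall x, 0 <= x ->
    ind_le a x <= upoly p x /\ upoly p x <= ind_le b x + e.
Proof.
move=> a0 ab e0; have e2 : 0 < e / 2 by rewrite divr_gt0.
have b0 : 0 < b by apply: le_lt_trans ab.
pose c := (a + b) / 2; pose th := (c + 1)^-1.
have ac : a < c by rewrite /c; lra.
have cb : c < b by rewrite /c; lra.
pose ua := (a + 1)^-1; pose ub := (b + 1)^-1.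
have ua0 : 0 < ua by rewrite invr_gt0; lra.
have ub0 : 0 < ub by rewrite invr_gt0; lra.
have th0 : 0 < th by rewrite invr_gt0; lra.
have th1 : th <= 1 by rewrite invf_le1; lra.
have uat : th < ua by rewrite ltf_pV2 ?posrE; lra.
have ubt : ub < th by rewrite ltf_pV2 ?posrE; lra.
have geo (r eta : R) : 0 <= r -> r < 1 -> 0 < eta -> exists N, forall n, (N <= n)%N -> r ^+ n <= eta.
  move=> r0 r1 eta0; have r1' : `|r| < 1 by rewrite ger0_norm.
  have /cvgrPdist_le /(_ _ eta0) [N _ HN] := cvg_expr r1'.
  exists N => n Nn; have := HN n Nn; rewrite /= sub0r normrN ger0_norm//.
  exact: exprn_ge0.
have [N1 HN1] : exists N, forall n, (N <= n)%N -> (th / ua) ^+ n <= e / 2.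
  by apply: geo => //; [rewrite divr_ge0// ltW|rewrite ltr_pdivrMr// mul1r].
(* Since K <= th^-n + 1, the quantity K u^n is at most (ub / th)^n + ub^n, and each term gets e /
   4. *)
have e4 : 0 < e / 4 by rewrite divr_gt0.
have [N2 HN2] : exists N, forall n, (N <= n)%N -> (ub / th) ^+ n <= e / 4.
  by apply: geo => //; [rewrite divr_ge0// ltW|rewrite ltr_pdivrMr// mul1r].
pose n := (maxn N1 N2).+1.
pose K := (Num.truncn (th ^- n)).+1.
have thn0 : 0 < th ^- n by rewrite invr_gt0 exprn_gt0.
have K1 : th ^- n <= K%:R by apply: ltW; exact: truncnS_gt.
have K2 : K%:R <= th ^- n + 1 by rewrite -natr1 lerD2r truncn_le// ltW.
exists ((1 + e / 2)%:P - (1 - 'X^n) ^+ K) => x x0.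
have -> : upoly ((1 + e / 2)%:P - (1 - 'X^n) ^+ K) x = 1 + e / 2 - (1 - (x + 1)^-1 ^+ n) ^+ K.
  by rewrite /upoly !hornerE.
set u := (x + 1)^-1.
have u0 : 0 < u by rewrite invr_gt0; lra.
have u1 : u <= 1 by rewrite invf_le1; lra.
have un0 : 0 < u ^+ n by rewrite exprn_gt0.
have un1 : u ^+ n <= 1 by rewrite exprn_ile1// ltW.
have v0 : 0 <= (1 - u ^+ n) ^+ K by rewrite exprn_ge0// subr_ge0.
have v1 : (1 - u ^+ n) ^+ K <= 1.
  by rewrite exprn_ile1 ?subr_ge0// lerBlDr lerDl ltW.
rewrite /ind_le; split.
  case: (leP x a) => xa /=; last first.
    by move: ((1 - u ^+ n) ^+ K) v0 v1 => V *; lra.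
  suff : (1 - u ^+ n) ^+ K <= e / 2.
    by move: ((1 - u ^+ n) ^+ K) v0 v1 => V *; lra.
  apply: (@le_trans _ _ (K%:R * u ^+ n)^-1).
    by apply: bernoulli_sub_ub => //; rewrite un0.
  apply: le_trans (HN1 n _); last by rewrite leqW// leq_maxl.
  rewrite expr_div_n -[leRHS]invrK invf_div lef_pV2 ?posrE; last first.
  - by rewrite divr_gt0// exprn_gt0.
  - by rewrite mulr_gt0// ltr0n.
  rewrite mulrC ler_pM ?invr_ge0 ?exprn_ge0 ?(ltW ua0) ?(ltW th0)//.
  rewrite lerXn2r ?nnegrE ?(ltW ua0) ?(ltW u0)//.
  by rewrite lef_pV2 ?posrE; lra.
case: (leP x b) => xb /=.
  by move: ((1 - u ^+ n) ^+ K) v0 v1 => V *; lra.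
suff : 1 - e / 2 <= (1 - u ^+ n) ^+ K.
  by move: ((1 - u ^+ n) ^+ K) v0 v1 => V *; lra.
apply: le_trans (bernoulli_sub_lb _ _); last by rewrite (ltW un0).
rewrite lerD2l lerN2.
have uub : u <= ub by rewrite lef_pV2 ?posrE; lra.
have unb : u ^+ n <= ub ^+ n by rewrite lerXn2r ?nnegrE ?(ltW ub0) ?(ltW u0).
have h2 : (ub / th) ^+ n <= e / 4 by apply: HN2; rewrite leqW// leq_maxr.
have h3 : th ^- n * ub ^+ n <= e / 4 by rewrite mulrC -expr_div_n.
have h4 : ub ^+ n <= th ^- n * ub ^+ n.
  by rewrite ler_peMl ?exprn_ge0 ?(ltW ub0)// invf_ge1 ?exprn_gt0// exprn_ile1// ltW.
apply: (@le_trans _ _ ((th ^- n + 1) * ub ^+ n)).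
  by apply: ler_pM => //; exact: ltW.
by rewrite mulrDl mul1r; lra.
Qed.

End IndicatorApproximation.

(** * The limiting distribution function and its Levy distance to the spectrum *)

Section LimitDistribution.
Variables (R : realType) (d : nat -> measure_display) (T : forall n, measurableType (d n)).
Variable P : forall n, probability (T n) R.
Variable Lam : forall n, T n -> (R -> R) -> R.
Arguments Lam : clear implicits.
Hypothesis pL : \forall n \near \oo, forall w, pmean (Lam n w).

Lemma cvgp_rpow0 t : cvgp P (fun n w => Lam n w (rpow 0 t)) 1.
Proof.
apply: cvgp_near (cvgp_cst P 1); apply: filterS pL => n h w.
have [Lc _ _ _] := h w.
by rewrite (_ : rpow 0 t = fun=> 1) ?Lc//; apply/funext => x; rewrite /rpow expr0 invr1.
Qed.

Let quot p t dl n w : R :=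
  (p.+1%:R * dl)^-1 * (Lam n w (rpow p.+1 t) - Lam n w (rpow p.+1 (t + dl))).

Let cvgp_quot p t dl l l' : cvgp P (fun n w => Lam n w (rpow p.+1 t)) l ->
  cvgp P (fun n w => Lam n w (rpow p.+1 (t + dl))) l' ->
  cvgp P (@quot p t dl) ((p.+1%:R * dl)^-1 * (l - l')).
Proof.
move=> h h'; apply: cvgpZ.
rewrite (_ : (fun n w => _) = fun n w => Lam n w (rpow p.+1 t) + (-1) * Lam n w (rpow p.+1 (t + dl))).
  by rewrite (_ : l - l' = l + (-1) * l'); [exact: (cvgpD h (cvgpZ (-1) h'))|rewrite mulN1r].
by apply: functional_extensionality_dep => n; apply/funext => w; rewrite mulN1r.
Qed.

Let quot_near p t dl : 0 < t -> 0 < dl -> \forall n \near \oo, forall w,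
  `|Lam n w (rpow p.+2 t) - @quot p t dl n w| <= dl * (p.+2%:R * t ^- p.+3).
Proof.
by move=> t0 d0; apply: filterS pL => n h w; rewrite distrC; exact: pmean_rpow_diff.
Qed.

Let small_step p t (e : R) : 0 < t -> 0 < e ->
  exists2 dl : R, 0 < dl & dl * (p.+2%:R * t ^- p.+3) <= e.
Proof.
move=> t0 e0; have C0 : 0 < p.+2%:R * t ^- p.+3 by rewrite mulr_gt0// invr_gt0 exprn_gt0.
by exists (e / (p.+2%:R * t ^- p.+3)); [rewrite divr_gt0|rewrite divfK// gt_eqF].
Qed.

(** Induction on [p] by difference quotients. Convergence is needed at all t > 0 and not only at t =
    1, because each step uses a second point t + dl. *)
Lemma cvgp_rpow_exists : (forall t, 0 < t -> exists l, cvgp P (fun n w => Lam n w (rpow 1 t)) l) ->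
  forall p t, 0 < t -> exists l, cvgp P (fun n w => Lam n w (rpow p t)) l.
Proof.
move=> H1; case => [|p] t t0; first by exists 1; exact: cvgp_rpow0.
elim: p t t0 => [|p IH] t t0; first exact: H1.
apply: cvgp_approx => e e0; have [dl d0 de] := small_step p t0 e0.
have [l hl] := IH _ t0; have [l' hl'] := IH _ (addr_gt0 t0 d0).
exists (@quot p t dl), ((p.+1%:R * dl)^-1 * (l - l')); split; first exact: cvgp_quot.
by apply: filterS (quot_near p t0 d0) => n h w; apply: le_trans (h w) de.
Qed.

(** The same induction with a candidate [L0]: being a positive mean, it obeys the same quotient
    estimate, so agreement at the first power carries over to all powers. *)
Lemma cvgp_rpow_transfer (L0 : (R -> R) -> R) : pmean L0 ->
  (forall t, 0 < t -> cvgp P (fun n w => Lam n w (rpow 1 t)) (L0 (rpow 1 t))) ->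
  forall p t, 0 < t -> cvgp P (fun n w => Lam n w (rpow p t)) (L0 (rpow p t)).
Proof.
move=> pL0 H1; case => [|p] t t0.
  have [Lc _ _ _] := pL0.
  rewrite [L0 _](_ : _ = 1); first exact: cvgp_rpow0.
  by rewrite -[RHS]Lc; congr L0; apply/funext => x; rewrite /rpow expr0 invr1.
elim: p t t0 => [|p IH] t t0; first exact: H1.
apply: cvgp_approx_to => e e0; have [dl d0 de] := small_step p t0 e0.
exists (@quot p t dl), ((p.+1%:R * dl)^-1 * (L0 (rpow p.+1 t) - L0 (rpow p.+1 (t + dl)))); split.
- by apply: cvgp_quot; apply: IH => //; exact: addr_gt0.
- by apply: le_trans de; exact: pmean_rpow_diff.
by apply: filterS (quot_near p t0 d0) => n h w; apply: le_trans (h w) de.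
Qed.

Variable l : nat -> R.
Hypothesis cvg_l : forall i, cvgp P (fun n w => Lam n w (rpow i 1)) (l i).

Definition lpoly (p : {poly R}) : R := \sum_(i < size p) p`_i * l i.

Lemma cvgp_upoly p : cvgp P (fun n w => Lam n w (upoly p)) (lpoly p).
Proof.
apply: cvgp_near (cvgp_sum (size p) (fun i => p`_i) cvg_l); apply: filterS pL => n h w.
rewrite -(pmean_sum (h w) (size p) (fun i => p`_i) (g := fun i => rpow i 1)).
  by congr (Lam n w); apply/funext => x; exact: upolyE.
by move=> i; exact: bmp_rpow.
Qed.

Lemma lpoly_le p q e : (forall x, 0 <= x -> upoly p x <= upoly q x + e) ->
  lpoly p <= lpoly q + e.
Proof.
move=> pq; apply: (cvgp_le (cvgp_upoly p) (cvgp_upoly q)).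
apply: filterS pL => n h w; have [Lc LD _ Lle] := h w.
rewrite -[X in _ + X](Lc e) -LD//; [|exact: bmp_upoly|exact: bmp_cst].
by apply: Lle => //; [exact: bmp_upoly|apply: bmpD; [exact: bmp_upoly|exact: bmp_cst]].
Qed.

Lemma lpolyC c : lpoly c%:P = c.
Proof.
apply: (cvgp_unique (cvgp_upoly c%:P)).
apply: cvgp_near (cvgp_cst P c); apply: filterS pL => n h w.
have [Lc _ _ _] := h w.
by rewrite (_ : upoly c%:P = fun=> c) ?Lc//; apply/funext => x; rewrite /upoly hornerC.
Qed.

(** An outer integral: the limiting functional is known only on polynomials in 1 / (x + 1), so the
    indicator is measured by its majorants there. The strict [a < b] builds right-continuity in, and
    no measure has to be represented. *)
Definition limit_cdf_set (a : R) : set R := [set r | exists p : {poly R}, r = lpoly p /\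
  exists2 b, a < b & forall x, 0 <= x -> ind_le b x <= upoly p x].

Definition limit_cdf (a : R) : R := inf (limit_cdf_set a).
Notation F := limit_cdf.

Lemma ind_le_ge0 (a x : R) : 0 <= ind_le a x. Proof. exact: ler0n. Qed.
Lemma ind_le_le1 (a x : R) : ind_le a x <= 1. Proof. by rewrite /ind_le; case: (x <= a). Qed.

Let set_ge0 a r : limit_cdf_set a r -> 0 <= r.
Proof.
move=> [p [-> [b _ hp]]]; rewrite -(lpolyC 0) -[leRHS]addr0; apply: lpoly_le => x x0.
rewrite addr0 {1}/upoly hornerC; apply: le_trans (hp x x0); exact: ind_le_ge0.
Qed.

Let set1 a : limit_cdf_set a 1.
Proof.
exists 1%:P; split; first by rewrite lpolyC.
by exists (a + 1) => [|x x0]; [rewrite ltrDl|rewrite /upoly hornerC ind_le_le1].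
Qed.

Let has_inf_set a : has_inf (limit_cdf_set a).
Proof. by split; [exists 1; exact: set1|exists 0 => r; exact: set_ge0]. Qed.

Let cdf_le a p b : a < b -> (forall x, 0 <= x -> ind_le b x <= upoly p x) -> F a <= lpoly p.
Proof. by move=> ab hp; apply: ge_inf; [case: (has_inf_set a)|exists p; split => //; exists b]. Qed.

Let cdf_ge a r : (forall p b, a < b -> (forall x, 0 <= x -> ind_le b x <= upoly p x) -> r <= lpoly p) ->
  r <= F a.
Proof.
move=> H; apply: lb_le_inf; first by case: (has_inf_set a).
by move=> _ [p [-> [b ab hp]]]; exact: H ab hp.
Qed.

Lemma limit_cdf_ge0 a : 0 <= F a.
Proof. by apply: cdf_ge => p b ab hp; apply: (@set_ge0 a); exists p; split => //; exists b. Qed.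

Lemma limit_cdf_le1 a : F a <= 1.
Proof.
by rewrite -(lpolyC 1); apply: (@cdf_le _ _ (a + 1)) => [|x x0];
  [rewrite ltrDl|rewrite /upoly hornerC ind_le_le1].
Qed.

Lemma limit_cdf_ndecr : {homo F : x y / x <= y}.
Proof.
move=> a a' aa'; apply: cdf_ge => p b ab hp; apply: cdf_le hp; exact: le_lt_trans ab.
Qed.

Lemma limit_cdf_neg a : a < 0 -> F a = 0.
Proof.
move=> a0; apply/le_anti; rewrite limit_cdf_ge0 andbT -(lpolyC 0).
apply: (@cdf_le _ _ (a / 2)); first by lra.
have a20 : a / 2 < 0 by lra.
by move=> x x0; rewrite /upoly hornerC /ind_le (leNgt x) (lt_le_trans a20 x0).
Qed.

(** A nearly optimal majorant for [a] covers the indicator up to some b > a, so it is admissible for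
    every x < b as well. *)
Lemma limit_cdf_right a e : 0 < e -> exists2 b, a < b & forall x, x < b -> F x < F a + e.
Proof.
move=> e0; have [_ [p [-> [b ab hp]]] lt] := inf_adherent e0 (has_inf_set a).
by exists b => // x xb; apply: le_lt_trans lt; exact: cdf_le hp.
Qed.

(** One polynomial compares indicators and the limiting function at the same time, which links any
    mean to [F] through a single convergence. The first bound on [F] needs a' < a because the
    definition of [F] asks for room to the right. *)
Lemma limit_cdf_sandwich a b e : 0 <= a -> a < b -> 0 < e -> exists p : {poly R},
  [/\ forall x, 0 <= x -> ind_le a x <= upoly p x,
      forall x, 0 <= x -> upoly p x <= ind_le b x + e,
      forall a', a' < a -> F a' <= lpoly p & lpoly p <= F b + e].
Proof.
move=> a0 ab e0; have [p hp] := upoly_ind_approx a0 ab e0.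
exists p; split => [x x0|x x0|a' aa'|].
- by case: (hp x x0).
- by case: (hp x x0).
- by apply: cdf_le aa' _ => x x0; case: (hp x x0).
rewrite -lerBlDr; apply: cdf_ge => q b' bb' hq; rewrite lerBlDr; apply: lpoly_le => x x0.
have [_ h] := hp x x0; apply: le_trans h _; rewrite lerD2r; apply: le_trans (hq x x0).
rewrite /ind_le; case: (leP x b) => xb; last by [].
by rewrite (le_trans xb (ltW bb')).
Qed.

Variable K : R.
Hypothesis K_ge0 : 0 <= K.
Hypothesis tight : \forall n \near \oo, forall w b, 0 < b -> 1 - K / b <= Lam n w (ind_le b).

Lemma limit_cdf_tight a : 0 < a -> 1 - K / a <= F a.
Proof.
move=> a0; apply: cdf_ge => p b ab hp; rewrite -[leRHS]addr0.
apply: (cvgp_le (cvgp_cst P _) (cvgp_upoly p)).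
near=> n => w; rewrite addr0.
have b0 : 0 < b by exact: lt_trans ab.
apply: (@le_trans _ _ (1 - K / b)).
  by rewrite lerD2l lerN2 ler_wpM2l// lef_pV2 ?posrE// ltW.
apply: (@le_trans _ _ (Lam n w (ind_le b))).
  have h : forall w b, 0 < b -> 1 - K / b <= Lam n w (ind_le b) by near: n.
  exact: h.
have h : forall w, pmean (Lam n w) by near: n; exact: pL.
have [_ _ _ Lle] := h w.
by apply: Lle => //; [exact: bmp_ind|exact: bmp_upoly].
Unshelve. all: by end_near. Qed.

(** Only finitely many polynomials, one per grid point of mesh e / 4, have to be close to their
    limits. Monotonicity fills the gaps between grid points, and beyond the grid tightness puts both
    functions near 1. *)
Lemma small_levy e : 0 < e -> small P (fun n => [set w | ~ forall x,
  F (x - e) - e <= Lam n w (ind_le x) /\ Lam n w (ind_le x) <= F (x + e) + e]).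
Proof.
move=> e0; pose dl := e / 4; have dl0 : 0 < dl by rewrite divr_gt0.
have edl : e = 4 * dl by rewrite /dl mulrC divfK.
have Hp (i : nat) : exists p : {poly R},
  [/\ forall x, 0 <= x -> ind_le (i%:R * dl) x <= upoly p x,
      forall x, 0 <= x -> upoly p x <= ind_le (i.+1%:R * dl) x + dl,
      forall a', a' < i%:R * dl -> F a' <= lpoly p & lpoly p <= F (i.+1%:R * dl) + dl].
  by apply: limit_cdf_sandwich => //; [rewrite mulr_ge0// ltW|rewrite ltr_pM2r// ltr_nat].
have {Hp}[p Hp] := choice Hp.
have [J HJ] : exists J : nat, 1 - dl <= F (J%:R * dl).
  pose J := (Num.truncn (K / dl / dl)).+1; exists J.
  have Jd : 0 < J%:R * dl by rewrite mulr_gt0.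
  apply: le_trans (limit_cdf_tight Jd); rewrite lerD2l lerN2 ler_pdivrMr//.
  by rewrite -ler_pdivrMl// mulrC -ler_pdivrMr// ltW// truncnS_gt.
pose E i := (fun n => [set w | dl < `|Lam n w (upoly (p i)) - lpoly (p i)|]) : forall n, set (T n).
have sE i : small P (E i) by exact: cvgp_upoly.
apply: small_sub (small_bigU J.+4 sE); near=> n => w /= nh.
(* At a good point each comparison costs 2 [dl] in height, once for the sandwich and once for the
   convergence. Rounding to the grid costs at most two steps in the argument, so 4 [dl] is
   enough. *)
apply: contrapT => nE; apply: nh.
have hL : forall w, pmean (Lam n w) by near: n; exact: pL.
have [Lc LD LZ Lle] := hL w.
have good i : (i < J.+4)%N -> `|Lam n w (upoly (p i)) - lpoly (p i)| <= dl.
  by move=> iJ; rewrite leNgt; apply/negP => h; apply: nE; exists i.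
pose G x := Lam n w (ind_le x).
have G0 x : 0 <= G x.
  by rewrite -(Lc 0); apply: Lle; [exact: bmp_cst|exact: bmp_ind|move=> y _; exact: ind_le_ge0].
have G1 x : G x <= 1.
  by rewrite -(Lc 1); apply: Lle; [exact: bmp_ind|exact: bmp_cst|move=> y _; exact: ind_le_le1].
have Gmono x y : x <= y -> G x <= G y.
  move=> xy; apply: Lle; [exact: bmp_ind|exact: bmp_ind|move=> z _].
  by rewrite /ind_le; case: (leP z x) => // zx; rewrite (le_trans zx xy).
have Gneg x : x < 0 -> G x = 0.
  move=> x0; apply/le_anti; rewrite G0 andbT -(Lc 0).
  apply: Lle; [exact: bmp_ind|exact: bmp_cst|move=> y y0].
  by rewrite /ind_le (leNgt y) (lt_le_trans x0 y0).
have up i : (i < J.+4)%N -> G (i%:R * dl) <= F (i.+1%:R * dl) + (dl + dl).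
  move=> iJ; have [h1 _ _ h4] := Hp i; have := good _ iJ; rewrite ler_norml => /andP[_ h5].
  have h6 : G (i%:R * dl) <= Lam n w (upoly (p i)).
    by apply: Lle; [exact: bmp_ind|exact: bmp_upoly|].
  lra.
have down i y : (i < J.+4)%N -> y < i%:R * dl -> F y <= G (i.+1%:R * dl) + (dl + dl).
  move=> iJ yi; have [_ h2 h3 _] := Hp i; have := good _ iJ; rewrite ler_norml => /andP[h5 _].
  have h6 : Lam n w (upoly (p i)) <= G (i.+1%:R * dl) + dl.
    rewrite -[X in _ + X](Lc dl) -LD; [|exact: bmp_ind|exact: bmp_cst].
    by apply: Lle; [exact: bmp_upoly|apply: bmpD; [exact: bmp_ind|exact: bmp_cst]|].
  have := h3 _ yi; lra.
move=> x; rewrite -/(G x).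
have [x0|x0] := ltP x 0.
  by rewrite Gneg// limit_cdf_neg; [have := limit_cdf_ge0 (x + e); lra|lra].
pose i := Num.truncn (x / dl).
have xd0 : 0 <= x / dl by rewrite divr_ge0// ltW.
have ix : i%:R * dl <= x by rewrite -ler_pdivlMr// truncn_le.
have xi : x < i.+1%:R * dl by rewrite -ltr_pdivrMr// truncnS_gt.
have dS (j : nat) : j.+1%:R * dl = j%:R * dl + dl by rewrite -natr1 mulrDl mul1r.
split.
  case: i ix xi => [|i] ix xi.
    by rewrite limit_cdf_neg; [have := G0 x; lra|rewrite mul1r in xi; lra].
  have [iJ|iJ] := ltnP i J.+4.
    have h := @down i (x - e) iJ; rewrite !dS in xi ix h.
    have {}h : F (x - e) <= G (i%:R * dl + dl) + (dl + dl) by apply: h; lra.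
    have := Gmono _ _ ix; lra.
  (* Beyond the grid the comparison at the point J dl suffices: there [F] is at least 1 - dl, so
     [G x] is at least 1 - 3 dl. *)
  have h := @down J.+2 (J%:R * dl) (leqnSn _); rewrite !dS in h.
  have {}h : F (J%:R * dl) <= G (J%:R * dl + dl + dl + dl) + (dl + dl) by apply: h; lra.
  have : (J.+4)%:R * dl <= i%:R * dl by rewrite ler_pM2r// ler_nat.
  rewrite !dS in xi ix * => h'.
  have := Gmono (J%:R * dl + dl + dl + dl) x; have := limit_cdf_le1 (x - e).
  by move=> h1 h2; have := h2 _; lra.
have [iJ|iJ] := ltnP i.+1 J.+4.
  have h := up _ iJ; rewrite !dS in h xi.
  have := Gmono _ _ (ltW xi).
  have : F (i%:R * dl + dl + dl) <= F (x + e) by apply: limit_cdf_ndecr; lra.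
  lra.
have h1 := G1 x; have h2 : F (J%:R * dl) <= F (x + e); last lra.
apply: limit_cdf_ndecr.
have : (J.+3)%:R * dl <= i%:R * dl by rewrite ler_pM2r// ler_nat.
by rewrite !dS; lra.
Unshelve. all: by end_near. Qed.

End LimitDistribution.

(** * Spectral distributions and the Levy distance *)

Section SeqMean.
Variable R : realType.
Implicit Types (s : seq R) (f : R -> R).

Definition smean s f : R := (size s)%:R^-1 * \sum_(x <- s) f x.

Lemma pmean_smean s : (0 < size s)%N -> all (>= 0) s -> pmean (smean s).
Proof.
move=> s0 pos; have sz : (size s)%:R != 0 :> R by rewrite pnatr_eq0 -lt0n.
split.
- move=> c; rewrite /smean big_const_seq count_predT iter_addr_0.
  by rewrite -[c *+ _]mulr_natl mulrA mulVf ?mul1r.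
- by move=> f g _ _; rewrite /smean big_split mulrDr.
- by move=> c f _; rewrite /smean -mulr_sumr mulrCA.
move=> f g _ _ fg; rewrite /smean ler_wpM2l ?invr_ge0//.
rewrite big_seq [leRHS]big_seq; apply: ler_sum => x xs; apply: fg.
exact: (allP pos).
Qed.

Lemma perm_smean s s' f : perm_eq s s' -> smean s f = smean s' f.
Proof. by move=> ss'; rewrite /smean (perm_size ss') (perm_big _ ss'). Qed.

(** Markov's inequality, from 1 - x / b <= 1_{x <= b} for x >= 0. *)
Lemma smean_markov s K b : (0 < size s)%N -> all (>= 0) s -> smean s id <= K -> 0 < b ->
  1 - K / b <= smean s (ind_le b).
Proof.
move=> s0 pos sK b0; have sz : (size s)%:R != 0 :> R by rewrite pnatr_eq0 -lt0n.
apply: (@le_trans _ _ (smean s (fun x => 1 - b^-1 * x))).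
  have -> : smean s (fun x => 1 - b^-1 * x) = 1 - smean s id / b.
    rewrite /smean sumrB mulrBr big_const_seq count_predT iter_addr_0 mulVf//.
    by rewrite -mulr_sumr; congr (_ - _); rewrite mulrCA mulrC.
  by rewrite lerD2l lerN2 ler_wpM2r// invr_ge0 ltW.
rewrite /smean ler_wpM2l ?invr_ge0//.
rewrite big_seq [leRHS]big_seq; apply: ler_sum => x xs.
have x0 : 0 <= x by exact: (allP pos).
rewrite /ind_le; case: (leP x b) => xb /=.
  by rewrite lerBlDr lerDl mulr_ge0// invr_ge0 ltW.
by rewrite subr_le0 mulrC ler_pdivlMr// mul1r ltW.
Qed.

Lemma smean_ind_right s a : exists2 b, a < b & forall x, a <= x -> x < b ->
  smean s (ind_le x) = smean s (ind_le a).
Proof.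
suff [b ab H] : exists2 b, a < b & forall x, a <= x -> x < b ->
    {in s, forall y, (y <= x) = (y <= a)}.
  exists b => // x ax xb; rewrite /smean; congr (_ * _).
  rewrite big_seq [RHS]big_seq; apply: eq_bigr => y ys.
  by rewrite /ind_le (H x ax xb y ys).
elim: s => [|y s [b ab IH]]; first by exists (a + 1); rewrite ?ltrDl.
have [ya|ay] := leP y a.
  exists b => // x ax xb z; rewrite inE => /predU1P[->|zs]; last exact: IH.
  by rewrite ya (le_trans ya ax).
exists (Num.min b y); first by rewrite lt_min ab ay.
move=> x ax; rewrite lt_min => /andP[xb xy] z; rewrite inE => /predU1P[->|zs].
  by rewrite leNgt xy leNgt ay.
exact: IH.
Qed.

End SeqMean.

Section PsdSpectrum.
Local Open Scope sesquilinear_scope.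
Local Open Scope complex_scope.
Local Open Scope ring_scope.
Variables (R : realType) (N : nat).
Implicit Types (M : 'M[R[i]]_N).

Definition real_spectrum M : seq R := [seq complex.Re z | z <- eigenvalues M].

Lemma psd_diagonalization M : psd M -> exists (Q : 'M[R[i]]_N) (dd : 'I_N -> R),
  [/\ Q^t* *m Q = 1%:M, Q *m Q^t* = 1%:M, forall i, 0 <= dd i &
    M = Q^t* *m diag_mx (\row_i (dd i)%:C) *m Q].
Proof.
move=> [hM pM]; set Q := spectralmx M; set D := spectral_diag M.
have QQ : Q *m Q^t* = 1%:M by apply/unitarymxP; exact: spectral_unitarymx.
have Qi : invmx Q = Q^t* by apply: invmx_unitary; exact: spectral_unitarymx.
have QQ' : Q^t* *m Q = 1%:M by rewrite -Qi mulVmx// spectral_unit.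
have ME : M = Q^t* *m diag_mx D *m Q.
  have hM' : M \is hermsymmx by apply/is_hermitianmxP; rewrite expr0 scale1r hM.
  by have /orthomx_spectralP := hermitian_normalmx hM'; rewrite -/Q -/D Qi.
have D0 i : 0 <= D 0 i.
  have := pM (Q^t* *m delta_mx i 0).
  rewrite (_ : qf M _ = D 0 i)// /qf adjM trmxCK ME.
  rewrite -!mulmxA (mulmxA Q) QQ mul1mx (mulmxA Q (Q^t*)) QQ mul1mx mulmxA.
  by rewrite -[LHS]/(qf (diag_mx D) (delta_mx i 0)) qf_delta mxE eqxx.
have DE : \row_i (complex.Re (D 0 i))%:C = D.
  by apply/rowP => i; rewrite mxE; apply/RRe_real/ger0_real.
exists Q, (fun i => complex.Re (D 0 i)); rewrite DE; split; [exact: QQ'|exact: QQ| |exact: ME].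
by move=> i; have := D0 i; rewrite lecE /= => /andP[].
Qed.

Section Diagonalized.
Variables (M Q : 'M[R[i]]_N) (dd : 'I_N -> R).
Hypotheses (QQ' : Q^t* *m Q = 1%:M) (QQ : Q *m Q^t* = 1%:M).
Hypothesis dd0 : forall i, 0 <= dd i.
Hypothesis ME : M = Q^t* *m diag_mx (\row_i (dd i)%:C) *m Q.

Lemma perm_real_spectrum : perm_eq (real_spectrum M) [seq dd i | i : 'I_N].
Proof.
have cpE : char_poly M = \prod_(z <- [seq (dd i)%:C | i : 'I_N]) ('X - z%:P).
  transitivity (char_poly (diag_mx (\row_i (dd i)%:C) : 'M[R[i]]_N)); last first.
    rewrite char_poly_trig; last exact/diag_mx_is_trig.
    by rewrite big_image; apply: eq_bigr => i _; rewrite !mxE eqxx.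
  rewrite /char_poly /char_poly_mx ME !map_mxM /=.
  set A := map_mx polyC (Q^t*); set B := map_mx polyC Q; set D := map_mx polyC (diag_mx _).
  have AB : A *m B = 1%:M by rewrite -map_mxM QQ' map_mx1.
  have -> : 'X%:M - A *m D *m B = A *m ('X%:M - D) *m B.
    by rewrite mulmxBr mulmxBl mul_mx_scalar -scalemxAl AB scalemx1.
  rewrite !det_mulmx mulrC mulrA -det_mulmx.
  by rewrite (mulmx1C AB) det1 mul1r.
have /prod_XsubC_eq /(perm_map (@complex.Re R)) : \prod_(z <- eigenvalues M) ('X - z%:P) =
    \prod_(z <- [seq (dd i)%:C | i : 'I_N]) ('X - z%:P).
  rewrite -cpE /eigenvalues; case: closed_field_poly_normal => r /= ->.
  by rewrite (monicP (char_poly_monic M)) scale1r.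
by rewrite -map_comp.
Qed.

Lemma resolvent_diag (t : R) : 0 < t -> psd M ->
  resolvent M t%:C = Q^t* *m diag_mx (\row_i ((dd i + t)^-1)%:C) *m Q.
Proof.
move=> t0 pM; have tC : 0 < t%:C by rewrite ltcR.
set G := RHS.
suff h : (M + (t%:C)%:M) *m G = 1%:M.
  by rewrite -[LHS]mulmx1 -h mulmxA (mulGB pM tC) mul1mx.
have -> : M + (t%:C)%:M = Q^t* *m diag_mx (\row_i (dd i + t)%:C) *m Q.
  have -> : (t%:C)%:M = Q^t* *m (t%:C)%:M *m Q.
    by rewrite mul_mx_scalar -scalemxAl QQ' scalemx1.
  have -> : diag_mx (\row_i (dd i + t)%:C) = diag_mx (\row_i (dd i)%:C) + (t%:C)%:M.
    by apply/matrixP => i j; rewrite !mxE rmorphD mulrnDl.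
  by rewrite mulmxDr mulmxDl -ME.
rewrite /G -!mulmxA (mulmxA Q (Q^t*)) QQ mul1mx (mulmxA (diag_mx _) (diag_mx _)) mulmx_diag.
rewrite (_ : diag_mx _ = 1%:M) ?mul1mx//.
rewrite -diag_const_mx; congr diag_mx; apply/rowP => i; rewrite !mxE.
by rewrite -rmorphM divff// gt_eqF// ltr_wpDl.
Qed.

Fixpoint mxpow (G : 'M[R[i]]_N) p : 'M[R[i]]_N := if p is p'.+1 then mxpow G p' *m G else 1%:M.

Lemma tr_resolvent_pow (t : R) p : 0 < t -> psd M ->
  \tr (mxpow (resolvent M t%:C) p) = (\sum_i rpow p t (dd i))%:C.
Proof.
move=> t0 pM.
have -> : mxpow (resolvent M t%:C) p = Q^t* *m diag_mx (\row_i (rpow p t (dd i))%:C) *m Q.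
  elim: p => [|p IH] /=.
    rewrite (_ : diag_mx _ = 1%:M) ?mulmx1//.
    rewrite -diag_const_mx; congr diag_mx; apply/rowP => i; rewrite !mxE.
    by rewrite /rpow expr0 invr1.
  rewrite IH (resolvent_diag t0 pM).
  rewrite -!mulmxA (mulmxA Q (Q^t*)) QQ mul1mx (mulmxA (diag_mx _) (diag_mx _)) mulmx_diag.
  congr (_ *m (diag_mx _ *m _)); apply/rowP => i; rewrite !mxE -rmorphM.
  by rewrite /rpow exprSr invfM mulrC.
rewrite mxtrace_mulC mulmxA QQ mul1mx mxtrace_diag rmorph_sum.
by apply: eq_bigr => i _; rewrite mxE.
Qed.

Lemma tr_diag : \tr M = (\sum_i dd i)%:C.
Proof.
rewrite ME mxtrace_mulC mulmxA QQ mul1mx mxtrace_diag rmorph_sum.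
by apply: eq_bigr => i _; rewrite mxE.
Qed.

End Diagonalized.

Variable M : 'M[R[i]]_N.
Hypothesis pM : psd M.

Lemma size_real_spectrum : size (real_spectrum M) = N.
Proof.
have [Q [dd [h1 h2 h3 h4]]] := psd_diagonalization pM.
by rewrite (perm_size (perm_real_spectrum h1 h4)) size_image card_ord.
Qed.

Lemma real_spectrum_ge0 : all (>= 0) (real_spectrum M).
Proof.
have [Q [dd [h1 h2 h3 h4]]] := psd_diagonalization pM.
rewrite (perm_all _ (perm_real_spectrum h1 h4)).
by rewrite all_map; apply/allP => i _ /=; exact: h3.
Qed.

Lemma smean_spectrum_rpow p t : 0 < t ->
  smean (real_spectrum M) (rpow p t) = complex.Re (\tr (mxpow (resolvent M t%:C) p)) / N%:R.
Proof.
move=> t0; have [Q [dd [h1 h2 h3 h4]]] := psd_diagonalization pM.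
rewrite (perm_smean _ (perm_real_spectrum h1 h4)) (tr_resolvent_pow h1 h2 h3 h4 p t0 pM) /=.
by rewrite /smean size_image card_ord big_image mulrC.
Qed.

Lemma smean_spectrum_id : smean (real_spectrum M) id = complex.Re (\tr M) / N%:R.
Proof.
have [Q [dd [h1 h2 h3 h4]]] := psd_diagonalization pM.
rewrite (perm_smean _ (perm_real_spectrum h1 h4)) (tr_diag h2 h4) /=.
by rewrite /smean size_image card_ord big_image mulrC.
Qed.

Lemma esdE x : esd M x = smean (real_spectrum M) (ind_le x).
Proof.
rewrite /smean size_real_spectrum mulrC /esd; congr (_ / _).
rewrite -sum1_count natr_sum big_map big_mkcond; apply: eq_bigr => z _.
by rewrite /ind_le; case: ifP.
Qed.

End PsdSpectrum.

Section LevyDistance.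
Variable R : realType.
Implicit Types F G : R -> R.

Definition levy_set F G : set R := [set e : R | 0 < e /\
    forall x, F (x - e) - e <= G x /\ G x <= F (x + e) + e].

Lemma levy_dist_ge0 F G : 0 <= levy_dist F G.
Proof.
have [[e he]|] := pselect (levy_set F G !=set0).
  by apply: lb_le_inf; [exists e|move=> x [x0 _]; exact: ltW].
(* The infimum of the empty set is 0 by convention. *)
by move=> /set0P/negP/negPn/eqP E; rewrite /levy_dist -/(levy_set F G) E inf0.
Qed.

(** Translating x by e exchanges the two inequalities, so the defining condition is symmetric and
    the arguments of the distance may be swapped. *)
Lemma levy_dist_le F G e : 0 < e ->
  (forall x, F (x - e) - e <= G x /\ G x <= F (x + e) + e) -> levy_dist G F <= e.
Proof.
move=> e0 h; apply: ge_inf; first by exists 0 => x [x0 _]; exact: ltW.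
split=> // x; split.
  by have [_] := h (x - e); rewrite subrK lerBlDr.
by have [+ _] := h (x + e); rewrite addrK lerBlDr.
Qed.

Lemma levy_set_up F G e e' : {homo F : x y / x <= y} -> levy_set F G e -> e <= e' -> levy_set F G e'.
Proof.
move=> Fh [e0 h] ee'; split; first exact: lt_le_trans ee'.
move=> x; have [h1 h2] := h x; split.
  have : F (x - e') <= F (x - e) by apply: Fh; lra.
  lra.
have : F (x + e) <= F (x + e') by apply: Fh; lra.
lra.
Qed.

Definition right_cont F := forall a e, 0 < e -> exists2 b, a < b & forall x, x < b -> F x < F a + e.

Lemma levy_set_rat F G q : 0 < q -> {homo F : x y / x <= y} -> {homo G : x y / x <= y} ->
  right_cont F -> right_cont G ->
  (forall r : rat, F (ratr r - q) - q <= G (ratr r) /\ G (ratr r) <= F (ratr r + q) + q) ->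
  levy_set F G q.
Proof.
move=> q0 Fh Gh Fr Gr h; split=> // x; split.
  apply/ler_addgt0Pl => e e0; have [b xb hb] := Gr x e e0.
  have [r] := rat_in_itvoo xb; rewrite in_itv /= => /andP[xr rb].
  have [h1 _] := h r; have := hb _ rb.
  have : F (x - q) <= F (ratr r - q) by apply: Fh; rewrite lerD2r ltW.
  lra.
apply/ler_addgt0Pl => e e0; have [b xb hb] := Fr (x + q) e e0.
have xb' : x < b - q by rewrite ltrBrDr.
have [r] := rat_in_itvoo xb'; rewrite in_itv /= => /andP[xr rb].
have rqb : ratr r + q < b by rewrite -ltrBrDr.
have [_ h1] := h r; have := hb _ rqb.
have : G x <= G (ratr r) by apply: Gh; rewrite ltW.
lra.
Qed.

(** For monotone right-continuous functions the condition need only be tested at rationals, so the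
    event that the distance exceeds [e] becomes a countable union of events about single values. *)
Lemma lt_levy_distP F G e : 0 < e -> {homo F : x y / x <= y} -> {homo G : x y / x <= y} ->
  right_cont F -> right_cont G -> levy_set F G !=set0 ->
  e < levy_dist F G <-> exists2 q : rat, e < ratr q & exists r : rat,
   ~ (F (ratr r - ratr q) - ratr q <= G (ratr r) /\ G (ratr r) <= F (ratr r + ratr q) + ratr q).
Proof.
move=> e0 Fh Gh Fr Gr ne; split.
  move=> elt; have [q] := rat_in_itvoo elt; rewrite in_itv /= => /andP[eq ql].
  exists q => //; apply: contrapT => /forallNP H.
  have : levy_set F G (ratr q).
    apply: levy_set_rat => //; first exact: lt_trans eq.
    by move=> r; apply: contrapT; exact: H.
  move=> hq; have : levy_dist F G <= ratr q.
    by apply: ge_inf => //; exists 0 => x [x0 _]; exact: ltW.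
  by rewrite leNgt ql.
move=> [q eq [r nr]]; apply: lt_le_trans eq _; apply: lb_le_inf => // x hx.
rewrite leNgt; apply/negP => xq; apply: nr.
by have [_ h] := levy_set_up Fh hx (ltW xq); exact: h.
Qed.

End LevyDistance.

(** * Measurability of the spectral distribution and of its Levy distance *)

Section MeasurableSpectrum.
Variables (R : realType) (d : measure_display) (W : measurableType d) (N : nat).
Variable A : W -> 'M[R[i]]_N.
Hypotheses (cmA : cm_mx A) (psdA : forall w, psd (A w)) (N0 : (0 < N)%N).

Let s w := real_spectrum (A w).

(** The list of eigenvalues is chosen without any measurability, but its symmetric averages are
    traces of powers of the resolvent, which are measurable in the entries. *)
Lemma measurable_smean_upoly p : measurable_fun setT (fun w => smean (s w) (upoly p)).
Proof.
pose f i w := complex.Re (\tr (mxpow (resolvent (A w) (1%:C)%C) i)) / N%:R.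
have mf i : measurable_fun setT (f i).
  apply: measurable_funM => //.
  suff [//] : cm (fun w => \tr (mxpow (resolvent (A w) (1%:C)%C) i)).
  have cmr : cm_mx (fun w => resolvent (A w) (1%:C)%C).
    apply: cm_invmx => [a b|w]; last by apply: shift_unit => //; rewrite ltcR.
    apply: cm_ext => [w|]; first by rewrite mxE; reflexivity.
    by apply: cmD; [exact: cmA|exact: cm_cst].
  have cmp : cm_mx (fun w => mxpow (resolvent (A w) (1%:C)%C) i).
    elim: i => [|i IH] /=; first by move=> a b; exact: cm_cst.
    exact: cm_mulmx.
  by apply: cm_sum => a.
rewrite (_ : (fun w => _) = fun w => \sum_(i < size p) p`_i * f i w).
  by apply: measurable_sum => i; apply: measurable_funM.
apply/funext => w.
have pm := pmean_smean _ (real_spectrum_ge0 (psdA w)).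
rewrite (_ : upoly p = fun x => \sum_(i < size p) p`_i * rpow i 1 x); last first.
  by apply/funext => x; exact: upolyE.
rewrite (pmean_sum (pm _) (size p) (fun i => p`_i) (g := fun i => rpow i 1)).
- by apply: eq_bigr => i _; rewrite smean_spectrum_rpow.
- by rewrite (size_real_spectrum (psdA w)).
- by move=> i; exact: bmp_rpow.
Qed.

Let pm w : pmean (smean (s w)).
Proof.
by apply: pmean_smean; [rewrite (size_real_spectrum (psdA w))|exact: real_spectrum_ge0].
Qed.

(** A pointwise limit of polynomial averages squeezed between the indicators at x and at x + 1 / (j
    + 1). A finite spectrum leaves a gap to the right of x, so the upper indicator finally has the
    same average. *)
Lemma measurable_esd x : measurable_fun setT (fun w => esd (A w) x).
Proof.
rewrite (_ : (fun w => _) = fun w => smean (s w) (ind_le x)); last first.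
  by apply/funext => w; rewrite esdE.
have [x0|x0] := ltP x 0.
  rewrite (_ : (fun w => _) = fun=> 0) //; apply/funext => w.
  have [Lc _ _ Lle] := pm w; apply/le_anti/andP; split.
    rewrite -[leRHS](Lc 0); apply: Lle; [exact: bmp_ind|exact: bmp_cst|move=> y y0].
    by rewrite /ind_le (leNgt y) (lt_le_trans x0 y0).
  rewrite -[leLHS](Lc 0); apply: Lle; [exact: bmp_cst|exact: bmp_ind|move=> y y0].
  exact: ind_le_ge0.
have Hp (j : nat) : exists p : {poly R}, forall y, 0 <= y ->
    ind_le x y <= upoly p y /\ upoly p y <= ind_le (x + j.+1%:R^-1) y + j.+1%:R^-1.
  by apply: upoly_ind_approx => //; rewrite ?ltrDl invr_gt0.
have {Hp}[p Hp] := choice Hp.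
apply: (@measurable_fun_cvg _ _ _ _ (fun j w => smean (s w) (upoly (p j)))).
  by move=> j; exact: measurable_smean_upoly.
move=> w _; have [Lc LD _ Lle] := pm w.
have [b xb hb] := smean_ind_right (s w) x.
have cinv : j.+1%:R^-1 @[j --> \oo] --> (0 : R) by exact: cvg_harmonic.
have bx : 0 < b - x by rewrite subr_gt0.
have sq : \forall j \near \oo, smean (s w) (ind_le x) <= smean (s w) (upoly (p j)) <=
    smean (s w) (ind_le x) + j.+1%:R^-1.
  near=> j; have jb : j.+1%:R^-1 < b - x.
    by near: j; exact: (cvgr_lt _ cinv _ bx).
  apply/andP; split.
    by apply: Lle; [exact: bmp_ind|exact: bmp_upoly|move=> y y0; case: (Hp j y y0)].
  rewrite -(hb (x + j.+1%:R^-1)); [|by rewrite lerDl|by rewrite -ltrBrDl].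
  rewrite -[X in _ + X]Lc -LD; [|exact: bmp_ind|exact: bmp_cst].
  apply: Lle; [exact: bmp_upoly| |move=> y y0; case: (Hp j y y0)] => //.
  by apply: bmpD; [exact: bmp_ind|exact: bmp_cst].
apply: (squeeze_cvgr sq); first exact: cvg_cst.
by rewrite -[X in _ --> X]addr0; apply: cvgD => //; exact: cvg_cst.
Unshelve. all: by end_near. Qed.

Lemma esd_ndecr w : {homo esd (A w) : x y / x <= y}.
Proof.
move=> x y xy; rewrite !esdE//; have [_ _ _ Lle] := pm w.
apply: Lle; [exact: bmp_ind|exact: bmp_ind|move=> z z0].
by rewrite /ind_le; case: (leP z x) => // zx; rewrite (le_trans zx xy).
Qed.

Lemma esd_ge0 w x : 0 <= esd (A w) x.
Proof. by rewrite divr_ge0. Qed.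

Lemma esd_le1 w x : esd (A w) x <= 1.
Proof.
rewrite esdE//; have [Lc _ _ Lle] := pm w; rewrite -[leRHS]Lc.
by apply: Lle; [exact: bmp_ind|exact: bmp_cst|move=> z _; exact: ind_le_le1].
Qed.

Lemma esd_right w : right_cont (esd (A w)).
Proof.
move=> a e e0; have [b ab hb] := smean_ind_right (s w) a.
exists b => // x xb; have [ax|xa] := leP a x.
  by rewrite !esdE// hb// ltrDl.
by apply: le_lt_trans (esd_ndecr w (ltW xa)) _; rewrite ltrDl.
Qed.

Variable F : R -> R.
Hypotheses (Fh : {homo F : x y / x <= y}) (Fr : right_cont F).
Hypotheses (F0 : forall x, 0 <= F x) (F1 : forall x, F x <= 1).

Lemma measurable_levy e : 0 < e ->
  measurable [set w | e < `|levy_dist (esd (A w)) F|].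
Proof.
move=> e0.
have ne w : levy_set (esd (A w)) F !=set0.
  exists 1; split=> // x; have := F0 x; have := F1 x.
  have := esd_ge0 w (x + 1); have := esd_le1 w (x - 1); lra.
pose B (q r : rat) : set W := if e < ratr q then
  ~` ([set w | esd (A w) (ratr r - ratr q) <= F (ratr r) + ratr q] `&`
      [set w | F (ratr r) - ratr q <= esd (A w) (ratr r + ratr q)]) else set0.
have -> : [set w | e < `|levy_dist (esd (A w)) F|] = \bigcup_q \bigcup_r B q r.
  apply/seteqP; split => w /=.
    rewrite ger0_norm ?levy_dist_ge0//.
    move/(lt_levy_distP e0 (esd_ndecr w) Fh (esd_right w) Fr (ne w)) => [q eq [r nr]].
    exists q => //; exists r => //; rewrite /B eq => -[h1 h2]; apply: nr; split.
      by rewrite lerBlDr.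
    by rewrite -lerBlDr.
  move=> [q _ [r _]]; rewrite /B; case: ifPn => // eq h.
  rewrite ger0_norm ?levy_dist_ge0//.
  apply/(lt_levy_distP e0 (esd_ndecr w) Fh (esd_right w) Fr (ne w)).
  exists q => //; exists r => -[h1 h2]; apply: h; split => /=.
    by rewrite -lerBlDr.
  by rewrite lerBlDr.
apply: bigcupT_measurable_rat => q; apply: bigcupT_measurable_rat => r.
rewrite /B; case: ifP => // _; apply: measurableC; apply: measurableI.
  rewrite (_ : mkset _ = setT `&` (fun w => esd (A w) (ratr r - ratr q)) @^-1` `]-oo, F (ratr r) + ratr q]%classic).
    exact: (measurable_esd _ measurableT (measurable_itv _)).
  by rewrite setTI; apply/seteqP; split => w /=; rewrite in_itv.
rewrite (_ : mkset _ = setT `&` (fun w => esd (A w) (ratr r + ratr q)) @^-1` `[F (ratr r) - ratr q, +oo[%classic).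
  exact: (measurable_esd _ measurableT (measurable_itv _)).
by rewrite setTI; apply/seteqP; split => w /=; rewrite in_itv /= andbT.
Qed.

End MeasurableSpectrum.

(** * The Stieltjes transform of the Marchenko-Pastur law *)

Section ArcsineByArctangent.
Variable R : realType.
Implicit Types v x : R.

(* The half-angle form of the arcsine is continuous on the whole line, in
   particular at -1 and 1. *)
Definition halfangle_asin v : R := 2 * atan (v / (1 + Num.sqrt (1 - v ^+ 2))).

Lemma halfangle_asin1 : halfangle_asin 1 = pi / 2.
Proof.
rewrite /halfangle_asin expr1n subrr sqrtr0 addr0 divr1 atan1; lra.
Qed.

Lemma halfangle_asinN1 : halfangle_asin (-1) = - (pi / 2).
Proof.
rewrite /halfangle_asin sqrrN expr1n subrr sqrtr0 addr0 divr1 atanN atan1; lra.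
Qed.

Lemma continuous_halfangle_asin : continuous halfangle_asin.
Proof.
move=> v; rewrite /halfangle_asin.
apply: (@continuousM _ _ (cst 2) _ v); first exact: cst_continuous.
apply: continuous_comp; last exact: continuous_atan.
apply: continuousM; first exact: cvg_id.
apply: continuousV; first by rewrite gt_eqF // ltr_pwDl // sqrtr_ge0.
apply: continuousD; first exact: cst_continuous.
apply: continuous_comp; last exact: sqrt_continuous.
apply: continuousB; first exact: cst_continuous.
exact: exprn_continuous.
Qed.

Lemma is_derive_sqrt_comp (f : R -> R) x df : is_derive x 1 f df -> 0 < f x ->
  is_derive x 1 (fun z => Num.sqrt (f z)) (df / (2 * Num.sqrt (f x))).
Proof.
move=> fx f0; have h := @is_derive1_sqrt R _ f0.
have := is_derive1_comp h fx.
by rewrite mulrC.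
Qed.

Lemma is_derive_div (f g : R -> R) x df dg : is_derive x 1 f df ->
    is_derive x 1 g dg -> g x != 0 ->
  is_derive x 1 (fun z => f z / g z) ((df * g x - f x * dg) / g x ^+ 2).
Proof.
move=> fx gx g0; have h := is_deriveV g0 gx.
apply: (@is_derive_eq _ _ _ _ _ _ _ _ (is_deriveM fx h)).
rewrite /GRing.scale /=; field.
by [].
Qed.

Lemma is_derive_halfangle_asin v : -1 < v < 1 ->
  is_derive v 1 halfangle_asin (Num.sqrt (1 - v ^+ 2))^-1.
Proof.
move=> /andP[v1 v2].
have v3 : 0 < 1 - v ^+ 2 by nra.
have h1 : is_derive v (1 : R) (fun z : R => 1 - z ^+ 2) (- (2 * v)).
  apply: is_derive_eq; rewrite /GRing.scale /=; ring.
have h2 := is_derive_sqrt_comp h1 v3.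
set r := Num.sqrt (1 - v ^+ 2) in h2 *.
have r0 : 0 < r by rewrite sqrtr_gt0.
have rE : r ^+ 2 = 1 - v ^+ 2 by rewrite sqr_sqrtr // ltW.
have h3 : is_derive v (1 : R) (fun z : R => 1 + Num.sqrt (1 - z ^+ 2)) (- (2 * v) / (2 * r)).
  apply: is_derive_eq; rewrite /= ; ring.
have h4 : is_derive v (1 : R) (fun z : R => z / (1 + Num.sqrt (1 - z ^+ 2)))
    ((1 * (1 + r) - v * (- (2 * v) / (2 * r))) / (1 + r) ^+ 2).
  apply: is_derive_div => //; by rewrite gt_eqF // ltr_pwDl // sqrtr_ge0.
have h5 := is_derive1_comp (is_derive1_atan _) h4.
apply: is_derive_eq (is_deriveZ 2 h5) _.
rewrite /GRing.scale /=.
have vE : v ^+ 2 = 1 - r ^+ 2 by rewrite rE; ring.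
have w0 : (1 + r) ^+ 2 + v ^+ 2 != 0 by rewrite gt_eqF // ltr_pwDl ?exprn_gt0 ?sqr_ge0 // addr_gt0.
transitivity (2 * (r * (1 + r) + v ^+ 2) / (r * ((1 + r) ^+ 2 + v ^+ 2))).
  rewrite -/r; field; rewrite w0 (gt_eqF r0) /= gt_eqF //; exact: addr_gt0.
rewrite vE; field; rewrite (gt_eqF r0) /=.
by rewrite gt_eqF //; nra.
Qed.

Variables (a b t : R).
Hypotheses (a_ge0 : 0 <= a) (a_lt_b : a < b) (t_gt0 : 0 < t).

(** An explicit antiderivative of sqrt((b - x) (x - a)) / (x + t). The arguments of the two arcsines
    are an affine and a Moebius map, both taking a to -1 and b to 1. *)
Let prim x := Num.sqrt ((b - x) * (x - a)) +
  ((a + b) / 2 + t) * halfangle_asin ((2 * x - a - b) / (b - a)) -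
  Num.sqrt ((a + t) * (b + t)) *
    halfangle_asin (((a + b + 2 * t) * (x + t) - 2 * (a + t) * (b + t)) /
      ((x + t) * (b - a))).

Let is_derive_prim x : a < x < b ->
  is_derive x 1 prim (Num.sqrt ((b - x) * (x - a)) / (x + t)).
Proof.
move: a_ge0 a_lt_b t_gt0 => a0 alb t0 /andP[ax xb].
have D0 : 0 < (b - x) * (x - a) by nra.
have ab0 : 0 < b - a by lra.
have xt0 : 0 < x + t by lra.
have abt : 0 < (a + t) * (b + t) by nra.
have h1 : is_derive x (1 : R) (fun z : R => (b - z) * (z - a)) (a + b - 2 * x).
  apply: is_derive_eq; rewrite /GRing.scale /=; ring.
have h2 := is_derive_sqrt_comp h1 D0.
set D := (b - x) * (x - a) in D0 h2 *.
set r := Num.sqrt D in h2 *.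
have r0 : 0 < r by rewrite sqrtr_gt0.
have rE : r ^+ 2 = D by rewrite sqr_sqrtr // ltW.
set q := Num.sqrt ((a + t) * (b + t)).
have q0 : 0 < q by rewrite sqrtr_gt0.
have qE : q ^+ 2 = (a + t) * (b + t) by rewrite sqr_sqrtr // ltW.
have h3 : is_derive x (1 : R) (fun z : R => (2 * z - a - b) / (b - a)) (2 / (b - a)).
  apply: is_derive_eq; rewrite /GRing.scale /=; ring.
have h4 : is_derive x (1 : R) (fun z : R => ((a + b + 2 * t) * (z + t) - 2 * (a + t) * (b + t)) /
      ((z + t) * (b - a))) (2 * q ^+ 2 / ((x + t) ^+ 2 * (b - a))).
  have n1 : is_derive x (1 : R) (fun z : R => (a + b + 2 * t) * (z + t) - 2 * (a + t) * (b + t)) (a + b + 2 * t).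
    apply: is_derive_eq; rewrite /GRing.scale /=; ring.
  have n2 : is_derive x (1 : R) (fun z : R => (z + t) * (b - a)) (b - a).
    apply: is_derive_eq; rewrite /GRing.scale /=; ring.
  apply: is_derive_eq (is_derive_div n1 n2 _) _; first by rewrite gt_eqF // mulr_gt0.
  by rewrite qE; field; rewrite !gt_eqF.
pose u := (2 * x - a - b) / (b - a).
have uE : 1 - u ^+ 2 = (2 * r / (b - a)) ^+ 2.
  by rewrite [RHS]expr_div_n [(2 * r) ^+ 2]exprMn rE /D /u; field; rewrite gt_eqF.
pose v := ((a + b + 2 * t) * (x + t) - 2 * (a + t) * (b + t)) / ((x + t) * (b - a)).
have vE : 1 - v ^+ 2 = (2 * q * r / ((x + t) * (b - a))) ^+ 2.
  rewrite [RHS]expr_div_n [(2 * q * r) ^+ 2]exprMn [(2 * q) ^+ 2]exprMn rE /v qE /D; field; by rewrite !gt_eqF.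
have in1 (z s : R) : 0 < s -> 1 - z ^+ 2 = s ^+ 2 -> -1 < z < 1.
  move=> s0 h; have : 0 < s ^+ 2 by rewrite exprn_gt0.
  by rewrite -h => h'; apply/andP; split; nra.
have hu : 0 < 2 * r / (b - a) by rewrite divr_gt0 // mulr_gt0.
have hv : 0 < 2 * q * r / ((x + t) * (b - a)) by rewrite divr_gt0 // !mulr_gt0.
have d1 : is_derive u 1 halfangle_asin (2 * r / (b - a))^-1.
  by rewrite -(gtr0_norm hu) -sqrtr_sqr -uE; apply: is_derive_halfangle_asin; exact: in1 hu uE.
have d2 : is_derive v 1 halfangle_asin (2 * q * r / ((x + t) * (b - a)))^-1.
  by rewrite -(gtr0_norm hv) -sqrtr_sqr -vE; apply: is_derive_halfangle_asin; exact: in1 hv vE.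
have e1 := is_deriveZ ((a + b) / 2 + t) (@is_derive1_comp _ halfangle_asin (fun z : R => (2 * z - a - b) / (b - a)) x _ _ d1 h3).
have e2 := is_deriveZ q (@is_derive1_comp _ halfangle_asin
  (fun z : R => ((a + b + 2 * t) * (z + t) - 2 * (a + t) * (b + t)) / ((z + t) * (b - a)))
  x _ _ d2 h4).
apply: is_derive_eq (is_deriveB (is_deriveD h2 e1) e2) _.
rewrite /GRing.scale /=.
(* (b - x) (x - a) is expanded in powers of x + t. The first two terms produce the root and the
   first arcsine, the constant - q^2 the second arcsine. *)
transitivity ((- (x + t) ^+ 2 + (a + b + 2 * t) * (x + t) - q ^+ 2) / (r * (x + t))).
  by field; rewrite !gt_eqF.
transitivity (r ^+ 2 / (r * (x + t))); last by field; rewrite !gt_eqF.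
congr (_ / _); rewrite rE qE /D; ring.
Qed.

Let continuous_prim x : a <= x -> {for x, continuous prim}.
Proof.
move: a_ge0 a_lt_b t_gt0 => a0 alb t0 ax.
have c1 : {for x, continuous (fun z : R => (b - z) * (z - a))}.
  apply: continuousM; apply: continuousB; by [exact: cst_continuous|exact: cvg_id].
have c2 : {for x, continuous (fun z : R => Num.sqrt ((b - z) * (z - a)))}.
  by apply: continuous_comp c1 _; exact: sqrt_continuous.
have c3 : {for x, continuous (fun z : R => (2 * z - a - b) / (b - a))}.
  apply: continuousM; last exact: cst_continuous.
  apply: continuousB; last exact: cst_continuous.
  apply: continuousB; last exact: cst_continuous.
  apply: continuousM; by [exact: cst_continuous|exact: cvg_id].
have c4 : {for x, continuous (fun z : R => ((a + b + 2 * t) * (z + t) - 2 * (a + t) * (b + t)) /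
      ((z + t) * (b - a)))}.
  have cxt : {for x, continuous (fun z : R => z + t)}.
    apply: continuousD; by [exact: cst_continuous|exact: cvg_id].
  apply: continuousM.
    apply: continuousB; last exact: cst_continuous.
    apply: continuousM => //; exact: cst_continuous.
  apply: continuousV; first by rewrite gt_eqF //; nra.
  apply: continuousM => //; exact: cst_continuous.
apply: continuousB.
  apply: continuousD => //.
  apply: continuousM; first exact: cst_continuous.
  apply: continuous_comp c3 _; exact: continuous_halfangle_asin.
apply: continuousM; first exact: cst_continuous.
apply: continuous_comp c4 _; exact: continuous_halfangle_asin.
Qed.

Lemma integral_sqrt_shift :
  (\int[lebesgue_measure]_(x in `[a, b]) (Num.sqrt ((b - x) * (x - a)) / (x + t))%:E =
   (pi * ((a + b) / 2 + t - Num.sqrt ((a + t) * (b + t))))%:E)%E.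
Proof.
move: a_ge0 a_lt_b t_gt0 => a0 alb t0.
rewrite (@continuous_FTC2 _ _ prim) //.
- rewrite -EFinB; congr (_%:E); rewrite /prim.
  have ab0 : b - a != 0 by rewrite gt_eqF // subr_gt0.
  have bt : b + t != 0 by rewrite gt_eqF //; lra.
  have at0 : a + t != 0 by rewrite gt_eqF //; lra.
  have -> : (2 * b - a - b) / (b - a) = 1 by field.
  have -> : (2 * a - a - b) / (b - a) = -1 by field.
  have -> : ((a + b + 2 * t) * (b + t) - 2 * (a + t) * (b + t)) / ((b + t) * (b - a)) = 1.
    by field; rewrite ab0 bt.
  have -> : ((a + b + 2 * t) * (a + t) - 2 * (a + t) * (b + t)) / ((a + t) * (b - a)) = -1.
    by field; rewrite ab0 at0.
  rewrite !subrr mul0r mulr0 sqrtr0 halfangle_asin1 halfangle_asinN1.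
  set q := Num.sqrt _; lra.
- apply: continuous_in_subspaceT => x /[!inE] /=; rewrite in_itv /= => /andP[ax xb].
  apply: (@continuousM _ _ (fun z : R => Num.sqrt ((b - z) * (z - a))) (fun z => (z + t)^-1)).
    apply: continuous_comp; last exact: sqrt_continuous.
    apply: continuousM; apply: continuousB; by [exact: cst_continuous|exact: cvg_id].
  apply: continuousV; first by rewrite gt_eqF //; lra.
  apply: continuousD; by [exact: cst_continuous|exact: cvg_id].
- split.
  + move=> x /[!in_itv] /= axb; have [] := is_derive_prim axb; done.
  + apply: cvg_at_right_filter; exact: continuous_prim.
  + apply: cvg_at_left_filter; apply: continuous_prim; exact: ltW.
- move=> x /[!in_itv] /= axb; rewrite derive1E; have [_] := is_derive_prim axb; done.
Qed.

End ArcsineByArctangent.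


Section SqrtOverX.
Variables (R : realType) (a b : R).
Hypotheses (a_ge0 : 0 <= a) (a_lt_b : a < b).
Let mu := @lebesgue_measure R.

Lemma measurable_sqrt_shift (t : R) (D : set R) :
  measurable_fun D (fun x => Num.sqrt ((b - x) * (x - a)) / (x + t)).
Proof.
apply: (@measurable_funS _ _ _ _ setT) => //.
apply: measurable_funM.
  apply: (measurableT_comp (continuous_measurable_fun (@sqrt_continuous R))).
  by apply: measurable_funM; apply: measurable_funB.
apply: (measurableT_comp (@measurable_invr R)); exact: measurable_funD.
Qed.

Lemma integral_sqrt_inv :
  (\int[mu]_(x in `[a, b]) (Num.sqrt ((b - x) * (x - a)) / x)%:E =
   (pi * ((a + b) / 2 - Num.sqrt (a * b)))%:E)%E.
Proof.
pose u n : R := n.+1%:R^-1.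
have u0 n : 0 < u n by rewrite invr_gt0.
have cu : u n @[n --> \oo] --> (0 : R) by exact: cvg_harmonic.
pose g n (x : R) := (Num.sqrt ((b - x) * (x - a)) / (x + u n))%:E.
have ge0 (x : R) : `[a, b]%classic x -> 0 <= x.
  by rewrite /= in_itv /= => /andP[ax _]; exact: le_trans ax.
have lim_g : (\int[mu]_(x in `[a, b]) g n x)%E @[n --> \oo] -->
    (pi * ((a + b) / 2 - Num.sqrt (a * b)))%:E.
  under eq_fun do rewrite (integral_sqrt_shift a_ge0 a_lt_b (u0 _)).
  apply: cvg_EFin; first exact: nearW.
  rewrite /comp /=.
  have h (x : R) : u n + x @[n --> \oo] --> x.
    by rewrite -[X in _ --> X]add0r; apply: cvgD => //; exact: cvg_cst.
  apply: cvgM; first exact: cvg_cst.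
  under eq_fun do rewrite [_ / 2 + _]addrC [a + u _]addrC [b + u _]addrC.
  apply: cvgB; first exact: h.
  apply: (@cvg_comp _ _ _ (fun n => (u n + a) * (u n + b)) Num.sqrt _ (nbhs (a * b))).
    by apply: cvgM; exact: h.
  exact: sqrt_continuous.
have lim_g' := @cvg_monotone_convergence _ _ _ mu `[a, b] _ g.
have : (\int[mu]_(x in `[a, b]) g n x)%E @[n --> \oo] -->
   (\int[mu]_(x in `[a, b]) limn (g ^~ x))%E.
  apply: lim_g' => //.
  - move=> n; apply/measurable_EFinP; exact: measurable_sqrt_shift.
  - move=> n x /ge0 x0; rewrite lee_fin divr_ge0 ?sqrtr_ge0 //.
    by rewrite addr_ge0 // ltW.
  - move=> x /ge0 x0 n n' nn'; rewrite lee_fin ler_wpM2l ?sqrtr_ge0 //.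
    rewrite lef_pV2 ?posrE ?ltr_wpDl // lerD2l /u lef_pV2 ?posrE ?ltr0n //.
    by rewrite ler_nat ltnS.
move=> /(cvg_unique _ lim_g) -> //.
apply: eq_integral => x; rewrite inE => xab; apply/esym/cvg_lim => //.
apply: cvg_EFin; first exact: nearW.
(* At x = 0 one has a = 0 and the numerator vanishes, so both the sequence and the limit, with 1 / 0
   read as 0, are 0. *)
rewrite /comp /=; have [x0|x0] := eqVneq x 0.
  have az : a = 0.
    by apply/le_anti; rewrite a_ge0 andbT; move: xab; rewrite /= in_itv /= x0 => /andP[].
  rewrite x0 az subrr mulr0 sqrtr0 mul0r.
  by rewrite (_ : (fun n => _) = (fun=> 0)); [exact: cvg_cst|apply/funext => n; rewrite mul0r].
apply: cvgM; first exact: cvg_cst.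
apply: cvgV => //; rewrite -[X in _ --> X]addr0; apply: cvgD => //; exact: cvg_cst.
Qed.

End SqrtOverX.

Section MarchenkoPastur.
Variables (R : realType) (c : R).
Hypothesis c_gt0 : 0 < c.
Let mu := @lebesgue_measure R.
Let a := (1 - Num.sqrt c) ^+ 2.
Let b := (1 + Num.sqrt c) ^+ 2.
Let s := Num.sqrt c.

Let s_gt0 : 0 < s. Proof. by rewrite sqrtr_gt0. Qed.
Let sE : s ^+ 2 = c. Proof. by rewrite sqr_sqrtr // ltW. Qed.
Let a_ge0 : 0 <= a. Proof. exact: sqr_ge0. Qed.
Let a_lt_b : a < b. Proof. rewrite /a /b -/s; move: s_gt0; nra. Qed.
Let abD : a + b = 2 * (1 + c).
Proof. rewrite /a /b -/s -sE; ring. Qed.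
Let abM : a * b = (1 - c) ^+ 2.
Proof. rewrite /a /b -/s -sE; ring. Qed.
Let support_ge0 (x : R) : `[a, b]%classic x -> 0 <= x.
Proof. by rewrite /= in_itv /= => /andP[ax _]; exact: le_trans ax. Qed.

Let mp_densityE (x : R) : `[a, b]%classic x ->
  mp_density c x = (2 * pi)^-1 * (Num.sqrt ((b - x) * (x - a)) / x).
Proof.
by move=> xab; rewrite /mp_density -/a -/b indicE mem_set // mulr1 invfM mulrA mulrCA mulrA.
Qed.

Let pi2_ge0 : 0 <= (2 * pi)^-1 :> R.
Proof. by rewrite invr_ge0 mulr_ge0 // pi_ge0. Qed.

Lemma mp_density_ge0 (x : R) : 0 <= mp_density c x.
Proof.
rewrite /mp_density -/a -/b indicE; case: (boolP (x \in _)) => [|_]; last by rewrite mulr0.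
rewrite inE => /support_ge0 x0; rewrite mulr1 divr_ge0 ?sqrtr_ge0 //.
by rewrite !mulr_ge0 // pi_ge0.
Qed.

Lemma measurable_mp_density : measurable_fun setT (mp_density c).
Proof.
rewrite /mp_density; apply: measurable_funM; last first.
  by apply: measurable_indic.
apply: measurable_funM.
  apply: (measurableT_comp (continuous_measurable_fun (@sqrt_continuous R))).
  by apply: measurable_funM; apply: measurable_funB.
apply: (measurableT_comp (@measurable_invr R)); exact: measurable_funM.
Qed.

(** The right-hand side is min(1, c); the missing mass is that of the atom at 0, see [w0E]. *)
Lemma integral_mp_density :
  (\int[mu]_(x in `[a, b]) (mp_density c x)%:E = (2^-1 * (1 + c - `|1 - c|))%:E)%E.
Proof.
transitivity (\int[mu]_(x in `[a, b]) ((2 * pi)^-1%:E *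
    (Num.sqrt ((b - x) * (x - a)) / x)%:E))%E.
  by apply: eq_integral => x; rewrite inE => xab; rewrite -EFinM mp_densityE.
rewrite ge0_integralZl //.
- rewrite integral_sqrt_inv // -EFinM abM abD sqrtr_sqr; congr (_%:E).
  have : (pi : R) != 0 by rewrite gt_eqF // pi_gt0.
  by move: pi => p p0; field.
- apply/measurable_EFinP.
  rewrite (_ : (fun x => _) = (fun x => Num.sqrt ((b - x) * (x - a)) / (x + 0))).
    exact: measurable_sqrt_shift.
  by apply/funext => x; rewrite addr0.
- by move=> x /support_ge0 x0; rewrite lee_fin divr_ge0 ?sqrtr_ge0.
Qed.

Let integrable_mul f : bmp f -> mu.-integrable `[a, b] (EFin \o (fun x => f x * mp_density c x)).
Proof.
move=> [mf [M Mf]].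
have irho : mu.-integrable `[a, b] (EFin \o (fun x => M * mp_density c x)).
  rewrite (_ : EFin \o _ = (fun x => M%:E * (mp_density c x)%:E)%E) //.
  apply: integrableZl => //; apply/integrableP; split.
    apply/measurable_EFinP; apply: measurable_funS measurable_mp_density => //.
  under eq_integral do rewrite /= ger0_norm ?mp_density_ge0 //.
  by rewrite integral_mp_density ltry.
apply: le_integrable irho => //.
  apply/measurable_EFinP; apply: (@measurable_funS _ _ _ _ setT) => //.
  exact: measurable_funM measurable_mp_density.
move=> x /support_ge0 x0 /=.
rewrite lee_fin !normrM ler_wpM2r //; exact: le_trans (Mf x x0) (ler_norm M).
Qed.

Let w0 : R := if c < 1 then 1 - c else 0.

Let w0E : w0 = 2^-1 * (1 - c + `|1 - c|).
Proof.
rewrite /w0; case: ifPn => c1; first by rewrite gtr0_norm ?subr_gt0 //; field.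
by rewrite ler0_norm ?subr_le0 ?leNgt //; ring.
Qed.

Let w0_ge0 : 0 <= w0.
Proof. by rewrite /w0; case: ifPn => // /ltW; rewrite subr_ge0. Qed.

Definition mp_mean (f : R -> R) : R :=
  \int[mu]_(x in `[a, b]) (f x * mp_density c x) + w0 * f 0.

Lemma pmean_mp_mean : pmean mp_mean.
Proof.
split.
- move=> r; rewrite /mp_mean.
  have -> : \int[mu]_(x in `[a, b]) (r * mp_density c x) = r * (2^-1 * (1 + c - `|1 - c|)).
    rewrite RintegralZl //; first by rewrite /Rintegral integral_mp_density.
    have := integrable_mul (bmp_cst 1).
    by rewrite (_ : (fun x => 1 * mp_density c x) = mp_density c) //; apply/funext => x; rewrite mul1r.
  by rewrite w0E; field.
- move=> f g bf bg; rewrite /mp_mean; under eq_Rintegral do rewrite mulrDl.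
  rewrite RintegralD //; [|exact: integrable_mul..].
  by rewrite mulrDr addrACA.
- move=> r f bf; rewrite /mp_mean; under eq_Rintegral do rewrite -mulrA.
  by rewrite RintegralZl //; [rewrite mulrDr mulrCA|exact: integrable_mul].
- move=> f g bf bg fg; rewrite /mp_mean lerD //; last by rewrite ler_wpM2l // fg.
  apply: le_Rintegral => //; [exact: integrable_mul..|].
  by move=> x /support_ge0 x0; rewrite ler_wpM2r ?mp_density_ge0 // fg.
Qed.

(** The value is r = (q - (t + c - 1)) / (2 t) with q^2 = (t + c - 1)^2 + 4 t, the nonnegative root
    of t r^2 + (t + c - 1) r - 1 = 0. Divided by 1 + r this is the limiting equation with unit
    weights. *)
Lemma mp_mean_rpow1 t : 0 < t -> exists2 r, mp_mean (rpow 1 t) = r &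
  0 <= r /\ 1 - t * r - c * (r / (1 + r)) = 0.
Proof.
move=> t0; eexists; first by [].
have q2E : (a + t) * (b + t) = (t + c - 1) ^+ 2 + 4 * t.
  have -> : (a + t) * (b + t) = a * b + (a + b) * t + t ^+ 2 by ring.
  rewrite abD abM; ring.
set q := Num.sqrt ((a + t) * (b + t)).
have q_ge0 : 0 <= q by exact: sqrtr_ge0.
have qE : q ^+ 2 = (t + c - 1) ^+ 2 + 4 * t.
  by rewrite sqr_sqrtr // q2E addr_ge0 ?sqr_ge0 // mulr_ge0 // ltW.
have mE : mp_mean (rpow 1 t) = (2 * t)^-1 * (q - (t + c - 1)).
  have irho := integrable_mul (bmp_cst 1).
  have iq := integrable_mul (bmpZ t (bmp_rpow 1 t0)).
  (* Partial fractions, 1 / (x + t) = 1 / x - t / (x (x + t)), express the transform through the two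
     integrals already computed. *)
  have jE x : `[a, b]%classic x -> (2 * pi)^-1 * (Num.sqrt ((b - x) * (x - a)) / (x + t)) =
      1 * mp_density c x - t * rpow 1 t x * mp_density c x.
    move=> xab; have x0 := support_ge0 xab; rewrite -mulrBl mp_densityE // [RHS]mulrCA; congr (_ * _).
    have [xE|xn] := eqVneq x 0.
      have -> : Num.sqrt ((b - x) * (x - a)) = 0.
        apply/eqP; rewrite sqrtr_eq0 xE subr0 sub0r mulrN oppr_le0 mulr_ge0 //.
        exact: le_trans (ltW a_lt_b).
      by rewrite !mul0r !mulr0.
    have xt : x + t != 0 by rewrite gt_eqF //; lra.
    rewrite /rpow expr1; set q' := Num.sqrt _; field; by rewrite xn xt.
  have e1 : \int[mu]_(x in `[a, b]) ((2 * pi)^-1 * (Num.sqrt ((b - x) * (x - a)) / (x + t))) =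
     2^-1 * (1 + c + t - q).
    rewrite /Rintegral.
    under eq_integral do rewrite EFinM.
    rewrite ge0_integralZl //.
    - rewrite integral_sqrt_shift // abD /=.
      have : (pi : R) != 0 by rewrite gt_eqF // pi_gt0.
      by rewrite -/q; move: pi (q) => p q' p0; field.
    - apply/measurable_EFinP; exact: measurable_sqrt_shift.
    - move=> x /support_ge0 x0; rewrite lee_fin divr_ge0 ?sqrtr_ge0 //; lra.
  have e2 : 2^-1 * (1 + c + t - q) = 2^-1 * (1 + c - `|1 - c|) -
      t * \int[mu]_(x in `[a, b]) (rpow 1 t x * mp_density c x).
    rewrite -e1; under eq_Rintegral => x do [rewrite inE => xab; rewrite jE //].
    rewrite RintegralB //.
    congr (_ - _).
      by rewrite /Rintegral; under eq_integral do rewrite mul1r; rewrite integral_mp_density.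
    under eq_Rintegral do rewrite -mulrA.
    rewrite RintegralZl //; apply: integrable_mul; exact: bmp_rpow.
  rewrite /mp_mean.
  have -> : \int[mu]_(x in `[a, b]) (rpow 1 t x * mp_density c x) =
      t^-1 * (2^-1 * (1 + c - `|1 - c|) - 2^-1 * (1 + c + t - q)).
    by rewrite e2; field; rewrite gt_eqF.
  rewrite w0E /rpow expr1 add0r; set m := `|1 - c|; field; by rewrite gt_eqF.
rewrite mE.
have r0 : 0 <= q - (t + c - 1).
  rewrite subr_ge0 -[q]ger0_norm //; apply: le_trans (ler_norm _) _.
  by rewrite -(@ler_pXn2r _ 2) ?nnegrE // !real_normK ?num_real // qE lerDl mulr_ge0 // ltW.
set r := (2 * t)^-1 * _.
have rpos : 0 <= r by rewrite mulr_ge0 // invr_ge0 mulr_ge0 // ltW.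
split=> //.
have -> : 1 - t * r - c * (r / (1 + r)) = (1 + r * (1 - t - c) - t * r ^+ 2) / (1 + r).
  by field; rewrite gt_eqF //; lra.
have -> : 1 + r * (1 - t - c) - t * r ^+ 2 = ((t + c - 1) ^+ 2 + 4 * t - q ^+ 2) / (4 * t).
  by rewrite /r; field; rewrite gt_eqF.
by rewrite qE subrr !mul0r.
Qed.

Lemma mp_mean_ind (x : R) : (mp_mean (ind_le x))%:E = mp_law c `]-oo, x].
Proof.
rewrite /mp_mean EFinD /mp_law -/w0; congr (_ + _)%E.
  have ir := integrable_mul (bmp_ind x).
  rewrite /Rintegral fineK; last exact: integrable_fin_num.
  rewrite integral_mkcond [RHS]integral_mkcond; apply: eq_integral => z _.
  rewrite !patchE /ind_le; case: ifPn => [_|/negP zab].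
    by rewrite mem_setE in_itv /=; case: ifP => _; rewrite ?mul1r ?mul0r.
  case: ifPn => // _; rewrite /mp_density -/a -/b indicE.
  by case: (boolP (z \in _)) => // _; rewrite mulr0.
by rewrite EFinM diracE mem_setE in_itv.
Qed.

(** Dominated convergence for the density; as x >= 0, the atom at 0 is counted on both sides. *)
Lemma mp_mean_ind_right (x e : R) : 0 <= x -> 0 < e ->
  exists2 y, x < y & mp_mean (ind_le y) <= mp_mean (ind_le x) + e.
Proof.
move=> x0 e0; pose u n : R := n.+1%:R^-1.
have u0 n : 0 < u n by rewrite invr_gt0.
have cu : u n @[n --> \oo] --> (0 : R) by exact: cvg_harmonic.
pose f n (z : R) := (ind_le (x + u n) z * mp_density c z)%:E.
have mi (y : R) : measurable_fun `[a, b] (fun z => (ind_le y z * mp_density c z)%:E).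
  by have /integrableP[] := integrable_mul (bmp_ind y).
have [] := @dominated_convergence _ _ _ mu `[a, b] _ f
  (fun z => (ind_le x z * mp_density c z)%:E) (fun z => (1 * mp_density c z)%:E) _ (mi x).
- by [].
- by move=> n; exact: mi.
- apply/aeW => z _; apply: cvg_EFin; first exact: nearW.
  rewrite /comp /=; apply: cvgM; last exact: cvg_cst.
  apply: (cvg_near_cst (ind_le x z)).
  have [zx|xz] := leP z x.
    by apply: nearW => n; rewrite /ind_le zx (le_trans zx) // lerDl ltW.
  near=> n; rewrite /ind_le (leNgt z x) xz /= (leNgt z) -ltrBrDl.
  suff -> : u n < z - x by [].
  near: n; apply: cvgr_lt cu _ _; by rewrite subr_gt0.
- exact: integrable_mul (bmp_cst 1).
- apply/aeW => z n _ /=; rewrite lee_fin normrM (ger0_norm (mp_density_ge0 z)).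
  rewrite ler_wpM2r ?mp_density_ge0 // // /ind_le; case: (z <= x + u n); rewrite ?normr1 ?normr0 // ler01.
move=> _ _ cvgf.
have cvgf' : \int[mu]_(z in `[a, b]) (ind_le (x + u n) z * mp_density c z) @[n --> \oo] -->
    \int[mu]_(z in `[a, b]) (ind_le x z * mp_density c z).
  apply: fine_cvg; rewrite fineK //; apply: integrable_fin_num => //; exact: integrable_mul (bmp_ind x).
move/cvgrPdist_le: cvgf' => /(_ e e0) [n _ /(_ n (leqnn _)) /= h].
exists (x + u n); first by rewrite ltrDl.
have E0 y : 0 <= y -> ind_le y 0 = 1 :> R by rewrite /ind_le => ->.
rewrite /mp_mean !E0 ?addr_ge0 // ?(ltW (u0 n)) //.
move: h; rewrite distrC ler_norml lerBlDl => /andP[_ h]; by rewrite [leRHS]addrAC lerD2r.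
Unshelve. all: by end_near. Qed.

End MarchenkoPastur.

(** * The limiting spectral distribution *)

Section LimitEquation.
Variables (R : realType) (tau : nat -> R).
Hypothesis tau_ge0 : forall j, 0 <= tau j.
Variables (mom : nat -> R) (A : R).
Hypothesis tau_mom : forall q, (0 < q)%N -> avg tau (fun x => x ^+ q) M @[M --> \oo] --> mom q.
Hypothesis A_gt0 : 0 < A.
Hypothesis mom_le : forall q, (0 < q)%N -> `|mom q| <= A ^+ q * q%:R ^+ q.
Variables c t : R.
Hypotheses (c_gt0 : 0 < c) (t_gt0 : 0 < t).

Let psi s := limn (avg tau (fun x => s * x / (1 + s * x))).

Let cvg_psi s : 0 <= s -> avg tau (fun x => s * x / (1 + s * x)) M @[M --> \oo] --> psi s.
Proof. by move=> s0; exact: cvg_avg_frac tau_mom A_gt0 mom_le _ s0. Qed.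

Let psi_ge0 s : 0 <= s -> 0 <= psi s.
Proof.
move=> s0; apply: limr_ge; first exact: cvgP (cvg_psi s0).
apply: nearW => M; apply: avg_ge0 => // x x0.
by rewrite divr_ge0 ?addr_ge0 ?mulr_ge0.
Qed.

Lemma mom1_ge0 : 0 <= mom 1.
Proof.
rewrite -(cvg_lim _ (tau_mom (ltn0Sn 0))) //; apply: limr_ge; first exact: cvgP (tau_mom (ltn0Sn 0)).
apply: nearW => M; apply: avg_ge0 => // x x0; exact: exprn_ge0.
Qed.

Let psi_lip u v : 0 <= u -> 0 <= v -> `|psi u - psi v| <= mom 1 * `|u - v|.
Proof.
move=> u0 v0.
have h1 : `|avg tau (fun x => u * x / (1 + u * x)) M - avg tau (fun x => v * x / (1 + v * x)) M|
    @[M --> \oo] --> `|psi u - psi v|.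
  by apply: cvg_norm; apply: cvgB; exact: cvg_psi.
have h2 : avg tau (fun x => x ^+ 1) M * `|u - v| @[M --> \oo] --> mom 1 * `|u - v|.
  by apply: cvgM; [exact: tau_mom|exact: cvg_cst].
rewrite -(cvg_lim _ h1) // -(cvg_lim _ h2) //.
apply: ler_lim; [exact: cvgP h1|exact: cvgP h2|apply: nearW => M].
rewrite -avgB; apply: le_trans (norm_avg _ _ _) _.
rewrite mulrC -avgZ; apply: le_avg => // x x0.
rewrite expr1 [leRHS]mulrC ![_ * x]mulrC; exact: frac_lipschitz.
Qed.

(** With psi the limiting average, c psi(s) + t s is 0 at s = 0 and at least 1 at s = 1 / t, so the
    intermediate value theorem applies. Continuity comes from the Lipschitz constant [mom 1] of
    psi. *)
Lemma limit_equation_root : exists2 s, 0 <= s &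
  avg tau (fun x => s * x / (1 + s * x)) M @[M --> \oo] --> (1 - t * s) / c.
Proof.
(* The absolute values extend the function to the whole line, where its continuity is stated. *)
pose G (s : R) := c * psi `|s| + t * `|s|.
pose K := c * mom 1 + t.
have K0 : 0 < K by rewrite ltr_wpDl // mulr_ge0 ?mom1_ge0 // ltW.
have lip u v : `|G u - G v| <= K * `|u - v|.
  have -> : G u - G v = c * (psi `|u| - psi `|v|) + t * (`|u| - `|v|) by rewrite /G; ring.
  apply: le_trans (ler_normD _ _) _; rewrite !normrM (gtr0_norm c_gt0) (gtr0_norm t_gt0).
  have d := ler_dist_dist u v.
  rewrite mulrDl lerD // ?ler_wpM2l // ?(ltW t_gt0) // -mulrA ler_wpM2l ?(ltW c_gt0) //.
  apply: le_trans (psi_lip _ _) _ => //; by rewrite ler_wpM2l ?mom1_ge0.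
have contG : continuous G.
  move=> x; apply/cvgrPdist_le => e e0; near=> y.
  apply: le_trans (lip x y) _; rewrite mulrC -ler_pdivlMr //.
  near: y; apply: cvgr_dist_le; first exact: cvg_id.
  exact: divr_gt0.
have psi0 : psi 0 = 0.
  apply: cvg_lim => //; rewrite (_ : avg _ _ = fun=> 0); first exact: cvg_cst.
  by apply/funext => M; rewrite /avg big1 ?mulr0 // => j _; rewrite !mul0r.
have G0 : G 0 = 0 by rewrite /G normr0 psi0 !mulr0 addr0.
have ti0 : 0 <= t^-1 by rewrite invr_ge0 ltW.
have G1 : 1 <= G t^-1.
  rewrite /G (ger0_norm ti0) mulfV ?gt_eqF // lerDr mulr_ge0 ?psi_ge0 // ltW //.
have [||s s0 Gs] := @IVT R G 0 t^-1 1 ti0.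
- by apply: continuous_subspaceT.
- by rewrite G0 ge_min ler01 /= le_max G1 orbT.
have {}s0 : 0 <= s by move: s0; rewrite in_itv /= => /andP[].
exists s => //; have -> : (1 - t * s) / c = psi s; last exact: cvg_psi.
by rewrite -Gs /G ger0_norm // addrK mulrC mulKf // gt_eqF.
Unshelve. all: by end_near. Qed.

End LimitEquation.


Section SampleTrace.
Local Open Scope sesquilinear_scope.
Local Open Scope complex_scope.
Local Open Scope ring_scope.
Variables (R : realType) (n k : nat).

Lemma Re_tr_tensor (v : 'I_k -> 'cV[R[i]]_n) :
  \tr (tensor v *m (tensor v) ^t*) = (\prod_(l < k) sqnorm (v l))%:C.
Proof.
rewrite mxtrace_mulC trace_mx11 mxE.
transitivity (\sum_(f : {ffun 'I_k -> 'I_n}) \prod_(l < k) (`|v l (f l) 0| ^+ 2)).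
  rewrite (reindex (@enum_val _ {: {ffun 'I_k -> 'I_n}})) /=; last first.
    by exists enum_rank => f _; [exact: enum_valK|exact: enum_rankK].
  apply: eq_bigr => a _; rewrite !mxE conjC_prod -big_split /=.
  by apply: eq_bigr => l _; rewrite normCK mulrC.
transitivity (\prod_(l < k) \sum_(j < n) (`|v l j 0| ^+ 2)); first by rewrite bigA_distr_bigA.
rewrite rmorph_prod; apply: eq_bigr => l _.
rewrite /sqnorm rmorph_sum; apply: eq_bigr => j _.
by case: (v l j 0) => u w; rewrite normCK; apply/eqP; rewrite eq_complex /=; apply/andP; split; apply/eqP; ring.
Qed.

Lemma Re_tr_csample (m : nat) (tau : nat -> R) (tau_ge0 : forall j, 0 <= tau j)
    (z : prodT (Cvec R n) ('I_m * 'I_k)%type) :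
  complex.Re (\tr (csample tau z)) <= \sum_(al < m) tau al.
Proof.
rewrite /csample /sample_mx [X in complex.Re X]raddf_sum /= Re_sum; apply: ler_sum => al _.
rewrite mxtraceZ Re_tr_tensor -rmorphM /= -[leRHS]mulr1 ler_wpM2l //.
apply: prodr_ile1 => l _; rewrite /clamp; case: eqP => [->|_]; first by rewrite ler01 lexx.
rewrite /sqnorm big1 ?lexx ?ler01 // => j _.
by rewrite mxE /= expr0n /= addr0.
Qed.

End SampleTrace.

(** * From the given random vectors to the product law *)

Section JointLaw.
Variables (R : realType) (n k m : nat) (d : measure_display) (T : measurableType d).
Variables (P : probability T R) (mu : probability (Cvec R n) R).
Variable y : 'I_m -> 'I_k -> {RV P >-> Cvec R n}.
Hypothesis y_law : forall al l (B : set (Cvec R n)),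
  measurable B -> distribution P (y al l) B = mu B.
Hypothesis y_indep : mutually_independent (fun al : ('I_m * 'I_k)%type => y al.1 al.2).

Definition joint (w : T) : prodT (Cvec R n) ('I_m * 'I_k)%type := fun i => y i.1 i.2 w.

Lemma measurable_joint : measurable_fun setT joint.
Proof. apply: measurable_to_prodT => i; exact: measurable_funPT. Qed.

HB.instance Definition _ := isMeasurableFun.Build _ _ _ _ joint measurable_joint.

Lemma joint_rect (B : 'I_m * 'I_k -> set (Cvec R n)) : (forall i, measurable (B i)) ->
  distribution P joint [set z | forall i, B i (z i)] = (\prod_i mu (B i))%E.
Proof.
move=> mB; rewrite /distribution /pushforward.
transitivity (P (\bigcap_(i in [set: 'I_m * 'I_k]) (y i.1 i.2 @^-1` B i))).
  congr (P _); apply/seteqP; split => w /= h; [move=> i _|move=> i]; exact: h.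
by rewrite y_indep //; apply: eq_bigr => i _; rewrite -(y_law i.1 i.2).
Qed.

Hypotheses (mu_unif : uniform_on_sphere mu) (n_gt0 : (0 < n)%N).
Variable tau : nat -> R.
Hypothesis tau_gt0 : forall j, 0 < tau j.

Lemma joint_equation_whp (t e dl : R) : 0 < t -> 0 < e -> 0 < dl ->
  exists B : set T, [/\ measurable B,
    [set w | dl < `|1 - t * csample_stieltjes tau t (joint w) -
      (n ^ k)%:R^-1 * \sum_(al < m) (tau al * csample_stieltjes tau t (joint w) /
         (1 + tau al * csample_stieltjes tau t (joint w)))|] `<=` B
  & (P B <= (((n ^ k)%:R^-1 * \sum_(al < m) tau al) *
     (e + e^-1 * (t ^- 2 * k%:R / n.+1%:R) + (t * (n ^ k)%:R)^-1) / dl)%:E)%E].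
Proof.
move=> t0 e0 dl0.
have [B [mB sB PB]] := stieltjes_equation_whp mu_unif joint_rect n_gt0 tau_gt0 t0 e0 dl0.
exists (joint @^-1` B); split => //.
  rewrite -[X in measurable X]setTI; exact: measurable_joint.
by move=> w h; exact: (sB (joint w)).
Qed.

Lemma small_unclamped : exists B : set T, [/\ measurable B, P B = 0%E &
  forall w, ~ B w -> csample tau (joint w) =
    sample_mx tau (fun al l => y al l w : 'cV[R[i]]_n)].
Proof.
pose S := [set v : Cvec R n | sqnorm (v : 'cV[R[i]]_n) = 1].
have mS : measurable S by exact: measurable_sphere.
pose G := \bigcap_(i in [set: 'I_m * 'I_k]) (y i.1 i.2 @^-1` S).
have mG : measurable G.
  apply: fin_bigcap_measurable => // i _.
  rewrite -[X in measurable X]setTI; exact: measurable_funPT.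
exists (~` G); split; first exact: measurableC.
  rewrite probability_setC // /G y_indep // big1 ?subee // => i _.
  by transitivity (mu S); [exact: (y_law i.1 i.2 mS)|case: mu_unif].
move=> w /contrapT Gw; rewrite /csample; congr sample_mx; apply/funext => al; apply/funext => l.
by rewrite /clamp /joint /= (Gw (al, l) I) eqxx.
Qed.

End JointLaw.


Section Stability.
Variables (R : realType) (tau : nat -> R).
Hypothesis tau_ge0 : forall j, 0 <= tau j.

Lemma frac_ndecr (a u v : R) : 0 <= a -> 0 <= u -> u <= v ->
  a * u / (1 + a * u) <= a * v / (1 + a * v).
Proof.
move=> a0 u0 uv; have v0 := le_trans u0 uv.
have au : 0 < 1 + a * u by rewrite ltr_pwDl// mulr_ge0.
have av : 0 < 1 + a * v by rewrite ltr_pwDl// mulr_ge0.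
rewrite ler_pdivrMr // mulrAC ler_pdivlMr //.
have : a * u <= a * v by rewrite ler_wpM2l.
lra.
Qed.

(** The residual is decreasing in u, and its linear part alone decreases at rate t; the sum only
    helps. *)
Lemma equation_stability (M : nat) (q t u v : R) : 0 <= q -> 0 < t -> 0 <= u -> 0 <= v ->
  t * `|u - v| <=
  `|(1 - t * u - q * \sum_(j < M) (tau j * u / (1 + tau j * u))) -
    (1 - t * v - q * \sum_(j < M) (tau j * v / (1 + tau j * v)))|.
Proof.
move=> q0 t0; wlog uv : u v / u <= v => [H u0 v0|u0 v0].
  have [uv|/ltW vu] := leP u v; first exact: H.
  by rewrite distrC [leRHS]distrC; exact: H.
set S := \sum_(j < M) _; set S' := \sum_(j < M) _.
have SS : S <= S' by apply: ler_sum => j _; exact: frac_ndecr.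
have qS : q * S <= q * S' by rewrite ler_wpM2l.
rewrite distrC ger0_norm ?subr_ge0 //; apply: le_trans (ler_norm _); lra.
Qed.

End Stability.

(** * Convergence of the empirical spectral distributions *)

Section SpectralConvergence.
Local Open Scope sesquilinear_scope.
Local Open Scope complex_scope.
Local Open Scope ring_scope.
Variables (R : realType) (k m : nat -> nat) (c : R).
Hypothesis k_gt0 : forall n, (0 < n)%N -> (0 < k n)%N.
Hypothesis m_oo : m n @[n --> \oo] --> \oo.
Hypothesis c_gt0 : 0 < c.
Hypothesis mnk_c : (m n)%:R / (n ^ k n)%N%:R @[n --> \oo] --> c.
Hypothesis kn_0 : (k n)%:R / n%:R @[n --> \oo] --> (0 : R).
Variable tau : nat -> R.
Hypothesis tau_gt0 : forall j, 0 < tau j.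
Variable m1 : R.
Hypothesis tau_m1 : avg tau (fun x => x ^+ 1) M @[M --> \oo] --> m1.
Variables (d : nat -> measure_display) (T : forall n, measurableType (d n)).
Variables (P : forall n, probability (T n) R) (mu : forall n, probability (Cvec R n) R).
Hypothesis mu_unif : forall n, (0 < n)%N -> uniform_on_sphere (mu n).
Variable y : forall n, 'I_(m n) -> 'I_(k n) -> {RV (P n) >-> Cvec R n}.
Arguments y : clear implicits.
Hypothesis y_law : forall n, (0 < n)%N -> forall alpha l (B : set (Cvec R n)),
  measurable B -> distribution (P n) (y n alpha l) B = mu n B.
Hypothesis y_indep : forall n, (0 < n)%N ->
  mutually_independent (fun al : ('I_(m n) * 'I_(k n))%type => y n al.1 al.2).

Let tau_ge0 j : 0 <= tau j. Proof. exact: ltW. Qed.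

Let cvg_weighted g l : avg tau g M @[M --> \oo] --> l ->
  (n ^ k n)%:R^-1 * \sum_(j < m n) g (tau j) @[n --> \oo] --> c * l.
Proof.
move=> h; rewrite (_ : (fun n => _) = fun n => (m n)%:R / (n ^ k n)%N%:R * avg tau g (m n)).
  apply: cvgM => //; exact: (cvg_comp _ _ m_oo h).
apply/funext => n; rewrite /avg; have [m0|m0] := eqVneq (m n) 0%N.
  by rewrite m0 !big_ord0 !(mul0r, mulr0).
by rewrite [RHS]mulrACA mulfV ?pnatr_eq0 // mul1r.
Qed.

Let m1_ge0 : 0 <= m1.
Proof.
rewrite -(cvg_lim _ tau_m1) //; apply: limr_ge; first exact: cvgP tau_m1.
apply: nearW => M; apply: avg_ge0 => // x x0; exact: exprn_ge0.
Qed.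

Let cvg_total : (n ^ k n)%:R^-1 * \sum_(j < m n) tau j @[n --> \oo] --> c * m1.
Proof. exact: (cvg_weighted tau_m1). Qed.

Let cvg_invN (t : R) : 0 < t -> (t * (n ^ k n)%:R)^-1 @[n --> \oo] --> (0 : R).
Proof.
move=> t0; apply/cvgrPdist_le => e e0; near=> n.
have n0 : (0 < n)%N by near: n; exists 1%N.
have nN : (n <= n ^ k n)%N by rewrite -[X in (X <= _)%N]expn1 leq_pexp2l // k_gt0.
have h : (e * t)^-1 <= n%:R by near: n; exact: nbhs_infty_ger.
have N0 : 0 < t * (n ^ k n)%:R by rewrite mulr_gt0 // ltr0n expn_gt0 n0.
rewrite sub0r normrN gtr0_norm ?invr_gt0 // invf_ple ?posrE //.
rewrite -ler_pdivrMl // -invfM mulrC; apply: le_trans h _.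
by rewrite ler_nat.
Unshelve. all: by end_near. Qed.

Let cvg_kn : (k n)%:R / n.+1%:R @[n --> \oo] --> (0 : R).
Proof.
apply: (@squeeze_cvgr _ _ _ _ (fun=> 0) (fun n => (k n)%:R / n%:R)) => //; last exact: cvg_cst.
near=> n; rewrite divr_ge0 //= ler_wpM2l // lef_pV2 ?posrE ?ltr0n // ?ler_nat //.
near: n; by exists 1%N.
Unshelve. all: by end_near. Qed.

Let Z n : T n -> prodT (Cvec R n) ('I_(m n) * 'I_(k n))%type := joint (y n).

(** The random transform and the deterministic [s] both nearly solve the equation for size n, the
    former with high probability; stability turns two small residuals into a small distance. *)
Lemma cvgp_csample_stieltjes (t s : R) : 0 < t -> 0 <= s ->
  avg tau (fun x => s * x / (1 + s * x)) M @[M --> \oo] --> (1 - t * s) / c ->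
  cvgp P (fun n w => csample_stieltjes tau t (@Z n w)) s.
Proof.
move=> t0 s0 cs e e0 eta eta0.
have C0 : 0 < c * m1 + 1 by rewrite ltr_wpDl // mulr_ge0 // ltW.
(* Two residuals of at most [dl] give a distance of at most 2 dl / t = e. *)
pose dl := e * t / 2; have dl0 : 0 < dl by rewrite divr_gt0 // mulr_gt0.
(* The bound on the exceptional probability tends to c m1 e1 / dl, which this choice keeps strictly
   below [eta]; the 1 also covers m1 = 0. *)
pose e1 := eta * dl / (c * m1 + 1); have e10 : 0 < e1 by rewrite divr_gt0 // mulr_gt0.
pose b n := ((n ^ k n)%:R^-1 * \sum_(j < m n) tau j) *
  (e1 + e1^-1 * (t ^- 2 * (k n)%:R / n.+1%:R) + (t * (n ^ k n)%:R)^-1) / dl.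
have cb : b n @[n --> \oo] --> (c * m1) * (e1 + e1^-1 * (t ^- 2 * 0) + 0) / dl.
  apply: cvgM; last exact: cvg_cst.
  apply: cvgM; first exact: cvg_total.
  apply: cvgD; last exact: cvg_invN.
  apply: cvgD; first exact: cvg_cst.
  apply: cvgM; first exact: cvg_cst.
  rewrite (_ : (fun n => _) = fun n => t ^- 2 * ((k n)%:R / n.+1%:R)).
    apply: cvgM => //; exact: cvg_cst.
  by apply/funext => n; rewrite mulrA.
have b_lt : (c * m1) * (e1 + e1^-1 * (t ^- 2 * 0) + 0) / dl < eta.
  rewrite !mulr0 !addr0 ltr_pdivrMr // /e1 mulrA ltr_pdivrMr // mulrC ltr_pM2l ?mulr_gt0 //.
  by rewrite ltrDl.
have cphi : 1 - t * s - (n ^ k n)%:R^-1 * \sum_(j < m n) (tau j * s / (1 + tau j * s))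
    @[n --> \oo] --> (0 : R).
  rewrite [X in _ --> X](_ : 0 = 1 - t * s - c * ((1 - t * s) / c)); last first.
    by rewrite [c * _]mulrC divfK ?gt_eqF // subrr.
  apply: cvgB; first exact: cvg_cst.
  rewrite (_ : (fun n => _) = fun n => (n ^ k n)%:R^-1 *
      \sum_(j < m n) (s * tau j / (1 + s * tau j))); first exact: (cvg_weighted cs).
  by apply/funext => n; congr (_ * _); apply: eq_bigr => j _; rewrite [tau j * s]mulrC.
near=> n.
have n0 : (0 < n)%N by near: n; exists 1%N.
have bn : b n <= eta by apply/ltW; near: n; exact: cvgr_lt cb _ b_lt.
have phi : `|1 - t * s - (n ^ k n)%:R^-1 * \sum_(j < m n) (tau j * s / (1 + tau j * s))| <= dl.
  rewrite -normrN -sub0r; near: n; by move/cvgrPdist_le : cphi; apply.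
have [B [mB sB PB]] := joint_equation_whp (y_law n0) (y_indep n0) (mu_unif n0) n0 tau_gt0 t0 e10 dl0.
exists B; split => //; last by apply: le_trans PB _; rewrite lee_fin.
move=> w /= h; apply: sB => /=.
rewrite ltNge; apply/negP => h2.
have sn0 := csample_stieltjes_ge0 n0 tau_gt0 t0 (@Z n w).
have N0 : 0 <= (n ^ k n)%:R^-1 :> R by rewrite invr_ge0.
have := equation_stability tau_ge0 (m n) N0 t0 sn0 s0.
move=> /le_trans /(_ (ler_normB _ _)) /le_trans /(_ (lerD h2 phi)).
rewrite -splitr mulrC ler_pM2r // leNgt => /negP; exact.
Unshelve. all: by end_near. Qed.


Hypothesis root : forall t, 0 < t -> exists2 s, 0 <= s &
  avg tau (fun x => s * x / (1 + s * x)) M @[M --> \oo] --> (1 - t * s) / c.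

Let Lam n (w : T n) (f : R -> R) := smean (real_spectrum (csample tau (@Z n w))) f.

Let card_index n : #|{: {ffun 'I_(k n) -> 'I_n}}| = (n ^ k n)%N.
Proof. by rewrite card_ffun !card_ord. Qed.

Let size_spectrum_gt0 n w : (0 < n)%N -> (0 < size (real_spectrum (csample tau (@Z n w))))%N.
Proof.
by move=> n0; rewrite size_real_spectrum ?card_index ?expn_gt0 ?n0 //; exact: psd_csample.
Qed.

Let spectrum_ge0 n w : all (>= 0) (real_spectrum (csample tau (@Z n w))).
Proof. by apply: real_spectrum_ge0; exact: psd_csample. Qed.

Let pmean_Lam : \forall n \near \oo, forall w, pmean (@Lam n w).
Proof.
near=> n => w; apply: pmean_smean => //; apply: size_spectrum_gt0.
by near: n; exists 1%N.
Unshelve. all: by end_near. Qed.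

Let Lam_rpow1 n w t : 0 < t -> @Lam n w (rpow 1 t) = csample_stieltjes tau t (@Z n w).
Proof.
move=> t0; rewrite /Lam smean_spectrum_rpow //=; last exact: psd_csample.
by rewrite mul1mx [X in _ / X%:R]card_index.
Qed.

Let cvgp_rpow1 t : 0 < t -> exists2 s, 0 <= s /\
    avg tau (fun x => s * x / (1 + s * x)) M @[M --> \oo] --> (1 - t * s) / c &
  cvgp P (fun n w => @Lam n w (rpow 1 t)) s.
Proof.
move=> t0; have [s s0 hs] := root t0; exists s => //.
apply: cvgp_near (cvgp_csample_stieltjes t0 s0 hs).
by apply: nearW => n w; exact: Lam_rpow1.
Qed.

(** The normalized trace is at most the total weight over n^k, which tends to c m1; the added 1
    makes [K] an eventual bound. *)
Let K := c * m1 + 1.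

Let K_ge0 : 0 <= K.
Proof. by rewrite addr_ge0 // mulr_ge0 // ltW. Qed.

Let K_gt : c * m1 < K. Proof. by rewrite ltrDl. Qed.

Let tight_Lam : \forall n \near \oo, forall w b, 0 < b -> 1 - K / b <= @Lam n w (ind_le b).
Proof.
near=> n => w b b0; apply: smean_markov => //.
  by apply: size_spectrum_gt0; near: n; exists 1%N.
rewrite smean_spectrum_id; last exact: psd_csample.
rewrite [X in _ / X%:R]card_index mulrC.
have h : (n ^ k n)%:R^-1 * \sum_(j < m n) tau j <= K.
  by apply/ltW; near: n; exact: cvgr_lt cvg_total _ K_gt.
by apply: le_trans h; rewrite ler_wpM2l ?invr_ge0 //; exact: Re_tr_csample.
Unshelve. all: by end_near. Qed.

Lemma limit_moments : exists l : nat -> R, forall p, cvgp P (fun n w => @Lam n w (rpow p 1)) (l p).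
Proof.
have h p : exists lp, cvgp P (fun n w => @Lam n w (rpow p 1)) lp.
  apply: cvgp_rpow_exists => // t t0; by have [s _ cs] := cvgp_rpow1 t0; exists s.
by exists (fun p => projT1 (cid (h p))) => p; exact: projT2 (cid (h p)).
Qed.

Section LimitCdf.
Variable l : nat -> R.
Hypothesis cvg_l : forall p, cvgp P (fun n w => @Lam n w (rpow p 1)) (l p).
Let F := limit_cdf l.

Let F_ge0 x : 0 <= F x. Proof. exact: limit_cdf_ge0 pmean_Lam _ cvg_l _. Qed.
Let F_le1 x : F x <= 1. Proof. exact: limit_cdf_le1 pmean_Lam _ cvg_l _. Qed.
Let F_ndecr : {homo F : x y / x <= y}. Proof. exact: limit_cdf_ndecr pmean_Lam _ cvg_l. Qed.
Let F_neg x : x < 0 -> F x = 0. Proof. exact: limit_cdf_neg pmean_Lam _ cvg_l _. Qed.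
Let F_right : right_cont F. Proof. move=> a e; exact: limit_cdf_right pmean_Lam _ cvg_l _ _. Qed.

Let F_right_continuous : right_continuous F.
Proof.
move=> a; apply/cvgrPdist_lt => e e0.
have [b ab hb] := F_right a e0; near=> x.
have ax : a < x by near: x; exact: nbhs_right_gt.
have xb : x < b by near: x; exact: nbhs_right_lt.
by rewrite distrC ger0_norm ?subr_ge0 ?F_ndecr ?(ltW ax) // ltrBlDl hb.
Unshelve. all: by end_near. Qed.

Let F_Ny : F x @[x --> -oo] --> (0 : R).
Proof.
apply: cvg_near_cst; near=> x; apply: F_neg; near: x; exact: nbhs_ninfty_lt.
Unshelve. all: by end_near. Qed.

Let F_y : F x @[x --> +oo] --> (1 : R).
Proof.
apply/cvgrPdist_le => e e0; near=> x.
have x0 : 0 < x by near: x; exact: nbhs_pinfty_gt.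
have xK : K / e <= x by near: x; apply: nbhs_pinfty_ge; exact: num_real.
rewrite ger0_norm ?subr_ge0 // lerBlDr.
have h : 1 - K / x <= F x by exact: limit_cdf_tight pmean_Lam _ cvg_l _ K_ge0 tight_Lam _ x0.
suff : K / x <= e by move: h; set q := K / x; lra.
by rewrite ler_pdivrMr // mulrC -ler_pdivrMr.
Unshelve. all: by end_near. Qed.

HB.instance Definition _ := isCumulative.Build R _ R F F_ndecr F_right_continuous.
HB.instance Definition _ := isCumulativeBounded.Build R 0 1 F F_Ny F_y.

Let A n (w : T n) := sample_mx tau (fun al l => y n al l w : 'cV[R[i]]_n).

Let cm_A n : cm_mx (@A n).
Proof.
move=> a b; apply: (@cm_ext _ _ _ _ (fun w => \sum_(al < m n) (tau al)%:C *
  ((\prod_(q < k n) (y n al q w : 'cV[R[i]]_n) ((enum_val a : {ffun 'I_(k n) -> 'I_n}) q) 0) *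
   (\prod_(q < k n) (y n al q w : 'cV[R[i]]_n) ((enum_val b : {ffun 'I_(k n) -> 'I_n}) q) 0)^*))).
  by move=> w; rewrite /A /sample_mx summxE; apply: eq_bigr => al _; rewrite !mxE big_ord1 !mxE.
have cy al q j : cm (fun w => (y n al q w : 'cV[R[i]]_n) j 0).
  have [h1 h2] := cm_entry R j.
  by split; [apply: (measurableT_comp h1)|apply: (measurableT_comp h2)]; exact: measurable_funPT.
apply: cm_sum => al; apply: cmM; first exact: cm_cst.
by apply: cmM; [|apply: cm_conj]; apply: cm_prod => q; exact: cy.
Qed.

Let psd_A n w : psd (@A n w).
Proof. by apply: psd_sum => al _; apply: psd_rank1; rewrite ler0c ltW. Qed.

(** The exceptional event lies in the union of the small set from [small_levy], which concerns the
    clamped sample, and the null set off which clamping changes nothing. *)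
Lemma levy_limit_cdf : cvg0_in_probability P (fun n w => levy_dist (esd (@A n w)) F).
Proof.
move=> e e0; have e20 : 0 < e / 2 by rewrite divr_gt0.
have e2e : e / 2 <= e by rewrite ler_pdivrMr // ler_peMr ?(ltW e0) // ler1n.
have lev := small_levy pmean_Lam cvg_l K_ge0 tight_Lam e20.
have bad eta : 0 < eta -> \forall n \near \oo,
    (P n [set w | (e < `|levy_dist (esd (@A n w)) F|)%R] <= eta%:E)%E.
  move=> eta0; near=> n; have n0 : (0 < n)%N by near: n; exists 1%N.
  have [B [mB sB PB]] : exists B : set (T n), [/\ measurable B,
      [set w | ~ forall x, F (x - e / 2) - e / 2 <= @Lam n w (ind_le x) /\
         @Lam n w (ind_le x) <= F (x + e / 2) + e / 2] `<=` B & (P n B <= eta%:E)%E].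
    by near: n; exact: lev.
  have [B' [mB' PB' hB']] := small_unclamped (y_law n0) (y_indep n0) (mu_unif n0) tau.
  apply: (@le_trans _ _ (P n (B `|` B'))).
    apply: le_measure; rewrite ?inE.
    - apply: measurable_levy => //; by rewrite card_index expn_gt0 n0.
    - exact: measurableU.
    - move=> w /= ew; have [hb'|hb'] := pselect (B' w); [by right|left].
      apply: sB => /= h; move: ew; apply/negP; rewrite -leNgt ger0_norm ?levy_dist_ge0 //.
      apply: (@le_trans _ _ (e / 2)) => //.
      have hA : @A n w = csample tau (@Z n w) by rewrite (hB' w hb').
      rewrite hA; apply: levy_dist_le; first exact: e20.
      move=> x; rewrite (esdE (psd_csample tau_gt0 _)).
      exact: h.
  have PB'0 : (P n B' <= 0)%E by rewrite PB'.
  apply: le_trans (measureU2 _ mB mB') _; rewrite -[leRHS]adde0; exact: leeD PB PB'0.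
apply/fine_cvgP; split.
  apply: filterS (bad 1 ltr01) => n h.
  by rewrite ge0_fin_numE ?measure_ge0 //; apply: le_lt_trans h (ltry _).
apply/cvgrPdist_le => eta eta0; apply: filterS (bad eta eta0) => n h /=.
rewrite sub0r normrN ger0_norm ?fine_ge0 ?measure_ge0 //.
rewrite -lee_fin fineK // ge0_fin_numE ?measure_ge0 //; exact: le_lt_trans h (ltry _).
Unshelve. all: by end_near. Qed.

Section Identity.
Hypothesis tau1 : forall j, tau j = 1.

Let pmp : pmean (mp_mean c) := pmean_mp_mean c_gt0.

(** With unit weights every average is r / (1 + r), so the transform of the Marchenko-Pastur law
    solves the limiting equation; uniqueness of limits in probability identifies all inverse
    powers. *)
Let l_mp p : l p = mp_mean c (rpow p 1).
Proof.
apply: (cvgp_unique (cvg_l p)); apply: cvgp_rpow_transfer => // t t0.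
have [r -> [r0 hr]] := mp_mean_rpow1 c_gt0 t0.
apply: cvgp_near (cvgp_csample_stieltjes t0 r0 _); first by apply: nearW => n w; exact: Lam_rpow1.
have -> : (1 - t * r) / c = r / (1 + r).
  by move/eqP: hr; rewrite subr_eq0 => /eqP ->; rewrite mulrAC mulfV ?mul1r ?gt_eqF.
apply: cvg_near_cst; near=> M; rewrite /avg.
under eq_bigr do rewrite tau1 mulr1.
by apply: (@avg_cst R tau (r / (1 + r)) M); near: M; exists 1%N.
Unshelve. all: by end_near. Qed.

Let lpoly_mp p : lpoly l p = mp_mean c (upoly p).
Proof.
rewrite (_ : upoly p = fun x => \sum_(i < size p) p`_i * rpow i 1 x); last first.
  by apply/funext => x; exact: upolyE.
rewrite (pmean_sum pmp (size p) (fun i => p`_i) (g := fun i => rpow i 1)).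
  by apply: eq_bigr => i _; rewrite l_mp.
by move=> i; exact: bmp_rpow.
Qed.

(** A single polynomial lies between indicators at nearby points, and both functionals agree on it.
    Right-continuity of each side then closes the gap to the right of x. *)
Lemma limit_cdf_mp x : (F x)%:E = mp_law c `]-oo, x].
Proof.
rewrite -mp_mean_ind //; congr (_%:E); have [Lc LD _ Lle] := pmp.
have [x0|x0] := ltP x 0.
  rewrite F_neg // -(Lc 0); apply/le_anti/andP.
  by split; apply: Lle; try exact: bmp_ind; try exact: bmp_cst;
    move=> z z0; rewrite /ind_le (leNgt z) (lt_le_trans x0 z0).
apply/le_anti/andP; split; apply/ler_addgt0Pl => e e0; have e20 : 0 < e / 2 by rewrite divr_gt0.
- have [b xb hb] := mp_mean_ind_right c_gt0 x0 e20.
  have [xa ab] := midf_lt xb.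
  have [p [_ pb Fp _]] := limit_cdf_sandwich pmean_Lam cvg_l (le_trans x0 (ltW xa)) ab e20.
  apply: le_trans (Fp _ xa) _; rewrite lpoly_mp.
  apply: le_trans (Lle _ _ (bmp_upoly p) (bmpD (bmp_ind b) (bmp_cst (e / 2))) pb) _.
  rewrite (LD _ _ (bmp_ind b) (bmp_cst _)) Lc.
  apply: le_trans (lerD hb (lexx (e / 2))) _.
  by rewrite [X in _ <= X + _]splitr -addrA addrC.
- have [b xb hb] := F_right x e20.
  have [xa ab] := midf_lt xb.
  have [p [xp _ _ pF]] := limit_cdf_sandwich pmean_Lam cvg_l x0 xa e20.
  apply: le_trans (Lle _ _ (bmp_ind x) (bmp_upoly p) xp) _; rewrite -lpoly_mp.
  apply: le_trans pF _; apply: le_trans (lerD (ltW (hb _ ab)) (lexx (e / 2))) _.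
  by rewrite [X in _ <= X + _]splitr -addrA addrC.
Qed.

End Identity.

Lemma limit_cdf_spec : exists G : cumulativeBounded (0 : R) (1 : R),
  cvg0_in_probability P (fun n w => levy_dist (esd (@A n w)) G) /\
  ((forall j, tau j = 1) -> forall x : R, (G x)%:E = mp_law c `]-oo, x]).
Proof. by exists F; split; [exact: levy_limit_cdf|exact: limit_cdf_mp]. Qed.

End LimitCdf.

End SpectralConvergence.

Theorem corollary1p1 (R : realType)
  (k m : nat -> nat) (c : R)
  (k_gt0 : forall n, (0 < n)%N -> (0 < k n)%N)
  (m_gt0 : forall n, (0 < n)%N -> (0 < m n)%N)
  (k_oo : k n @[n --> \oo] --> \oo)
  (m_oo : m n @[n --> \oo] --> \oo)
  (c_gt0 : 0 < c)
  (mnk_c : (m n)%:R / (n ^ k n)%N%:R @[n --> \oo] --> c)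
  (kn_0 : (k n)%:R / n%:R @[n --> \oo] --> (0 : R))
  (tau : nat -> R) (tau_gt0 : forall j, 0 < tau j)
  (mom : nat -> R)
  (tau_mom : forall q, (0 < q)%N ->
     M%:R^-1 * (\sum_(j < M) tau j ^+ q) @[M --> \oo] --> mom q)
  (A : R) (A_gt0 : 0 < A)
  (mom_le : forall q, (0 < q)%N -> `|mom q| <= A ^+ q * q%:R ^+ q)
  (d : nat -> measure_display) (T : forall n, measurableType (d n))
  (P : forall n, probability (T n) R)
  (mu : forall n, probability (Cvec R n) R)
  (mu_unif : forall n, (0 < n)%N -> uniform_on_sphere (mu n))
  (y : forall n, 'I_(m n) -> 'I_(k n) -> {RV (P n) >-> Cvec R n})
  (y_law : forall n, (0 < n)%N -> forall alpha l (B : set (Cvec R n)),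
     measurable B -> distribution (P n) (y n alpha l) B = mu n B)
  (y_indep : forall n, (0 < n)%N ->
     mutually_independent
       (fun al : ('I_(m n) * 'I_(k n))%type => y n al.1 al.2)) :
  exists F : cumulativeBounded (0 : R) (1 : R),
    cvg0_in_probability P (fun n w =>
      levy_dist
        (esd (sample_mx tau (fun alpha l => y n alpha l w : 'cV[R[i]]_n))) F) /\
    ((forall j, tau j = 1) ->
       forall x : R, (F x)%:E = mp_law c `]-oo, x]).
Proof.
have tau_ge0 j : 0 <= tau j by exact: ltW.
have avg_mom q : (0 < q)%N -> avg tau (fun x => x ^+ q) M @[M --> \oo] --> mom q.
  exact: tau_mom.
have root t (t_gt0 : 0 < t) :=
  limit_equation_root tau_ge0 avg_mom A_gt0 mom_le c_gt0 t_gt0.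
have tau_m1 := avg_mom 1%N isT.
have [l cvg_l] := limit_moments k_gt0 m_oo c_gt0 mnk_c kn_0 tau_gt0 tau_m1 mu_unif y_law y_indep root.
exact (limit_cdf_spec k_gt0 m_oo c_gt0 mnk_c kn_0 tau_gt0 tau_m1 mu_unif y_law y_indep cvg_l).
Qed.
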